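(* Let $\Omega=(a,b)\times(c,d)$, $T>0$, $\alpha,\beta\in(1,2]$, let $\Omega$ be triangulated by triangles $D^1,\dots,D^K$, let $V_h$ be the space of piecewise polynomials of degree at most $N$, and let $B$ be the discrete bilinear form with central fluxes defined in the context. The numerical scheme with central flux $$B(u_h,\mathbf p_h,\mathbf q_h;v,\boldsymbol\phi,\boldsymbol\pi)=\int_0^T (f,v)_\Omega\,dt\qquad\text{for all }(v,\boldsymbol\phi,\boldsymbol\pi)\in H^1(0,T;V_h)\times(L^2(0,T;V_h))^2\times(L^2(0,T;V_h))^2$$ is $L^2$ stable in the following sense. Let $(u_h,\mathbf p_h,\mathbf q_h)$ and $(\widetilde u_h,\widetilde{\mathbf p}_h,\widetilde{\mathbf q}_h)$, both in $H^1(0,T;V_h)\times(L^2(0,T;V_h))^2\times(L^2(0,T;V_h))^2$, both satisfy the scheme with the same $f$ (with possibly different initial values at $t=0$), and put $e_{u_h}=u_h-\widetilde u_h$, $e_{\mathbf p_h}=(e_{p_h^x},e_{p_h^y})=\mathbf p_h-\widetilde{\mathbf p}_h$, $e_{\mathbf q_h}=\mathbf q_h-\widetilde{\mathbf q}_h$. Then $\|e_{u_h}(\cdot,t)\|_{L^2(\Omega)}\le\|e_{u_h}(\cdot,0)\|_{L^2(\Omega)}$ for all $t\in(0,T)$, and for all $t\in(0,T)$ $$\begin{aligned}\|e_{u_h}(\cdot,t)\|_{L^2(\Omega)}^2=\ &\|e_{u_h}(\cdot,0)\|_{L^2(\Omega)}^2\\&-2\cos\big((\tfrac{\alpha}{2}-1)\pi\big)\int_0^t\int_c^d\|e_{p_h^x}(\cdot,y,\tau)\|_{H^{\frac{\alpha}{2}-1}}^2\,dy\,d\tau\\&-2\cos\big((\tfrac{\beta}{2}-1)\pi\big)\int_0^t\int_a^b\|e_{p_h^y}(x,\cdot,\tau)\|_{H^{\frac{\beta}{2}-1}}^2\,dx\,d\tau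 .\end{aligned}$$
   Context: Continuous problem. The scheme discretizes $\partial_t u=\partial_x\,{}_aD_x^{\alpha-2}\partial_x u+\partial_y\,{}_cD_y^{\beta-2}\partial_y u+f$ on $\Omega\times[0,T]$, $\Omega=(a,b)\times(c,d)$, with $u=0$ on $\partial\Omega$, written as a system with $\mathbf p=(p^x,p^y)=\nabla u$, $\mathbf q=({}_aD_x^{\alpha-2}p^x,{}_cD_y^{\beta-2}p^y)$, $\partial_tu=\nabla\cdot\mathbf q+f$, where $f$ is a given source term. Fractional integrals. For $\mu>0$, ${}_aD_x^{-\mu}w(x)=\frac1{\Gamma(\mu)}\int_a^x(x-\xi)^{\mu-1}w(\xi)\,d\xi$ (and ${}_aD_x^{0}w=w$). We write $\frac{\partial^{\alpha-2}p}{\partial x^{\alpha-2}}={}_aD_x^{\alpha-2}p$ (acting in $x$, starting at $a$) and $\frac{\partial^{\beta-2}p}{\partial y^{\beta-2}}={}_cD_y^{\beta-2}p$ (acting in $y$, starting at $c$). Negative norms. For $\mu\ge0$, $\|w\|_{H^{-\mu}}=\||\omega|^{-\mu}\widehat w\|_{L^2(\mathbb R)}$, where $\widehat w$ is the Fourier transform of $w$ (normalized to be unitary on $L^2(\mathbb R)$). Functions defined on a bounded interval ($(a,b)$ in $x$, $(c,d)$ in $y$) are extended by zero to $\mathbb R$. Mesh. $\Omega=\bigcup_{k=1}^KD^k$ is a space-filling triangulation into geometry-conforming, nonoverlapping planar triangles. $\Gamma$ is the union of the boundaries of the $D^k$, $\Gamma_i$ the set of interior edges (each counted once), $\Gamma_b=\partial\Omega$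 the set of boundary edges, $\Gamma=\Gamma_i\cup\Gamma_b$. $V_h=\{v:\ v|_{D^k}\text{ is a polynomial in two variables of total degree}\le N,\ k=1,\dots,K\}$. $(\cdot,\cdot)_\Omega=\sum_k(\cdot,\cdot)_{D^k}$ is the $L^2$ inner product, and $\nabla$, $\nabla\cdot$ are taken elementwise. Traces. On an interior edge the traces from the two adjacent triangles are marked $-$ and $+$ and $\mathbf n^\pm$ are the corresponding outward unit normals. For scalars $u$ and vectors $\mathbf u$: on $\Gamma_i$, $[u]=\mathbf n^+u^++\mathbf n^-u^-$ and $[\mathbf u]=\mathbf n^+\cdot\mathbf u^++\mathbf n^-\cdot\mathbf u^-$; on $\Gamma_b$, $[u]=\mathbf nu$ and $[\mathbf u]=\mathbf n\cdot\mathbf u$ with $\mathbf n$ the outward unit normal of $\Omega$. Central fluxes. $\widehat u_h=\frac{u_h^++u_h^-}2$ and $\widehat{\mathbf q}_h=\frac{\mathbf q_h^++\mathbf q_h^-}2$ on $\Gamma_i$; $\widehat u_h=0$ and $\widehat{\mathbf q}_h=\mathbf q_h$ (the interior trace) on $\Gamma_b$. Bilinear form. $$\begin{aligned}B(u_h,\mathbf p_h,\mathbf q_h;v,\boldsymbol\phi,\boldsymbol\pi)=&\int_0^T(\partial_tu_h,v)_\Omega\,dt+\int_0^T(\mathbf q_h,\nabla v)_\Omega\,dt+\int_0^T(\mathbf q_h,\boldsymbol\phi)_\Omega\,dt\\&-\int_0^T\Big(\Big(\tfrac{\partial^{\alpha-2}p_h^x}{\partial x^{\alpha-2}},\tfrac{\partial^{\beta-2}p_h^y}{\partial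 y^{\beta-2}}\Big),\boldsymbol\phi\Big)_\Omega dt+\int_0^T(\mathbf p_h,\boldsymbol\pi)_\Omega\,dt+\int_0^T(u_h,\nabla\cdot\boldsymbol\pi)_\Omega\,dt\\&-\int_0^T\Big(\oint_\Gamma\widehat{\mathbf q}_h\cdot[v]\,ds+\oint_{\Gamma_i}\widehat u_h[\boldsymbol\pi]\,ds\Big)dt.\end{aligned}$$ *)

(* Defs.v *)
From HB Require Import structures.
From mathcomp Require Import all_boot all_order all_algebra.
From mathcomp Require Import all_classical all_reals all_analysis.
From mathcomp.real_closed Require complex.
Import Order.TTheory GRing.Theory Num.Theory.
Import numFieldNormedType.Exports.

Set Implicit Arguments.
Unset Strict Implicit.
Unset Printing Implicit Defensive.

Local Open Scope classical_set_scope.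
Local Open Scope ring_scope.

(** * Fractional integrals and negative-order norms *)

Definition Gamma {R : realType} (s : R) : R :=
  \int[lebesgue_measure]_(t in `]0, +oo[) (t `^ (s - 1) * expR (- t)).

(* [frac_int a mu w x] is the left Riemann-Liouville integral of order [mu >= 0]
   of [w], i.e. the "derivative" of order [- mu], with base point [a]. *)
Definition frac_int {R : realType} (a mu : R) (w : R -> R) (x : R) : R :=
  if mu == 0 then w x
  else (Gamma mu)^-1 *
       \int[lebesgue_measure]_(xi in `[a, x]) ((x - xi) `^ (mu - 1) * w xi).

(* Integral form of the unitary Fourier transform, with kernel
   [exp (- i omega x)]; it is only applied to bounded, compactly supported
   functions, which are in [L^1]. *)
Definition fourier {R : realType} (w : R -> R) (omega : R) : complex.complex R :=
  complex.Complex
    ((Num.sqrt (2 * pi))^-1 *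
       \int[lebesgue_measure]_x (cos (omega * x) * w x))
    (- ((Num.sqrt (2 * pi))^-1 *
       \int[lebesgue_measure]_x (sin (omega * x) * w x))).

Definition Hneg_norm {R : realType} (mu : R) (w : R -> R) : \bar R :=
  Lnorm lebesgue_measure 2%:E
    (fun omega => (`|omega| `^ (- mu)
                   * complex.ComplexField.Normc.normc (fourier w omega))%:E).

(** * Triangles and triangulations of a rectangle *)

Definition triangle (R : realType) := 'I_3 -> R * R.

Definition barycenter {R : realType} (V : triangle R) (l : 'I_3 -> R) : R * R :=
  (\sum_i l i * (V i).1, \sum_i l i * (V i).2).

(* Convex hull of the vertices of [V] whose index lies in [S]; it is empty when
   [S] is. *)
Definition hull {R : realType} (V : triangle R) (S : set 'I_3) : set (R * R) :=
  [set z | exists l : 'I_3 -> R,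
     [/\ forall i, 0 <= l i, \sum_i l i = 1,
         forall i, ~ S i -> l i = 0 & z = barycenter V l]].

Definition closed_triangle {R : realType} (V : triangle R) : set (R * R) :=
  hull V setT.

Definition open_triangle {R : realType} (V : triangle R) : set (R * R) :=
  [set z | exists l : 'I_3 -> R,
     [/\ forall i, 0 < l i, \sum_i l i = 1 & z = barycenter V l]].

(* Twice the signed area. *)
Definition area2 {R : realType} (V : triangle R) : R :=
  ((V 1).1 - (V 0).1) * ((V 2%:R).2 - (V 0).2)
  - ((V 2%:R).1 - (V 0).1) * ((V 1).2 - (V 0).2).

(* The edges of a triangle are numbered by the opposite vertex; index
   arithmetic in ['I_3] is modulo 3. *)
Definition edge {R : realType} (V : triangle R) (i : 'I_3) : set (R * R) :=
  hull V [set j | j != i].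

Definition edge_vec {R : realType} (V : triangle R) (i : 'I_3) : R * R :=
  V (i + 2%:R) - V (i + 1).

Definition edge_length {R : realType} (V : triangle R) (i : 'I_3) : R :=
  Num.sqrt ((edge_vec V i).1 ^+ 2 + (edge_vec V i).2 ^+ 2).

(* Outward unit normal on edge [i], for either orientation of [V]: the edge
   vector is rotated by a right angle, and the sign is chosen so that the
   opposite vertex lies on the negative side. *)
Definition normal {R : realType} (V : triangle R) (i : 'I_3) : R * R :=
  let tau := edge_vec V i in
  let w := V i - V (i + 1) in
  let s := - Num.sg (tau.2 * w.1 - tau.1 * w.2) / edge_length V i in
  (s * tau.2, - (s * tau.1)).

(* Arc-length integral over edge [i]. *)
Definition edge_int {R : realType} (V : triangle R) (i : 'I_3)
    (g : R * R -> R) : R :=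
  edge_length V i *
  \int[lebesgue_measure]_(s in `[0, 1])
    g ((V (i + 1)).1 + s * (edge_vec V i).1,
       (V (i + 1)).2 + s * (edge_vec V i).2).

Definition closed_rect {R : realType} (a b c d : R) : set (R * R) :=
  `[a, b] `*` `[c, d].

Definition rect_boundary {R : realType} (a b c d : R) : set (R * R) :=
  closed_rect a b c d `\` (`]a, b[ `*` `]c, d[).

(* Two closed triangles of a conforming mesh meet in the convex hull of their
   common vertices: nothing, a common vertex or a common edge. *)
Definition triangulation {R : realType} (a b c d : R) (K : nat)
    (D : 'I_K -> triangle R) : Prop :=
  [/\ forall k, area2 (D k) != 0,
      \bigcup_k closed_triangle (D k) = closed_rect a b c d,
      forall k l, k != l -> open_triangle (D k) `&` open_triangle (D l) = set0 &
      forall k l, k != l ->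
        closed_triangle (D k) `&` closed_triangle (D l)
        = hull (D k) [set i | exists j, D k i = D l j]].

(** * The broken polynomial space *)

(* In [p : {poly {poly R}}] the inner variable is [x], the outer one is [y]:
   [p`_j`_i] is the coefficient of x^i y^j. *)
Definition ev {R : realType} (p : {poly {poly R}}) (z : R * R) : R :=
  p.[z.2%:P].[z.1].

Definition dx {R : realType} (p : {poly {poly R}}) : {poly {poly R}} :=
  map_poly (@deriv R) p.

Definition dy {R : realType} (p : {poly {poly R}}) : {poly {poly R}} := p^`().

Definition total_degree_le {R : realType} (N : nat) (p : {poly {poly R}}) :=
  forall i j, (N < i + j)%N -> p`_j`_i = 0.

(* A broken polynomial is given by its polynomial on each triangle, so that its
   traces on an edge are plain evaluations. *)
Definition broken (R : realType) (K : nat) := 'I_K -> {poly {poly R}}.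

Definition Vh {R : realType} (K N : nat) : set (broken R K) :=
  [set v | forall k, total_degree_le N (v k)].

(* The function on the plane defined by a broken polynomial, extended by zero;
   the open triangles being disjoint, at most one term is nonzero. On the mesh
   skeleton, which is a null set, the value is 0. *)
Definition to_fun {R : realType} (K : nat) (D : 'I_K -> triangle R)
    (v : broken R K) (x y : R) : R :=
  \sum_(k < K) \1_(open_triangle (D k)) (x, y) * ev (v k) (x, y).

(* [L^2] inner product of functions given triangle by triangle. *)
Definition ip {R : realType} (K : nat) (D : 'I_K -> triangle R)
    (g h : 'I_K -> R * R -> R) : R :=
  \sum_(k < K) \int[(lebesgue_measure \x lebesgue_measure)%E]_(z in
                     open_triangle (D k)) (g k z * h k z).

Definition ipv {R : realType} (K : nat) (D : 'I_K -> triangle R)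
    (g h : ('I_K -> R * R -> R) * ('I_K -> R * R -> R)) : R :=
  ip D g.1 h.1 + ip D g.2 h.2.

Definition evb {R : realType} (K : nat) (v : broken R K) : 'I_K -> R * R -> R :=
  fun k => ev (v k).

Definition L2_norm {R : realType} (K : nat) (D : 'I_K -> triangle R)
    (v : broken R K) : R :=
  Num.sqrt (ip D (evb v) (evb v)).

(** * Time-dependent broken polynomials *)

Definition t_field (R : realType) (K : nat) := R -> broken R K.

Definition vt_field (R : realType) (K : nat) := (t_field R K * t_field R K)%type.

Definition L2_time {R : realType} (T : R) (f : R -> R) : Prop :=
  measurable_fun `[0, T] f /\
  lebesgue_measure.-integrable `[0, T] (fun t => (f t ^+ 2)%:E).

(* [f] is the continuous representative of an element of [H^1(0,T)], i.e. an
   indefinite integral of a function in [L^2(0,T)]. *)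
Definition H1_time {R : realType} (T : R) (f : R -> R) : Prop :=
  exists g : R -> R, L2_time T g /\
    forall t, t \in `[0, T] ->
      f t = f 0 + \int[lebesgue_measure]_(s in `[0, t]) g s.

(* [V_h] being finite dimensional, all norms on it are equivalent and
   [L^2(0,T;V_h)] and [H^1(0,T;V_h)] are defined coefficientwise. *)
Definition L2_Vh {R : realType} (T : R) (K N : nat) : set (t_field R K) :=
  [set w | (forall t, t \in `[0, T] -> Vh N (w t)) /\
           forall k i j, L2_time T (fun t => (w t k)`_j`_i)].

Definition H1_Vh {R : realType} (T : R) (K N : nat) : set (t_field R K) :=
  [set w | (forall t, t \in `[0, T] -> Vh N (w t)) /\
           forall k i j, H1_time T (fun t => (w t k)`_j`_i)].

Definition L2_Vh2 {R : realType} (T : R) (K N : nat) : set (vt_field R K) :=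
  L2_Vh T N `*` L2_Vh T N.

(* Pointwise time derivative; for [u] in [H^1(0,T;V_h)] it exists at almost
   every [t] and coincides with the weak derivative. *)
Definition dt {R : realType} (K : nat) (u : t_field R K) (t : R) :
    'I_K -> R * R -> R :=
  fun k z => derive1 (fun s : R => ev (u s k) z) t.

Definition evv {R : realType} (K : nat) (p : vt_field R K) (t : R) :
    ('I_K -> R * R -> R) * ('I_K -> R * R -> R) :=
  (evb (p.1 t), evb (p.2 t)).

Definition grad {R : realType} (K : nat) (v : broken R K) :
    ('I_K -> R * R -> R) * ('I_K -> R * R -> R) :=
  (fun k => ev (dx (v k)), fun k => ev (dy (v k))).

Definition divg {R : realType} (K : nat) (p : vt_field R K) (t : R) :
    'I_K -> R * R -> R :=
  fun k => ev (dx (p.1 t k) + dy (p.2 t k)).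

(* The pair of fractional derivatives of orders [alpha - 2] in [x] and
   [beta - 2] in [y]. *)
Definition fracD {R : realType} (a c alpha beta : R) (K : nat)
    (D : 'I_K -> triangle R) (p : vt_field R K) (t : R) :
    ('I_K -> R * R -> R) * ('I_K -> R * R -> R) :=
  (fun _ z => frac_int a (2 - alpha) (fun x => to_fun D (p.1 t) x z.2) z.1,
   fun _ z => frac_int c (2 - beta) (fun y => to_fun D (p.2 t) z.1 y) z.2).

(** * Edge terms with central fluxes *)

Definition dot {R : realType} (v w : R * R) : R := v.1 * w.1 + v.2 * w.2.

Definition ev2 {R : realType} (K : nat) (p : vt_field R K) (t : R) (k : 'I_K)
    (z : R * R) : R * R :=
  (ev (p.1 t k) z, ev (p.2 t k) z).

(* Sum over the interior edges of the integral of [g k i l j], where the edge is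
   edge [i] of triangle [k] and edge [j] of triangle [l]; the condition [k < l]
   counts each edge once, the [-] side being triangle [k] and the [+] side
   triangle [l]. *)
Definition interior_edges_int {R : realType} (K : nat) (D : 'I_K -> triangle R)
    (g : 'I_K -> 'I_3 -> 'I_K -> 'I_3 -> R * R -> R) : R :=
  \sum_(k < K) \sum_(l < K | (k < l)%N)
  \sum_(i < 3) \sum_(j < 3 | `[< edge (D k) i = edge (D l) j >])
    edge_int (D k) i (g k i l j).

Definition boundary_edges_int {R : realType} (a b c d : R) (K : nat)
    (D : 'I_K -> triangle R) (g : 'I_K -> 'I_3 -> R * R -> R) : R :=
  \sum_(k < K) \sum_(i < 3 | `[< edge (D k) i `<=` rect_boundary a b c d >])
    edge_int (D k) i (g k i).

Definition jump {R : realType} (K : nat) (D : 'I_K -> triangle R)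
    (v : broken R K) (k : 'I_K) (i : 'I_3) (l : 'I_K) (j : 'I_3) (z : R * R) :
    R * R :=
  ev (v k) z *: (normal (D k) i : R^o * R^o)
  + ev (v l) z *: (normal (D l) j : R^o * R^o).

Definition vjump {R : realType} (K : nat) (D : 'I_K -> triangle R)
    (p : vt_field R K) (t : R) (k : 'I_K) (i : 'I_3) (l : 'I_K) (j : 'I_3)
    (z : R * R) : R :=
  dot (normal (D k) i) (ev2 p t k z) + dot (normal (D l) j) (ev2 p t l z).

Definition avg {R : realType} (K : nat) (u : broken R K) (k l : 'I_K)
    (z : R * R) : R :=
  (ev (u k) z + ev (u l) z) / 2.

Definition vavg {R : realType} (K : nat) (q : vt_field R K) (t : R) (k l : 'I_K)
    (z : R * R) : R * R :=
  (avg (q.1 t) k l z, avg (q.2 t) k l z).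

Definition q_edge_terms {R : realType} (a b c d : R) (K : nat)
    (D : 'I_K -> triangle R) (q : vt_field R K) (v : t_field R K) (t : R) : R :=
  interior_edges_int D
    (fun k i l j z => dot (vavg q t k l z) (jump D (v t) k i l j z))
  + boundary_edges_int a b c d D
    (fun k i z => dot (ev2 q t k z) (normal (D k) i) * ev (v t k) z).

Definition u_edge_terms {R : realType} (K : nat)
    (D : 'I_K -> triangle R) (u : t_field R K) (pi_ : vt_field R K) (t : R) : R :=
  interior_edges_int D
    (fun k i l j z => avg (u t) k l z * vjump D pi_ t k i l j z).

(** * The scheme *)

Definition Bform {R : realType} (a b c d T alpha beta : R) (K : nat)
    (D : 'I_K -> triangle R) (u : t_field R K) (p q : vt_field R K)
    (v : t_field R K) (phi pi_ : vt_field R K) : R :=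
  let mu := @lebesgue_measure R in
  \int[mu]_(t in `[0, T]) ip D (dt u t) (evb (v t))
  + \int[mu]_(t in `[0, T]) ipv D (evv q t) (grad (v t))
  + \int[mu]_(t in `[0, T]) ipv D (evv q t) (evv phi t)
  - \int[mu]_(t in `[0, T]) ipv D (fracD a c alpha beta D p t) (evv phi t)
  + \int[mu]_(t in `[0, T]) ipv D (evv p t) (evv pi_ t)
  + \int[mu]_(t in `[0, T]) ip D (evb (u t)) (divg pi_ t)
  - \int[mu]_(t in `[0, T])
      (q_edge_terms a b c d D q v t + u_edge_terms D u pi_ t).

(* The source term [f] takes the time first, then the point of the plane. *)
Definition solves_scheme {R : realType} (a b c d T alpha beta : R) (K N : nat)
    (D : 'I_K -> triangle R) (f : R -> R * R -> R)
    (u : t_field R K) (p q : vt_field R K) : Prop :=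
  forall (v : t_field R K) (phi pi_ : vt_field R K),
    H1_Vh T N v -> L2_Vh2 T N phi -> L2_Vh2 T N pi_ ->
    Bform a b c d T alpha beta D u p q v phi pi_
    = \int[lebesgue_measure]_(t in `[0, T]) ip D (fun _ => f t) (evb (v t)).

(* Main.v *)
(* Write e for the differences of the two solutions. Testing both schemes with
   (v, phi, pi) = eta (e_u, - e_p, e_q), where eta is a scalar function of time,
   and subtracting, all terms without derivative of e_u and without fractional
   integral cancel: on each triangle the divergence theorem turns
   (e_q, grad e_u) + (e_u, div e_q) into the boundary integral of (e_q . n) e_u,
   and on an interior edge, which conformity makes an edge of exactly two
   triangles lying on opposite sides, the central fluxes produce the sum of
   these two boundary terms. Letting eta tend to the indicator of [0, t],
     int_0^t (d_t e_u, e_u) + int_0^t (D e_p, e_p) = 0,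
   and the product rule for absolutely continuous functions gives the energy
   identity once the quadratic form of the fractional integral is known.
   That form is computed slice by slice: if w is bounded, compactly supported
   and has finitely many discontinuities, then for 0 <= m < 1
     int (D^{-m} w) w = cos (m pi / 2) int |om|^{-m} |w^(om)|^2.
   The autocorrelation of w is the inverse cosine transform of the power
   spectrum |w^|^2, which is integrable by testing against Poisson kernels;
   the kernel s^{m-1} exp(- e s) of the fractional integral has cosine transform
   Gamma(m) (e^2 + om^2)^{-m/2} cos (m atan (om / e)), found by solving an ODE
   in om, and e tends to 0. *)

(* The scheme only yields identities integrated over [[0, T]], and the test component v must be H^1
   in time, so a fixed time t is reached through continuous ramps. The source f carries no
   regularity: both solutions are tested with the same v, and the two right-hand sides are one and
   the same number. Real integrals are total, so splitting a sum costs an integrability proof. To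
   pay this once, every term is made a bilinear form on V_h; expanding it in monomials leaves
   products of two L^2(0,T) coefficients. A slice of a broken polynomial jumps where it crosses
   triangle edges, so its transform need not be integrable and Fourier inversion is not directly
   available. Exponential damping replaces inversion by Poisson integrals, which converge at each
   continuity point; finiteness of the set of jumps makes this almost everywhere. The constant cos
   (m pi / 2) is the limit of cos (m atan (om / e)); with m = 2 - alpha it is cos ((alpha / 2 - 1)
   pi), by parity. *)
Require Import Defs.
From HB Require Import structures.
From mathcomp Require Import all_boot all_order all_algebra.
From mathcomp Require Import all_classical all_reals all_analysis.
From mathcomp Require Import measurable_realfun polyXY ring lra.
Import Order.TTheory GRing.Theory Num.Theory.
Import numFieldNormedType.Exports.
Set Implicit Arguments.
Unset Strict Implicit.
Unset Printing Implicit Defensive.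
Local Open Scope classical_set_scope.
Local Open Scope ring_scope.

(** * Integration on the line and on products *)

Section affine.
Context {R : realType}.
Notation mu := (@lebesgue_measure R).

Definition affine (r c y : R) : measurableTypeR R := r * y + c.

Lemma measurable_affine (r c : R) : measurable_fun setT (affine r c).
Proof. by apply: measurable_funD => //; apply: measurable_funM. Qed.

Local Open Scope ereal_scope.

Definition affine_measure (r c : R) (r0 : (0 < r)%R) :
  {measure set (measurableTypeR R) -> \bar R}.
Proof.
refine (mscale (NngNum (ltW r0)) (pushforward mu (affine r c))).
exact: measurable_affine.
Defined.

(** Both measures agree on half-open intervals, which determines Lebesgue measure; the affine change
    of variables rests on this. *)
Lemma lebesgue_measure_affine (r c : R) (r0 : (0 < r)%R) (A : set R) :
  measurable A -> mu A = affine_measure c r0 A.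
Proof.
move=> mA; apply: lebesgue_measure_unique => //= _ [[a b]] _ <-.
rewrite /mscale /= /pushforward.
have -> : affine r c @^-1` `]a, b] = `](a - c) / r, (b - c) / r]%classic%R.
  apply/seteqP; split => x /=; rewrite !in_itv /= /affine.
    by rewrite ltr_pdivrMr// ler_pdivlMr// ltrBlDr lerBrDr mulrC.
  by rewrite ltr_pdivrMr// ler_pdivlMr// ltrBlDr lerBrDr mulrC.
rewrite !lebesgue_measure_itv/= !lte_fin ltr_pM2r ?invr_gt0// ltrD2r.
case: ifPn => // _; last by rewrite mule0.
by rewrite -!EFinB -EFinM; congr EFin; field; rewrite gt_eqF.
Qed.

Lemma ge0_integral_affine (r c : R) (f : R -> \bar R) : (0 < r)%R ->
  measurable_fun setT f -> (forall x, 0 <= f x) ->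
  \int[mu]_x f x = r%:E * \int[mu]_y f (r * y + c)%R.
Proof.
move=> r0 mf f0.
rewrite (eq_measure_integral (affine_measure c r0)); last first.
  by move=> A mA _; exact: lebesgue_measure_affine.
rewrite /affine_measure ge0_integral_mscale//= ge0_integral_pushforward//.
exact: measurable_affine.
Qed.

Lemma integrable_affine (r c : R) (f : R -> R) : (0 < r)%R ->
  mu.-integrable setT (EFin \o f) ->
  mu.-integrable setT (fun y => (f (r * y + c)%R)%:E).
Proof.
move=> r0 /integrableP[/measurable_EFinP mf foo]; apply/integrableP; split.
  apply/measurable_EFinP; apply: measurableT_comp => //; exact: (measurable_affine r c).
move: foo; rewrite (ge0_integral_affine c r0)//=; last first.
  by apply/measurable_EFinP; apply: measurableT_comp.
by rewrite -[X in _ < X](gt0_muley (x := r%:E)) ?lte_fin// lte_pmul2l// lte_fin.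
Qed.

Lemma integral_affine (r c : R) (f : R -> R) : (0 < r)%R ->
  mu.-integrable setT (EFin \o f) ->
  \int[mu]_x (f x)%:E = r%:E * \int[mu]_y (f (r * y + c)%R)%:E.
Proof.
move=> r0 intf; have mf := measurable_int mu intf.
have intg := integrable_affine c r0 intf.
rewrite integralE [in RHS]integralE.
rewrite muleBr//; last first.
  by rewrite fin_num_adde_defl// fin_numN; apply: integrable_neg_fin_num.
congr (_ - _).
  apply: etrans (ge0_integral_affine c r0 (measurable_funepos mf) _) _ => //.
  by congr (_ * _); apply: eq_integral => y _; rewrite !funeposE.
apply: etrans (ge0_integral_affine c r0 (measurable_funeneg mf) _) _ => //.
by congr (_ * _); apply: eq_integral => y _; rewrite !funenegE.
Qed.

Lemma Rintegral_affine (r c : R) (f : R -> R) : (0 < r)%R ->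
  mu.-integrable setT (EFin \o f) ->
  (\int[mu]_x f x = r * \int[mu]_y f (r * y + c))%R.
Proof.
move=> r0 intf; rewrite /Rintegral (integral_affine c r0)// fineM//.
by apply: integrable_fin_num => //; exact: integrable_affine.
Qed.

Lemma Rintegral_shift (c : R) (f : R -> R) :
  mu.-integrable setT (EFin \o f) ->
  (\int[mu]_x f x = \int[mu]_y f (y + c))%R.
Proof.
move=> intf; rewrite (Rintegral_affine c ltr01)// mul1r.
by apply: eq_Rintegral => y _; rewrite mul1r.
Qed.

Lemma integrable_opp (f : R -> R) : mu.-integrable setT (EFin \o f) ->
  mu.-integrable setT (EFin \o (fun x => f (- x)%R)).
Proof.
move=> intf; pose phi := (-%R : R -> measurableTypeR R).
have mphi : measurable_fun setT phi by apply: measurable_funN.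
have /measurable_EFinP mf := measurable_int mu intf.
apply/integrableP; split; first by apply/measurable_EFinP; exact: measurableT_comp mf mphi.
have [_] := integrableP _ _ _ intf.
rewrite (eq_measure_integral (pushforward mu phi)); last first.
  by move=> A mA _; exact/esym/lebesgue_measureN.
rewrite ge0_integral_pushforward//=.
by apply/measurable_EFinP; exact: measurableT_comp.
Qed.

Lemma Rintegral_opp (f : R -> R) : mu.-integrable setT (EFin \o f) ->
  (\int[mu]_x f x = \int[mu]_x f (- x))%R.
Proof.
move=> intf; rewrite /Rintegral; congr fine.
pose phi := (-%R : R -> measurableTypeR R).
have mphi : measurable_fun setT phi by apply: measurable_funN.
have mf := measurable_int mu intf.
rewrite integralE [in RHS]integralE; congr (_ - _).
  rewrite (eq_measure_integral (pushforward mu phi)); last first.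
    by move=> A mA _; exact/esym/lebesgue_measureN.
  rewrite ge0_integral_pushforward//=; last exact: measurable_funepos.
  by apply: eq_integral => x _; rewrite /= !funeposE.
rewrite (eq_measure_integral (pushforward mu phi)); last first.
  by move=> A mA _; exact/esym/lebesgue_measureN.
rewrite ge0_integral_pushforward//=; last exact: measurable_funeneg.
by apply: eq_integral => x _; rewrite /= !funenegE.
Qed.

End affine.

(** * Integrands identified only almost everywhere *)

Section ae_nonmeasurable.
Context d (T : measurableType d) (R : realType) (mu : {measure set T -> \bar R}).
Local Open Scope ereal_scope.
Import HBNNSimple.

(** The integral of [f] is a supremum over simple functions below it. These are measurable even if
    [f] is not, so the null set can be removed from each of them. *)
Lemma ge0_le_integral_ae (f g : T -> \bar R) (N : set T) : measurable N -> mu N = 0 ->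
  (forall x, 0 <= f x) -> (forall x, 0 <= g x) -> measurable_fun setT g ->
  (forall x, ~ N x -> f x <= g x) -> \int[mu]_x f x <= \int[mu]_x g x.
Proof.
move=> mN N0 f0 g0 mg fg.
rewrite [leLHS]ge0_integralTE//; apply: ge_ereal_sup => _ [h /= hf <-].
have mh : measurable_fun setT (EFin \o h) by exact/measurable_EFinP.
rewrite -integralT_nnsfun.
rewrite (ge0_negligible_integral mN measurableT mh _ N0)//=; last first.
  by move=> x _; rewrite lee_fin fun_ge0.
rewrite [leRHS](ge0_negligible_integral mN _ _ _ N0)//=.
apply: ge0_le_integral => //=.
- exact: measurableD.
- by move=> x _; rewrite lee_fin fun_ge0.
- exact: measurable_funTS.
- exact: measurable_funTS.
- by move=> x [_ /fg]; apply: le_trans.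
Qed.

Lemma ge0_ae_integral (f g : T -> \bar R) (N : set T) : measurable N -> mu N = 0 ->
  (forall x, 0 <= f x) -> (forall x, 0 <= g x) -> measurable_fun setT g ->
  (forall x, ~ N x -> f x = g x) -> \int[mu]_x f x = \int[mu]_x g x.
Proof.
move=> mN N0 f0 g0 mg fg; apply/eqP; rewrite eq_le; apply/andP; split.
  by apply: (ge0_le_integral_ae mN N0) => // x /fg ->.
rewrite (ge0_negligible_integral mN measurableT mg _ N0)// integral_mkcond.
rewrite [leLHS]ge0_integralTE//; last first.
  by move=> x; rewrite patchE; case: ifPn.
rewrite [leRHS]ge0_integralTE//.
apply: ereal_sup_le => _ [h /= hg <-]; exists h => //= x; apply: le_trans (hg x) _.
rewrite patchE; case: ifPn => //; rewrite inE => -[_ /fg ->//].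
Qed.

(** Meant for integrands whose formula is known off a null set only: the pointwise time derivative
    of a field, and the vertical slices of a triangle away from its vertices. *)
Lemma ae_integral_nonmeasurable (D N : set T) (f g : T -> \bar R) :
  measurable D -> measurable N -> mu N = 0 -> measurable_fun D g ->
  (forall x, D x -> ~ N x -> f x = g x) ->
  \int[mu]_(x in D) f x = \int[mu]_(x in D) g x.
Proof.
move=> mD mN N0 mg fg; rewrite !(integral_mkcond D).
have mg' : measurable_fun setT (g \_ D) by exact/(measurable_restrictT g mD).1.
have fg' x : ~ N x -> (f \_ D) x = (g \_ D) x.
  by move=> Nx; rewrite !patchE; case: ifPn => //; rewrite inE => Dx; apply: fg.
rewrite integralE [in RHS]integralE; congr (_ - _).
  apply: (ge0_ae_integral mN N0) => //; first exact: measurable_funepos.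
  by move=> x Nx; rewrite !funeposE fg'.
apply: (ge0_ae_integral mN N0) => //; first exact: measurable_funeneg.
by move=> x Nx; rewrite !funenegE fg'.
Qed.

End ae_nonmeasurable.

Lemma cvg_Rintegral_dominated d (T : measurableType d) (R : realType)
    (mu : {measure set T -> \bar R}) (D : set T) (f_ : nat -> T -> R) (f g : T -> R) :
  measurable D -> (forall n, measurable_fun D (f_ n)) -> measurable_fun D f ->
  {ae mu, forall x, D x -> f_ n x @[n --> \oo] --> f x} ->
  mu.-integrable D (EFin \o g) ->
  (forall n x, D x -> `|f_ n x| <= g x) ->
  mu.-integrable D (EFin \o f) /\
  (\int[mu]_(x in D) f_ n x) @[n --> \oo] --> \int[mu]_(x in D) f x.
Proof.
move=> mD mf_ mf ff ig fg.
have [|||||intf _ cv] := @dominated_convergence _ _ _ mu D mD (fun n => EFin \o f_ n)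
  (EFin \o f) (EFin \o g).
- by move=> n; exact/measurable_EFinP.
- exact/measurable_EFinP.
- by apply: filterS ff => x h Dx; apply: cvg_EFin (h Dx); exact: nearW.
- exact: ig.
- by apply: aeW => x n Dx /=; rewrite lee_fin; exact: fg.
split => //; apply: fine_cvg.
rewrite /Rintegral fineK//; exact: (integrable_fin_num mD intf).
Qed.

Section Rintegral_sum.
Context d (T : measurableType d) (R : realType) (m : {measure set T -> \bar R}).
Variables (A : set T) (I : Type) (f : I -> T -> R).
Hypotheses (mA : measurable A) (fi : forall i, m.-integrable A (EFin \o f i)).

Lemma integrable_sumR (r : seq I) : m.-integrable A (EFin \o (fun x => \sum_(i <- r) f i x)).
Proof.
elim: r => [|i r IH].
  have := integrable0 m A; apply: eq_integrable => // x _ /=.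
  by rewrite big_nil.
have := integrableD mA (fi i) IH; apply: eq_integrable => // x _ /=.
by rewrite big_cons.
Qed.

Lemma Rintegral_sum (r : seq I) :
  \int[m]_(x in A) (\sum_(i <- r) f i x) = \sum_(i <- r) \int[m]_(x in A) f i x.
Proof.
elim: r => [|i r IH].
  by rewrite big_nil /Rintegral; under eq_integral do rewrite big_nil; rewrite integral0.
rewrite big_cons -IH -RintegralD//; last exact: integrable_sumR.
by apply: eq_Rintegral => x _; rewrite big_cons.
Qed.

End Rintegral_sum.

Section Rfubini.
Context d1 d2 (T1 : measurableType d1) (T2 : measurableType d2) (R : realType).
Variables (m1 : {sigma_finite_measure set T1 -> \bar R})
  (m2 : {sigma_finite_measure set T2 -> \bar R}).
Local Open Scope ereal_scope.
Variable f : T1 * T2 -> R.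
Hypothesis intf : (m1 \x m2).-integrable setT (EFin \o f).

(** The inner real integral is [fine] of the extended one; the two agree where the latter is finite,
    that is almost everywhere. *)
Lemma Rfubini1 : (\int[m1 \x m2]_z f z = \int[m1]_x \int[m2]_y f (x, y))%R.
Proof.
rewrite /Rintegral -(integral12_prod_meas1 intf); congr fine.
have mF := measurable_fubini_F intf.
apply: ae_eq_integral => //.
  by apply/measurable_EFinP; apply: measurableT_comp.
apply: filterS (integrable_ae measurableT (integrable_fubini_F intf)).
by move=> x h _; rewrite -[LHS]fineK//; exact: h.
Qed.

Lemma Rfubini2 : (\int[m1 \x m2]_z f z = \int[m2]_y \int[m1]_x f (x, y))%R.
Proof.
rewrite /Rintegral -(integral21_prod_meas1 intf); congr fine.
have mF := measurable_fubini_G intf.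
apply: ae_eq_integral => //.
  by apply/measurable_EFinP; apply: measurableT_comp.
apply: filterS (ae_integrable2 intf) => y h _; rewrite -[LHS]fineK//.
exact: (integrable_fin_num measurableT h).
Qed.

Lemma measurable_Rfubini1 : measurable_fun setT (fun x => (\int[m2]_y f (x, y))%R).
Proof. by apply: measurableT_comp => //; exact: (measurable_fubini_F intf). Qed.

Lemma measurable_Rfubini2 : measurable_fun setT (fun y => (\int[m1]_x f (x, y))%R).
Proof. by apply: measurableT_comp => //; exact: (measurable_fubini_G intf). Qed.

Lemma integrable_Rfubini2 : m2.-integrable setT (EFin \o (fun y => (\int[m1]_x f (x, y))%R)).
Proof.
have mf := measurable_int _ intf.
apply/integrableP; split; first by apply/measurable_EFinP; exact: measurable_Rfubini2.
apply: le_lt_trans ((integrable21ltyP m1 m2 mf).1 intf).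
apply: ge0_le_integral => //.
- by apply/measurable_EFinP; apply: measurableT_comp => //; exact: measurable_Rfubini2.
- apply: (measurable_fun_fubini_tonelli_G (abse \o (EFin \o f))) => //.
  + exact: measurableT_comp.
  + by move=> z /=; rewrite lee_fin.
- move=> y _; apply: le_trans (le_abse_integral _ _ _) => //=; last exact: measurableT_comp mf _.
  by rewrite /Rintegral; case: (\int[m1]_x _) => [r| |]//=; rewrite normr0 leey.
Qed.

End Rfubini.

(** * Exchange of integrals against a bounded kernel *)

Section kernel_fubini.
Context d1 d2 (T1 : measurableType d1) (T2 : measurableType d2) (R : realType).
Variables (m1 : {sigma_finite_measure set T1 -> \bar R})
  (m2 : {sigma_finite_measure set T2 -> \bar R}).

Lemma integrable_prod_dominated (f : T1 * T2 -> R) (g : T1 -> R) (h : T2 -> R) :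
  measurable_fun setT f ->
  m1.-integrable setT (EFin \o g) -> m2.-integrable setT (EFin \o h) ->
  (forall x y, `|f (x, y)| <= `|g x| * `|h y|) ->
  (m1 \x m2)%E.-integrable setT (EFin \o f).
Proof.
move=> mf ig ih fgh.
have mf' : measurable_fun setT (EFin \o f) by exact/measurable_EFinP.
apply/(integrable12ltyP m1 m2 mf').
have mh : measurable_fun setT h by apply/measurable_EFinP; exact: (measurable_int _ ih).
have mg : measurable_fun setT g by apply/measurable_EFinP; exact: (measurable_int _ ig).
apply: (@le_lt_trans _ _ (\int[m1]_x (`|g x|%:E * \int[m2]_y `|h y|%:E))%E).
  apply: ge0_le_integral => //.
  - by move=> x _; apply: integral_ge0.
  - apply: (measurable_fun_fubini_tonelli_F (abse \o (EFin \o f))) => //.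
      exact: measurableT_comp.
    by move=> z /=; rewrite lee_fin.
  - by apply: emeasurable_funM => //; apply/measurable_EFinP; apply: measurableT_comp.
  - move=> x _; rewrite -ge0_integralZl_EFin//; last first.
      by apply/measurable_EFinP; apply: measurableT_comp.
    apply: ge0_le_integral => //.
    + by apply: measurableT_comp => //; apply: measurableT_comp mf' _.
    + by apply: measurable_funeM; apply/measurable_EFinP; apply: measurableT_comp.
    + by move=> y _; rewrite /= -EFinM lee_fin.
have [_ hoo] := integrableP _ _ _ ih.
have [_ goo] := integrableP _ _ _ ig.
rewrite ge0_integralZr//.
- by apply: lte_mul_pinfty => //; [exact: integral_ge0 | rewrite ge0_fin_numE//; exact: integral_ge0].
- by apply/measurable_EFinP; apply: measurableT_comp.
- exact: integral_ge0.
Qed.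

Variables (g : T1 -> R) (h : T2 -> R) (k : T1 * T2 -> R) (B : R).
Hypotheses (ig : m1.-integrable setT (EFin \o g)) (ih : m2.-integrable setT (EFin \o h))
  (mk : measurable_fun setT k) (kB : forall z, `|k z| <= B).

Lemma integrable_kernel :
  (m1 \x m2)%E.-integrable setT (EFin \o (fun z => g z.1 * (h z.2 * k z))).
Proof.
have mh : measurable_fun setT h by apply/measurable_EFinP; exact: (measurable_int _ ih).
have mg : measurable_fun setT g by apply/measurable_EFinP; exact: (measurable_int _ ig).
apply: (integrable_prod_dominated (g := g) (h := fun y => B * h y)).
- apply: measurable_funM; first exact: measurableT_comp.
  by apply: measurable_funM => //; exact: measurableT_comp.
- exact: ig.
- have := integrableZl measurableT B ih.
  by apply: eq_integrable.
- move=> x y; rewrite !normrM ler_wpM2l// [leRHS]mulrC ler_wpM2l//.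
  by apply: le_trans (kB _) _; exact: ler_norm.
Qed.

(** This form of Fubini serves the trigonometric kernels, the translates of a bounded [w], and the
    indicator of a half plane in the product rule. *)
Lemma kernel_fubini :
  \int[m1]_x (g x * \int[m2]_y (h y * k (x, y))) =
  \int[m2]_y (h y * \int[m1]_x (g x * k (x, y))).
Proof.
have mh : measurable_fun setT h by apply/measurable_EFinP; exact: (measurable_int _ ih).
have mg : measurable_fun setT g by apply/measurable_EFinP; exact: (measurable_int _ ig).
have bk1 x : m2.-integrable setT (EFin \o (fun y => h y * k (x, y))).
  have := integrableMl measurableT ih (measurableT_comp mk (pair1_measurable x)).
  apply; exists B; split; first exact: num_real.
  by move=> M BM y _; apply: le_trans (kB _) (ltW BM).
have bk2 y : m1.-integrable setT (EFin \o (fun x => g x * k (x, y))).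
  have := integrableMl measurableT ig (measurableT_comp mk (pair2_measurable y)).
  apply; exists B; split; first exact: num_real.
  by move=> M BM x _; apply: le_trans (kB _) (ltW BM).
transitivity (\int[m1]_x \int[m2]_y (g x * (h y * k (x, y)))).
  by apply: eq_Rintegral => x _; rewrite RintegralZl.
rewrite -(Rfubini1 integrable_kernel) (Rfubini2 integrable_kernel).
apply: eq_Rintegral => y _; rewrite -RintegralZl//.
by apply: eq_Rintegral => x _ /=; rewrite mulrCA.
Qed.

End kernel_fubini.

(** * Exponentially damped power kernels *)

Section power_kernel.
Context {R : realType}.
Notation mu := (@lebesgue_measure R).

Lemma continuous_powR_gt0 (p x : R) : 0 < x -> {for x, continuous (@powR R ^~ p)}.
Proof.
move=> x0; apply/differentiable_continuous/derivable1_diffP.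
by apply: derivable_powR; rewrite in_itv/= x0.
Qed.

Lemma within_continuous_powR (p a b : R) : 0 < a ->
  {within `[a, b], continuous (@powR R ^~ p)}.
Proof.
move=> a0; apply: continuous_in_subspaceT => x; rewrite inE/= in_itv/= => /andP[ax _].
by apply: continuous_powR_gt0; exact: lt_le_trans ax.
Qed.

Lemma integral_powR (m a b : R) : 0 < m -> 0 < a -> a <= b ->
  (\int[mu]_(x in `[a, b]) (x `^ (m - 1))%:E = ((b `^ m - a `^ m) / m)%:E)%E.
Proof.
move=> m0 a0; rewrite le_eqVlt => /predU1P[<-|ab].
  by rewrite set_itv1 integral_set1 subrr mul0r.
rewrite (@continuous_FTC2 _ _ (fun x => m^-1 * x `^ m))//.
- by rewrite -EFinB -mulrBr mulrC.
- exact: within_continuous_powR.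
- split.
  + move=> x; rewrite in_itv/= => /andP[ax xb]; apply: derivableM => //.
    by apply: derivable_powR; rewrite in_itv/= andbT (lt_trans a0).
  + apply: cvgM; first exact: cvg_cst.
    by apply: cvg_at_right_filter; exact: continuous_powR_gt0.
  + apply: cvgM; first exact: cvg_cst.
    by apply: cvg_at_left_filter; apply: continuous_powR_gt0; exact: lt_trans ab.
- move=> x; rewrite in_itv/= => /andP[ax xb].
  have x0 : 0 < x by exact: lt_trans ax.
  have dx := is_derive1_powR m x0.
  rewrite derive1E (_ : (fun _ => _) = m^-1 \*: (@powR R ^~ m))//.
  rewrite deriveZ; last by case: dx.
  by rewrite derive_val /GRing.scale/= mulrA mulVf ?mul1r// gt_eqF.
Qed.

(** Monotone convergence along [[1 / n.+1, 1]], where the primitive bounds the integrals by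
    [m^-1]. *)
Lemma integrable_powR_bnd (m : R) : 0 < m ->
  mu.-integrable `]0, 1]%classic (fun x => (x `^ (m - 1))%:E).
Proof.
move=> m0.
have mp (D : set R) : measurable D -> measurable_fun D (fun x : R => (x `^ (m - 1))%:E).
  by move=> mD; apply/measurable_EFinP; apply: measurable_funTS.
apply/integrableP; split; first exact: mp.
rewrite (_ : `]0, 1]%classic = \bigcup_n `[n.+1%:R^-1 : R, 1]%classic); last first.
  apply/seteqP; split => x /=.
    rewrite in_itv/= => /andP[x0 x1].
    have [n nx] := ltr_add_invr x0.
    by exists n => //=; rewrite in_itv/= x1 andbT -[n.+1%:R^-1]add0r ltW.
  by move=> [n _] /=; rewrite !in_itv/= => /andP[nx ->]; rewrite andbT (lt_le_trans _ nx).
under eq_integral do rewrite gee0_abs ?lee_fin ?powR_ge0//.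
have cv := @ge0_nondecreasing_set_cvg_integral _ (measurableTypeR R) R (fun n : nat => `[n.+1%:R^-1 : R, 1]%classic)
  (fun x => (x `^ (m - 1))%:E) (@lebesgue_measure R).
apply: (@le_lt_trans _ _ (m^-1)%:E); last exact: ltry.
have {}cv := cv _ (fun n => measurable_itv _) (fun n => mp _ (measurable_itv _))
  (fun _ x _ => powR_ge0 x (m - 1) : ((0%:E <= (x `^ (m - 1))%:E)%E)).
have nd : {homo (fun n : nat => `[n.+1%:R^-1 : R, 1]%classic) : i j / (i <= j)%N >-> (i <= j)%O}.
  move=> i j ij; rewrite subsetEset => x/=; rewrite !in_itv/= => /andP[ix ->].
  by rewrite andbT (le_trans _ ix)// lef_pV2 ?posrE// ler_nat ltnS.
rewrite -(cvg_lim _ (cv nd))//; apply: lime_le; first by apply/cvg_ex; eexists; exact: cv.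
apply: nearW => n; rewrite integral_powR// ?invf_le1 ?ler1n//.
by rewrite lee_fin powR1 ler_pdivrMr// mulVf ?gt_eqF// gerBl powR_ge0.
Qed.

(* The complex integral of [kern e m] against [exp (- i b s)] is
   [Gamma m * (e + i b) ^ (- m)]. *)
Definition kern (e m s : R) : R :=
  if 0 < s then s `^ (m - 1) * expR (- (e * s)) else 0.

Lemma kern_ge0 (e m s : R)  : 0 <= kern e m s.
Proof. by rewrite /kern; case: ifP => // _; rewrite mulr_ge0 ?powR_ge0 ?expR_ge0. Qed.

Lemma kernE (e m : R) : kern e m = (fun s => s `^ (m - 1) * expR (- (e * s))) \_ `]0, +oo[.
Proof.
apply/funext => s.
rewrite /kern patchE; case: ifPn => s0; first by rewrite ifT// inE/= in_itv/= s0.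
by rewrite ifF//; apply/negbTE; rewrite notin_setE/= in_itv/= andbT; apply/negP.
Qed.

Lemma measurable_kern (e m : R) : measurable_fun setT (kern e m).
Proof.
rewrite kernE.
apply: (proj1 (measurable_restrictT _ (measurable_itv _))); apply: measurable_funTS.
apply: measurable_funM => //; apply: measurableT_comp => //.
by apply: measurableT_comp => //; apply: measurable_funM.
Qed.

Lemma integrable_kern (e m : R)  : 0 < e -> 0 < m <= 1 ->
  mu.-integrable setT (EFin \o kern e m).
Proof.
move=> e0 /andP[m0 m1].
(* The dominating function is the bare power on []0, 1]] plus the bare exponential on the half line;
   since [m <= 1], the power is at most 1 beyond 1. *)
have i1 := proj1 (@integrable_mkcond _ _ _ (@lebesgue_measure R) `]0, 1]%classic _
  (measurable_itv _)) (integrable_powR_bnd m0).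
have i2 := integrableZl measurableT e^-1 (integrable_exponential_pdf e0).
apply: le_integrable (integrableD measurableT i1 i2) => //.
  by apply/measurable_EFinP; exact: measurable_kern.
move=> x _; rewrite /= /kern; have [x0|x0] := ltP 0 x; last by rewrite normr0 abse_ge0.
rewrite exponential_pdfE ?(ltW x0)// -EFinM mulrA mulVf ?gt_eqF// mul1r mulNr.
have ex1 : expR (- (e * x)) <= 1 by rewrite -expR0 ler_expR oppr_le0 mulr_ge0 ?ltW.
rewrite patchE; case: ifPn => xi.
  rewrite -EFinD lee_fin !ger0_norm ?addr_ge0 ?mulr_ge0 ?powR_ge0 ?expR_ge0//.
  by rewrite (@le_trans _ _ (x `^ (m - 1)))// ?lerDl ?expR_ge0// ler_piMr ?powR_ge0.
(* Off []0, 1]] the restricted power takes the default value [point], which is 0. *)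
rewrite (_ : point = 0%E)// add0e lee_fin !ger0_norm ?mulr_ge0 ?powR_ge0 ?expR_ge0//.
rewrite ler_piMl ?expR_ge0//.
have x1 : 1 <= x.
  move: xi; rewrite notin_setE/= in_itv/= x0/= => /negP; rewrite -ltNge; exact: ltW.
apply: le_trans (ler_powR x1 _ : _ <= x `^ 0) _; first by rewrite subr_le0.
by rewrite powRr0.
Qed.

(** The inequality x <= exp x at x = e s / 2 trades the factor [s] for half of the exponential
    decay. This dominates the derivatives of the transforms in [e] and [b]. *)
Lemma mulr_kern_le (e m s : R)  : 0 < e -> s * kern e m s <= 2 / e * kern (e / 2) m s.
Proof.
move=> e0; rewrite /kern; case: ifP => s0; last by rewrite !mulr0.
rewrite [leLHS]mulrCA [leRHS]mulrCA ler_wpM2l ?powR_ge0//.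
rewrite (_ : - (e * s) = - (e / 2 * s) + - (e / 2 * s)); last by lra.
rewrite expRD mulrA ler_wpM2r ?expR_ge0//.
rewrite expRN -ler_pdivlMr ?invr_gt0 ?expR_gt0// invrK.
have h : e / 2 * s <= expR (e / 2 * s) by apply: le_trans (expR_ge1Dx _); lra.
rewrite [leLHS](_ : s = 2 / e * (e / 2 * s)); last by field; rewrite gt_eqF.
by rewrite ler_wpM2l// divr_ge0// ltW.
Qed.

Lemma mulr_kern_ge0 (e m s : R)  : 0 <= s * kern e m s.
Proof.
by rewrite /kern; case: ifP => s0; rewrite ?mulr0// mulr_ge0 ?mulr_ge0 ?powR_ge0 ?expR_ge0// ltW.
Qed.

Lemma integrable_mulr_kern (e m : R)  : 0 < e -> 0 < m <= 1 ->
  mu.-integrable setT (EFin \o (fun s => s * kern e m s)).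
Proof.
move=> e0 m01; have e20 : 0 < e / 2 by rewrite divr_gt0.
apply: le_integrable (integrableZl measurableT (2 / e) (integrable_kern e20 m01)) => //.
  by apply/measurable_EFinP; apply: measurable_funM => //; exact: measurable_kern.
move=> x _ /=; rewrite lee_fin !ger0_norm ?mulr_kern_ge0//.
  exact: mulr_kern_le.
by rewrite mulr_ge0 ?kern_ge0// divr_ge0// ltW.
Qed.

Lemma kernMr (r e m s : R)  : 0 < r -> kern e m (r * s) = r `^ (m - 1) * kern (r * e) m s.
Proof.
move=> r0; rewrite /kern pmulr_rgt0//; case: ifP => s0; last by rewrite mulr0.
rewrite powRM ?(ltW r0) ?(ltW s0)// -mulrA.
by congr (_ * (_ * expR _)); ring.
Qed.

(* [phase = 0] gives the cosine transform and [phase = - pi / 2] the sine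
   transform. *)
Definition kern_trig (e m b phase : R) : R :=
  \int[mu]_s (kern e m s * cos (b * s + phase)).

Lemma integrable_Mcos (g : R -> R) (b phase : R) : mu.-integrable setT (EFin \o g) ->
  mu.-integrable setT (EFin \o (fun s => g s * cos (b * s + phase))).
Proof.
move=> ig; apply: (integrableMl measurableT ig).
  apply: measurableT_comp => //.
    by apply: continuous_measurable_fun; exact: continuous_cos.
  by apply: measurable_funD => //; apply: measurable_funM.
exists 1; split; first exact: num_real.
move=> M M1 y _; apply: le_trans (ltW M1).
by rewrite ler_norml cos_geN1 cos_le1.
Qed.

(** The transform is homogeneous of degree [- m] in the pair (e, b), by the substitution s -> r s.
    Hence the case [e = 1] suffices, and Euler's relation is available. *)
Lemma kern_trig_scale (e m b phase r : R)  : 0 < r -> 0 < e -> 0 < m <= 1 ->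
  kern_trig (r * e) m (r * b) phase = r `^ (- m) * kern_trig e m b phase.
Proof.
move=> r0 e0 m01; rewrite /kern_trig.
rewrite [in RHS](Rintegral_affine 0 r0); last by apply: integrable_Mcos; exact: integrable_kern.
rewrite [in RHS](_ : (fun _ => _) = (fun s => r `^ (m - 1) *
   (kern (r * e) m s * cos (r * b * s + phase)))); last first.
  by apply/funext => s; rewrite addr0 kernMr// mulrA [r * b]mulrC mulrA.
rewrite RintegralZl//; last first.
  by apply: integrable_Mcos; apply: integrable_kern => //; rewrite mulr_gt0.
rewrite !mulrA -[LHS]mul1r; congr (_ * _).
rewrite -[X in _ * X * _](powRr1 (ltW r0)) -!powRD ?(gt_eqF r0) ?implybT//.
by rewrite (_ : _ + _ = 0) ?powRr0//; ring.
Qed.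

(** Minus the derivative of [kern_trig] in [e]; at the phase shifted by [- pi / 2] it is minus the
    derivative in [b]. *)
Definition kern_trig1 (e m b phase : R) : R :=
  \int[mu]_s (s * kern e m s * cos (b * s + phase)).

Lemma kern_factor (e m s : R) :
  kern e m s = (if 0 < s then s `^ (m - 1) else 0) * expR (- (e * s)).
Proof. by rewrite /kern; case: ifP; rewrite ?mul0r. Qed.

Lemma le_kern (e e' m s : R) : e <= e' -> kern e' m s <= kern e m s.
Proof.
rewrite /kern; case: ifP => // s0 ee'.
by rewrite ler_wpM2l ?powR_ge0// ler_expR lerN2 ler_wpM2r// ltW.
Qed.

Lemma is_derive_kern_integrand (m a0 a1 b0 b1 phase s r : R) :
  is_derive r 1 (fun r => kern (a0 + r * a1) m s * cos ((b0 + r * b1) * s + phase))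
   (- a1 * (s * kern (a0 + r * a1) m s * cos ((b0 + r * b1) * s + phase))
    - b1 * (s * kern (a0 + r * a1) m s * sin ((b0 + r * b1) * s + phase))).
Proof.
rewrite (_ : (fun r => _) = fun r => (if 0 < s then s `^ (m - 1) else 0) *
  (expR (- ((a0 + r * a1) * s)) * cos ((b0 + r * b1) * s + phase))); last first.
  by apply/funext => x; rewrite kern_factor mulrA.
have d1 : is_derive r 1 (fun r => expR (- ((a0 + r * a1) * s)))
    (- (a1 * s) * expR (- ((a0 + r * a1) * s))).
  have dg : is_derive r 1 (fun r : R => - ((a0 + r * a1) * s)) (- (a1 * s)).
    rewrite (_ : (fun r => _) = fun r => (- (a1 * s)) * r + (- (a0 * s))); last first.
      by apply/funext => x; ring.
    apply: is_derive_eq; rewrite /GRing.scale/=; ring.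
  have := @is_derive1_comp R expR _ r _ _ (is_derive_expR _) dg.
  by rewrite /comp mulrC.
have d2 : is_derive r 1 (fun r => cos ((b0 + r * b1) * s + phase))
    (- (b1 * s) * sin ((b0 + r * b1) * s + phase)).
  have dg : is_derive r 1 (fun r : R => (b0 + r * b1) * s + phase) (b1 * s).
    rewrite (_ : (fun r => _) = fun r => (b1 * s) * r + (b0 * s + phase)); last first.
      by apply/funext => x; ring.
    apply: is_derive_eq; rewrite /GRing.scale/=; ring.
  have := @is_derive1_comp R (@cos R) _ r _ _ (is_derive_cos _) dg.
  by rewrite /comp => h; apply: is_derive_eq h _; ring.
apply: is_derive_eq; rewrite kern_factor /GRing.scale/=; ring.
Qed.

(** Differentiating along a line in the (e, b) plane covers both uses: a ray from the origin for
    Euler's relation, and a vertical line for the derivative in the frequency. *)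
Lemma is_derive_kern_trig (m a0 a1 b0 b1 phase r : R) :
  0 < a0 + r * a1 -> 0 < m <= 1 ->
  is_derive r 1 (fun r => kern_trig (a0 + r * a1) m (b0 + r * b1) phase)
   (- a1 * kern_trig1 (a0 + r * a1) m (b0 + r * b1) phase
    - b1 * kern_trig1 (a0 + r * a1) m (b0 + r * b1) (phase - pi / 2)).
Proof.
move=> e0 m01; set e := a0 + r * a1 in e0 *.
pose f x s := kern (a0 + x * a1) m s * cos ((b0 + x * b1) * s + phase).
(* The radius keeps the damping above [e / 2], so that one integrable function dominates all the
   derivatives; the [+ 1] covers [a1 = 0]. *)
pose d := e / 2 / (`|a1| + 1).
have d0 : 0 < d by rewrite !divr_gt0// ltr_pwDr.
have ea x : x \in `]r - d, r + d[ -> e / 2 <= a0 + x * a1.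
  rewrite in_itv/= => /andP[x1 x2].
  have : `|(x - r) * a1| <= e / 2.
    rewrite normrM (@le_trans _ _ (d * (`|a1| + 1)))//; last first.
      by rewrite /d divfK// gt_eqF// ltr_pwDr.
    by rewrite ler_pM// ?lerDl// ler_norml; apply/andP; split; lra.
  rewrite ler_norml => /andP[h _].
  rewrite (_ : a0 + x * a1 = e + (x - r) * a1); last by rewrite /e; ring.
  by move: h; set z := _ * a1 => h; lra.
have e20 : 0 < e / 2 by rewrite divr_gt0.
have Ir : r \in `]r - d, r + d[ by rewrite in_itv/= ltrBlDr ltrDl d0.
have iF x : (`]r - d, r + d[%classic : set R) x -> mu.-integrable setT (EFin \o f x).
  move=> /ea ex; apply: integrable_Mcos; apply: integrable_kern => //.
  exact: lt_le_trans ex.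
have dF x s : derivable (f ^~ s) x 1.
  by have := is_derive_kern_integrand m a0 a1 b0 b1 phase s x; case.
have dFE x s : partial1of2 f x s =
    - a1 * (s * kern (a0 + x * a1) m s * cos ((b0 + x * b1) * s + phase))
    - b1 * (s * kern (a0 + x * a1) m s * sin ((b0 + x * b1) * s + phase)).
  by rewrite partial1of2E; have [_ ->] := is_derive_kern_integrand m a0 a1 b0 b1 phase s x.
pose C := (`|a1| + `|b1|).
pose G s := C * (s * kern (e / 2) m s).
have G0 s : 0 <= G s by rewrite mulr_ge0// ?mulr_kern_ge0// addr_ge0.
have iG : mu.-integrable setT (EFin \o G).
  have := integrableZl measurableT C (integrable_mulr_kern e20 m01).
  exact: eq_integrable.
have Gub x s : (`]r - d, r + d[%classic : set R) x -> setT s -> `|partial1of2 f x s| <= G s.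
  move=> /ea ex _; rewrite dFE /G /C [leRHS]mulrDl.
  have sk : s * kern (a0 + x * a1) m s <= s * kern (e / 2) m s.
    have [s0|s0] := ltP 0 s; first by rewrite ler_wpM2l ?le_kern// ltW.
    by rewrite /kern ltNge s0/= !mulr0.
  have sk0 := mulr_kern_ge0 (a0 + x * a1) m s.
  apply: le_trans (ler_normD _ _) _; rewrite normrN !normrM normrN -!normrM.
  apply: lerD; rewrite !normrM -normrM ler_wpM2l// (ger0_norm sk0).
    apply: le_trans sk; rewrite ler_piMr// ler_norml cos_geN1 cos_le1//.
  by apply: le_trans sk; rewrite ler_piMr// ler_norml sin_geN1 sin_le1.
have dv := @derivable_under_integral R _ _ (@lebesgue_measure R) f setT measurableT r _ _ Ir iF
  (fun x y _ _ => dF x y) G G0 iG Gub.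
have dE := @differentiation_under_integral R _ _ (@lebesgue_measure R) f setT measurableT r _ _ Ir iF
  (fun x y _ _ => dF x y) G G0 iG Gub.
split; first exact: dv.
rewrite -derive1E dE /kern_trig1.
have ik p := integrable_Mcos (b0 + r * b1) p (integrable_mulr_kern e0 m01).
rewrite -(RintegralZl (- a1) measurableT (ik phase)).
rewrite -(RintegralZl b1 measurableT (ik (phase - pi / 2))).
rewrite -RintegralB//; first last.
- by have := integrableZl measurableT b1 (ik (phase - pi / 2)); apply: eq_integrable.
- by have := integrableZl measurableT (- a1) (ik phase); apply: eq_integrable.
by apply: eq_Rintegral => s _; rewrite dFE addrA cosBpihalf.
Qed.

(** Euler's relation for homogeneous functions: differentiate [kern_trig r m (r * w)] at [r = 1],
    once under the integral and once from its closed form in [r]. *)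
Lemma kern_trig_euler (m w phase : R) : 0 < m <= 1 ->
  m * kern_trig 1 m w phase =
  kern_trig1 1 m w phase + w * kern_trig1 1 m w (phase - pi / 2).
Proof.
move=> m01.
have e1 : (fun r => kern_trig (0 + r * 1) m (0 + r * w) phase) =
          (fun r => kern_trig r m (r * w) phase).
  by apply/funext => r; rewrite !add0r mulr1.
have p01 : 0 < 0 + 1 * 1 :> R by rewrite mulr1 add0r.
have := @is_derive_kern_trig m 0 1 0 w phase 1 p01 m01.
rewrite e1 !(mulr1, add0r) mul1r => -[_ d1].
have [_ d2] : is_derive (1 : R) 1 (fun r : R => kern_trig 1 m w phase * r `^ (- m))
   (kern_trig 1 m w phase *: (- m * 1 `^ (- m - 1))).
  have := is_derive1_powR (- m) (@ltr01 R) => h.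
  exact: (is_deriveZ (f := fun r : R => r `^ (- m)) (kern_trig 1 m w phase)).
move: d2; rewrite powR1 mulr1.
rewrite (@near_eq_derive _ _ _ _ (fun r => kern_trig r m (r * w) phase)); last first.
  near=> r; rewrite -[X in kern_trig X m (r * w)]mulr1 kern_trig_scale// 1?mulrC//.
  near: r; exact: lt_nbhsr.
by rewrite d1 /GRing.scale/= mulrN => h; rewrite mulrC -[LHS]opprK -h; ring.
Unshelve. all: by end_near. Qed.

Lemma kern_trig1_phase_pi (m w : R) : 0 < m <= 1 ->
  kern_trig1 1 m w (- (pi / 2) - pi / 2) = - kern_trig1 1 m w 0.
Proof.
move=> m01; rewrite /kern_trig1 -[RHS]mulN1r.
rewrite -(RintegralZl (- 1) measurableT (integrable_Mcos w 0 (integrable_mulr_kern ltr01 m01))).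
apply: eq_Rintegral => s _; rewrite addrA cosBpihalf sinBpihalf addr0; ring.
Qed.

Lemma is_derive_kern_trig1 (m w phase : R) : 0 < m <= 1 ->
  is_derive w 1 (fun w => kern_trig 1 m w phase) (- kern_trig1 1 m w (phase - pi / 2)).
Proof.
move=> m01.
have p01 : 0 < 1 + w * 0 :> R by rewrite mulr0 addr0.
have := @is_derive_kern_trig m 1 0 0 1 phase w p01 m01.
rewrite !(mulr0, addr0, add0r, mulr1) oppr0 mul0r sub0r mul1r.
by under eq_fun do rewrite mulr0 addr0 add0r mulr1.
Qed.

(** With F the cosine and G the sine transform, F - i G is the constant Gamma(m) times (1 + i
    w)^(-m). Complex powers are avoided by working with modulus and argument. *)
Lemma kern_trig_polar (m w : R) : 0 < m <= 1 ->
  kern_trig 1 m w 0 =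
  kern_trig 1 m 0 0 * (1 + w ^+ 2) `^ (- (m / 2)) * cos (m * atan w).
Proof.
move=> m01.
pose F x := kern_trig 1 m x 0; pose G x := kern_trig 1 m x (- (pi / 2)).
pose A x := kern_trig1 1 m x 0; pose B x := kern_trig1 1 m x (- (pi / 2)).
have dF (x : R) : is_derive x (1 : R) F (- B x).
  by have := is_derive_kern_trig1 x 0 m01; rewrite add0r.
have dG (x : R) : is_derive x (1 : R) G (A x).
  by have := is_derive_kern_trig1 x (- (pi / 2)) m01; rewrite kern_trig1_phase_pi// opprK.
have EF (x : R) : m * F x = A x + x * B x.
  by have := kern_trig_euler x 0 m01; rewrite add0r.
have EG (x : R) : m * G x = B x - x * A x.
  by have := kern_trig_euler x (- (pi / 2)) m01; rewrite kern_trig1_phase_pi// mulrN.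
pose q x : R := 1 + x ^+ 2.
have q0 x : 0 < q x by rewrite ltr_pwDl ?sqr_ge0.
pose rho x := q x `^ (m / 2).
have dth (x : R) : is_derive x (1 : R) (@atan R) (q x)^-1 by exact: is_derive1_atan.
have drho (x : R) : is_derive x (1 : R) rho (m * x * (q x)^-1 * rho x).
  have dq : is_derive x (1 : R) q (2 * x).
    by apply: is_derive_eq; rewrite /GRing.scale/=; ring.
  have := @is_derive1_comp R (@powR R ^~ (m / 2)) _ x _ _ (is_derive1_powR (m / 2) (q0 x)) dq.
  rewrite /comp => h; apply: is_derive_eq h _.
  rewrite -/(rho x) powRB ?(gt_eqF (q0 x)) ?implybT// powRr1 ?(ltW (q0 x))// -/(rho x).
  by field; rewrite gt_eqF.
have dc (x : R) : is_derive x (1 : R) (fun x => cos (m * atan x)) (- (m * (q x)^-1) * sin (m * atan x)).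
  have dm : is_derive x (1 : R) (fun x => m * atan x) (m * (q x)^-1).
    by apply: is_derive_eq; rewrite /GRing.scale/=; ring.
  have := @is_derive1_comp R (@cos R) _ x _ _ (is_derive_cos _) dm.
  by rewrite /comp => h; apply: is_derive_eq h _; ring.
have ds (x : R) : is_derive x (1 : R) (fun x => sin (m * atan x)) (m * (q x)^-1 * cos (m * atan x)).
  have dm : is_derive x (1 : R) (fun x => m * atan x) (m * (q x)^-1).
    by apply: is_derive_eq; rewrite /GRing.scale/=; ring.
  have := @is_derive1_comp R (@sin R) _ x _ _ (is_derive_sin _) dm.
  by rewrite /comp => h; apply: is_derive_eq h _; ring.
(* Euler's relations at the two phases, solved for [A] and [B], close the differential system in [F]
   and [G]. *)
have Ax (x : R) : A x = m * (F x - x * G x) / q x.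
  by rewrite mulrBr mulrCA EF EG; have := q0 x; rewrite /q => qx; field; rewrite gt_eqF.
have Bx (x : R) : B x = m * (x * F x + G x) / q x.
  by rewrite mulrDr mulrCA EF EG; have := q0 x; rewrite /q => qx; field; rewrite gt_eqF.
(* [U] and [V] are the real and imaginary parts of (F - i G) (1 + i x)^m, which is constant. *)
pose U x := rho x * (F x * cos (m * atan x) + G x * sin (m * atan x)).
pose V x := rho x * (F x * sin (m * atan x) - G x * cos (m * atan x)).
have dU (x : R) : is_derive x (1 : R) U 0.
  by apply: is_derive_eq; rewrite /GRing.scale/= Ax Bx; field; rewrite gt_eqF.
have dV (x : R) : is_derive x (1 : R) V 0.
  by apply: is_derive_eq; rewrite /GRing.scale/= Ax Bx; field; rewrite gt_eqF.
have Uc : U w = U 0 by exact: is_derive_0_is_cst.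
have Vc : V w = V 0 by exact: is_derive_0_is_cst.
have rho0 : rho 0 = 1 by rewrite /rho /q expr0n/= addr0 powR1.
have G0 : G 0 = 0.
  rewrite /G /kern_trig.
  by under eq_Rintegral do rewrite mul0r add0r -sub0r cosBpihalf sin0 mulr0; rewrite Rintegral_cst// mul0r.
have rw : rho w != 0 by rewrite gt_eqF// powR_gt0.
rewrite -/(F w) -/(F 0) powRN -/(rho w).
have cs := cos2Dsin2 (m * atan w).
have {}Uc : U w = F 0.
  by rewrite Uc /U rho0 atan0 mulr0 cos0 sin0 mulr0 addr0 mulr1 mul1r.
have {}Vc : V w = 0.
  by rewrite Vc /V rho0 atan0 mulr0 cos0 sin0 G0 !mul0r mulr0 subrr mulr0.
have : F w * rho w = U w * cos (m * atan w) + V w * sin (m * atan w).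
  rewrite /U /V -[LHS]mulr1 -cs; ring.
rewrite Uc Vc mul0r addr0 => h; rewrite mulrAC -h.
by field.
Qed.

End power_kernel.

(** * The quadratic form of a fractional integral on the Fourier side *)

Section kern_values.
Context {R : realType}.
Notation mu := (@lebesgue_measure R).

Lemma kern_trig00 (e m : R) : kern_trig e m 0 0 = \int[mu]_s kern e m s.
Proof. by apply: eq_Rintegral => s _; rewrite mul0r addr0 cos0 mulr1. Qed.

Lemma Gamma_kern (m : R) : Gamma m = \int[mu]_s kern 1 m s.
Proof.
rewrite kernE -Rintegral_mkcond /Gamma; apply: eq_Rintegral => s _.
by rewrite mul1r.
Qed.

Lemma kern_trigE (e m w : R) : 0 < e -> 0 < m <= 1 ->
  kern_trig e m w 0 = Gamma m * (e ^+ 2 + w ^+ 2) `^ (- (m / 2)) * cos (m * atan (w / e)).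
Proof.
move=> e0 m01.
have := kern_trig_scale (w / e) 0 e0 ltr01 m01.
rewrite mulr1 mulrCA mulfV ?gt_eqF// mulr1 => ->.
rewrite kern_trig_polar// kern_trig00 -Gamma_kern !mulrA; congr (_ * _).
rewrite (mulrC _ (Gamma m)) -mulrA; congr (_ * _).
rewrite (_ : e ^+ 2 + w ^+ 2 = e ^+ 2 * (1 + (w / e) ^+ 2)); last by field; rewrite gt_eqF.
rewrite [RHS]powRM ?sqr_ge0 ?addr_ge0 ?sqr_ge0//; congr (_ * _).
rewrite -powR_mulrn ?(ltW e0)// -powRrM; congr (_ `^ _).
by field.
Qed.

Lemma Gamma_gt0 (m : R) : 0 < m <= 1 -> 0 < Gamma m.
Proof.
move=> /[dup] m01 /andP[m0 m1]; rewrite Gamma_kern.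
(* On [[1, 2]] the power is at least 1 / s, hence at least 1 / 2, and the exponential is at least
   [expR (- 2)]. *)
pose c : R := expR (- 2) / 2.
have c0 : 0 < c by rewrite divr_gt0 ?expR_gt0.
apply: (@lt_le_trans _ _ (\int[mu]_s (c * \1_(`[1, 2] : set R) s))).
  rewrite RintegralZl//; last exact: integrable_indic_itv.
  rewrite mulr_gt0// /Rintegral integral_indic//= setIT lebesgue_measure_itv/= lte_fin ltr1n/=.
  by rewrite subr_gt0 ltr1n.
apply: le_Rintegral => //.
- have := integrableZl measurableT c (integrable_indic_itv (1 : R) 2 true false).
  exact: eq_integrable.
- exact: integrable_kern.
move=> s _; rewrite indicE; have [|_] := boolP (s \in _); last by rewrite mulr0 kern_ge0.
rewrite inE/= in_itv/= mulr1 => /andP[s1 s2].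
have s0 : 0 < s by exact: lt_le_trans s1.
rewrite /kern s0 /c mulrC mul1r ler_pM ?invr_ge0 ?expR_ge0 ?ler_expR ?lerN2//.
apply: le_trans (_ : s `^ (- 1) <= _); last by rewrite ler_powR//; lra.
by rewrite powR_inv1 ?(ltW s0)// lef_pV2 ?posrE.
Qed.

Lemma Gamma1 : Gamma (1 : R) = 1.
Proof.
have := @integral_exponential_pdf R 1 ltr01.
rewrite (_ : (fun x => (exponential_pdf 1 x)%:E) =
    (fun x : R => (1 * expR (- 1 * x))%:E) \_ `[0, +oo[); last first.
  by apply/funext => x; rewrite /exponential_pdf !patchE; case: ifP.
rewrite -integral_mkcond -integral_itv_obnd_cbnd; last first.
  apply/measurable_EFinP; apply: measurable_funTS; apply: measurable_funM => //.
  by apply: measurableT_comp => //; apply: measurable_funM.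
move=> h; rewrite /Gamma /Rintegral -[RHS]/(fine 1%E) -h; congr fine.
by apply: eq_integral => x _; rewrite subrr powRr0 !mul1r mulN1r.
Qed.

(** The case [m = 1], where the cosine of the arctangent is algebraic: the result is [pi] times the
    Poisson kernel, the approximate identity used for inversion. *)
Lemma kern_poisson (e w : R) : 0 < e ->
  \int[mu]_s (kern e 1 s * cos (w * s)) = e / (e ^+ 2 + w ^+ 2).
Proof.
move=> e0; have q0 : 0 < e ^+ 2 + w ^+ 2 by rewrite ltr_pwDl ?exprn_gt0// sqr_ge0.
transitivity (kern_trig e 1 w 0); first by apply: eq_Rintegral => s _; rewrite addr0.
rewrite kern_trigE ?ltr01 ?lexx// Gamma1 !mul1r cos_atan powRN powR12_sqrt ?(ltW q0)//.
rewrite (_ : 1 + _ = (e ^+ 2 + w ^+ 2) / e ^+ 2); last by field; rewrite gt_eqF.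
rewrite sqrtrM ?(ltW q0)// sqrtrV ?sqr_ge0// sqrtr_sqr (ger0_norm (ltW e0)).
rewrite -[in RHS](sqr_sqrtr (ltW q0)); field.
by rewrite (gt_eqF e0) sqrtr_eq0 -ltNge q0.
Qed.

Lemma ge0_integral_even (f : R -> \bar R) : measurable_fun setT f ->
  (forall x, 0 <= f x)%E -> (forall x, f (- x) = f x) ->
  (\int[mu]_x f x = 2%:E * \int[mu]_(x in `]0%R, +oo[) f x)%E.
Proof.
move=> mf f0 fe.
rewrite -(setUv (`]0, +oo[%classic : set R)) ge0_integral_setU//=; last 3 first.
- exact: measurableC.
- by rewrite setUv.
- exact/disj_setPCl.
rewrite setCitvr.
have -> : (\int[mu]_(x in `]-oo, 0%R]) f x = \int[mu]_(x in `]-oo, 0%R]) f (- x)%R)%E.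
  by apply: eq_integral => x _; rewrite fe.
rewrite -ge0_integration_by_substitution0// -integral_itv_obnd_cbnd//; last exact: measurable_funTS.
by rewrite mule_natl mule2n.
Qed.

Lemma integral_poissonE : (\int[mu]_x (1 + x ^+ 2)^-1%:E = (pi : R)%:E)%E.
Proof.
have mp : measurable_fun setT (fun x : R => ((1 + x ^+ 2)^-1)%:E).
  by apply/measurable_EFinP; apply: continuous_measurable_fun; exact: continuous_oneDsqrV.
rewrite ge0_integral_even//; last 2 first.
- by move=> x; rewrite lee_fin invr_ge0 addr_ge0 ?sqr_ge0.
- by move=> x; rewrite sqrrN.
rewrite integral_itv_obnd_cbnd; last exact: measurable_funTS.
rewrite [X in (_ * X)%E](@integral0y_oneDsqr R) -EFinM; congr EFin.
by rewrite mulrC divfK.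
Qed.

Lemma integrable_poisson : mu.-integrable setT (fun x : R => ((1 + x ^+ 2)^-1)%:E).
Proof.
apply/integrableP; split.
  by apply/measurable_EFinP; apply: continuous_measurable_fun; exact: continuous_oneDsqrV.
under eq_integral do rewrite gee0_abs ?lee_fin ?invr_ge0 ?addr_ge0 ?sqr_ge0//.
by rewrite integral_poissonE ltry.
Qed.

Lemma integral_poisson : \int[mu]_x (1 + x ^+ 2)^-1 = pi :> R.
Proof. by rewrite /Rintegral integral_poissonE. Qed.

End kern_values.

Lemma measurable_parametric d (T : measurableType d) (R : realType) (h : R -> R) (k : T * R -> R) (B : R) :
  lebesgue_measure.-integrable setT (EFin \o h) -> measurable_fun setT k ->
  (forall z, `|k z| <= B) ->
  measurable_fun setT (fun z => \int[lebesgue_measure]_x (h x * k (z, x))).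
Proof.
move=> ih mk kB.
(* Under the zero measure the constant 1 is integrable on any space, so Fubini applies; only its
   measurability conclusion is kept. *)
have i1 : (@mzero d T R).-integrable setT (EFin \o (fun=> 1)).
  apply/integrableP; split; first exact: measurable_cst.
  by rewrite integral_cst// mule0.
have := measurable_Rfubini1 (integrable_kernel i1 ih mk kB).
by apply: eq_measurable_fun => z _; apply: eq_Rintegral => x _; rewrite mul1r.
Qed.

Lemma integrable_Mbnd {R : realType} (g h : R -> R) (B : R) :
  lebesgue_measure.-integrable setT (EFin \o g) -> measurable_fun setT h ->
  (forall x, `|h x| <= B) ->
  lebesgue_measure.-integrable setT (EFin \o (fun x => g x * h x)).
Proof.
move=> ig mh hB; apply: (integrableMl measurableT ig mh).
exists B; split; first exact: num_real.
by move=> M BM x _; apply: le_trans (ltW BM).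
Qed.

(* Only differences of points of [[a, b]] enter the convolution of [kern 0 m]
   with a function supported there, hence the integrable truncation. *)
Definition trunc_kern {R : realType} (L m s : R) : R := if s <= L then kern 0 m s else 0.

Section trunc_kern.
Context {R : realType}.
Notation mu := (@lebesgue_measure R).
Variables (L m : R).
Hypothesis m01 : 0 < m <= 1.

Lemma trunc_kern_ge0 s : 0 <= trunc_kern L m s.
Proof. by rewrite /trunc_kern; case: ifP => // _; exact: kern_ge0. Qed.

Lemma trunc_kern_le s : trunc_kern L m s <= expR L * kern 1 m s.
Proof.
rewrite /trunc_kern; case: ifP => sL; last by rewrite mulr_ge0 ?expR_ge0 ?kern_ge0.
rewrite /kern; case: ifP => s0; last by rewrite mulr0.
rewrite mul0r oppr0 expR0 mulr1 mul1r mulrCA ler_peMr ?powR_ge0// -expRD.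
by rewrite -[leLHS]expR0 ler_expR subr_ge0.
Qed.

Lemma measurable_trunc_kern : measurable_fun setT (trunc_kern L m).
Proof.
apply: measurable_fun_ifT => //; last exact: measurable_kern.
exact: measurable_fun_ler.
Qed.

Lemma integrable_trunc_kern : mu.-integrable setT (EFin \o trunc_kern L m).
Proof.
have mh := measurable_trunc_kern.
have := integrableZl measurableT (expR L) (integrable_kern (@ltr01 R) m01).
apply: le_integrable => //; first exact/measurable_EFinP.
by move=> s _ /=; rewrite lee_fin !ger0_norm ?trunc_kern_ge0 ?trunc_kern_le// mulr_ge0 ?expR_ge0 ?kern_ge0.
Qed.

End trunc_kern.

(** The substitution s = x - xi turns the fractional integral into a convolution. The support of [w]
    removes xi < a, and the remaining s stay below [b - a], where the kernel is not cut. *)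
Lemma frac_conv {R : realType} (w : R -> R) (a b M m x : R) :
  measurable_fun setT w -> (forall x, `|w x| <= M) ->
  (forall x, ~~ (a <= x <= b) -> w x = 0) -> 0 < m < 1 -> a <= x <= b ->
  \int[lebesgue_measure]_(xi in `[a, x]) ((x - xi) `^ (m - 1) * w xi) =
  \int[lebesgue_measure]_s (trunc_kern (b - a) m s * w (x - s)).
Proof.
move=> mw wM w0 /andP[m0 m1] /andP[ax xb].
have m01 : 0 < m <= 1 by rewrite m0 ltW.
have ihw : lebesgue_measure.-integrable setT
    (EFin \o (fun s => trunc_kern (b - a) m s * w (x - s))).
  apply: (integrable_Mbnd (integrable_trunc_kern (b - a) m01)) => //.
  by apply: measurableT_comp mw _; exact: measurable_funB.
rewrite (Rintegral_opp ihw) (@Rintegral_shift R (- x)); last exact: integrable_opp ihw.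
have m10 : m - 1 != 0 by rewrite subr_eq0 lt_eqF.
rewrite [LHS]Rintegral_mkcond; apply: eq_Rintegral => xi _.
rewrite opprB opprB addrCA subrr addr0 patchE.
case: ifPn => [|]; rewrite ?inE ?notin_setE/= in_itv/=.
  move=> /andP[axi xix]; congr (_ * _).
  rewrite /trunc_kern (lerB xb axi) /kern mul0r oppr0 expR0 mulr1 subr_gt0.
  (* At [xi = x] both kernels vanish, since 0 to the nonzero power [m - 1] is 0 by convention. *)
  by case: ltgtP xix => // -> _; rewrite subrr powR0.
move=> /negP; rewrite negb_and -!ltNge => /orP[xia|xxi].
  by rewrite w0 ?mulr0// negb_and -ltNge xia.
rewrite /trunc_kern /kern subr_gt0 ltNge (ltW xxi)/=.
by case: ifP; rewrite mul0r.
Qed.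

(** * Autocorrelation and power spectrum *)

Section autocorrelation.
Context {R : realType}.
Notation mu := (@lebesgue_measure R).
Variables (w : R -> R) (a b M : R).
Hypothesis mw : measurable_fun setT w.
Hypothesis wM : forall x, `|w x| <= M.
Hypothesis w0 : forall x, ~~ (a <= x <= b) -> w x = 0.
Hypothesis wD : finite_set [set x | ~ {for x, continuous w}].

Lemma integrable_bnd_supp (g : R -> R) (C : R) : measurable_fun setT g ->
  (forall x, `|g x| <= C) -> (forall x, ~~ (a <= x <= b) -> g x = 0) ->
  mu.-integrable setT (EFin \o g).
Proof.
move=> mg gC g0.
have := integrableZl measurableT C (integrable_indic_itv a b true false).
apply: le_integrable => //; first exact/measurable_EFinP.
move=> x _ /=; rewrite lee_fin indicE.
have [|] := boolP (x \in _); rewrite ?inE ?notin_setE/= in_itv/=.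
  by rewrite mulr1 => _; apply: le_trans (gC _) _; exact: ler_norm.
by move=> /negP /g0 ->; rewrite normr0.
Qed.

Lemma integrable_w : mu.-integrable setT (EFin \o w).
Proof. exact: integrable_bnd_supp wM w0. Qed.

Definition autocorr (s : R) : R := \int[mu]_y (w y * w (y + s)).

(** This is [2 * pi] times the squared modulus of the unitary Fourier transform. *)
Definition power_spectrum (om : R) : R :=
  (\int[mu]_x (cos (om * x) * w x)) ^+ 2 + (\int[mu]_x (sin (om * x) * w x)) ^+ 2.

Lemma power_spectrum_ge0 om : 0 <= power_spectrum om.
Proof. by rewrite addr_ge0 ?sqr_ge0. Qed.

Let Cw om := \int[mu]_x (cos (om * x) * w x).
Let Sw om := \int[mu]_x (sin (om * x) * w x).

Lemma measurable_cos2 : measurable_fun setT (fun z : R * R => cos (z.1 * z.2)).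
Proof.
apply: measurableT_comp; first by apply: continuous_measurable_fun; exact: continuous_cos.
by apply: measurable_funM.
Qed.

Lemma measurable_sin2 : measurable_fun setT (fun z : R * R => sin (z.1 * z.2)).
Proof.
apply: measurableT_comp; first by apply: continuous_measurable_fun; exact: continuous_sin.
by apply: measurable_funM.
Qed.

Lemma measurable_cosM (om : R) : measurable_fun setT (fun x : R => cos (om * x)).
Proof.
apply: continuous_measurable_fun => x; apply: continuous_comp; last exact: continuous_cos.
exact: mulrl_continuous.
Qed.

Lemma measurable_sinM (om : R) : measurable_fun setT (fun x : R => sin (om * x)).
Proof.
apply: continuous_measurable_fun => x; apply: continuous_comp; last exact: continuous_sin.
exact: mulrl_continuous.
Qed.

Lemma integrable_cos_w om : mu.-integrable setT (EFin \o (fun x => cos (om * x) * w x)).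
Proof.
apply: (@integrable_bnd_supp _ M).
- by apply: measurable_funM => //; exact: measurable_cosM.
- move=> x; rewrite normrM -[leRHS]mul1r ler_pM// ler_norml cos_geN1 cos_le1//.
- by move=> x /w0 ->; rewrite mulr0.
Qed.

Lemma integrable_sin_w om : mu.-integrable setT (EFin \o (fun x => sin (om * x) * w x)).
Proof.
apply: (@integrable_bnd_supp _ M).
- by apply: measurable_funM => //; exact: measurable_sinM.
- move=> x; rewrite normrM -[leRHS]mul1r ler_pM// ler_norml sin_geN1 sin_le1//.
- by move=> x /w0 ->; rewrite mulr0.
Qed.

Lemma Rintegral_cosB om c :
  \int[mu]_x (w x * cos (om * (x - c))) = cos (om * c) * Cw om + sin (om * c) * Sw om.
Proof.
rewrite -RintegralZl//; last exact: integrable_cos_w.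
rewrite -RintegralZl//; last exact: integrable_sin_w.
rewrite -RintegralD//; first last.
- by have := integrableZl measurableT (sin (om * c)) (integrable_sin_w om); apply: eq_integrable.
- by have := integrableZl measurableT (cos (om * c)) (integrable_cos_w om); apply: eq_integrable.
by apply: eq_Rintegral => x _; rewrite mulrBr cosB; ring.
Qed.

Lemma Rintegral_cos_shift om s :
  \int[mu]_y (w y * (cos (om * (y + s)) * Cw om + sin (om * (y + s)) * Sw om)) =
  power_spectrum om * cos (om * s).
Proof.
transitivity (\int[mu]_y
  ((cos (om * s) * Cw om + sin (om * s) * Sw om) * (cos (om * y) * w y) +
   (cos (om * s) * Sw om - sin (om * s) * Cw om) * (sin (om * y) * w y))).
  by apply: eq_Rintegral => y _; rewrite [om * (y + s)]mulrDr cosD sinD; ring.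
rewrite RintegralD//; first last.
- by have := integrableZl measurableT (cos (om * s) * Sw om - sin (om * s) * Cw om) (integrable_sin_w om); apply: eq_integrable.
- by have := integrableZl measurableT (cos (om * s) * Cw om + sin (om * s) * Sw om) (integrable_cos_w om); apply: eq_integrable.
rewrite !RintegralZl//; [|exact: integrable_sin_w|exact: integrable_cos_w].
by rewrite -/(Cw om) -/(Sw om) /power_spectrum -/(Cw om) -/(Sw om); ring.
Qed.

Let W := \int[mu]_x `|w x|.

Lemma integrable_norm_w : mu.-integrable setT (EFin \o (fun x => `|w x|)).
Proof. exact: integrable_norm integrable_w. Qed.

Lemma W_ge0 : 0 <= W. Proof. by apply: Rintegral_ge0. Qed.

Lemma Rintegral_trig_le (k : R -> R) : mu.-integrable setT (EFin \o (fun x => k x * w x)) ->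
  (forall x, `|k x| <= 1) -> `|\int[mu]_x (k x * w x)| <= W.
Proof.
move=> ik k1; apply: le_trans (le_normr_Rintegral measurableT ik) _.
apply: le_Rintegral => //; [exact: integrable_norm ik|exact: integrable_norm_w|].
by move=> x _; rewrite normrM ler_piMl.
Qed.

Lemma Cw_le om : `|Cw om| <= W.
Proof.
apply: Rintegral_trig_le; first exact: integrable_cos_w.
by move=> x; rewrite ler_norml cos_geN1 cos_le1.
Qed.

Lemma Sw_le om : `|Sw om| <= W.
Proof.
apply: Rintegral_trig_le; first exact: integrable_sin_w.
by move=> x; rewrite ler_norml sin_geN1 sin_le1.
Qed.

Lemma power_spectrum_le om : power_spectrum om <= 2 * W ^+ 2.
Proof.
rewrite /power_spectrum -/(Cw om) -/(Sw om) mulr_natl mulr2n.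
by apply: lerD; rewrite -real_normK ?num_real// ler_sqr ?nnegrE ?W_ge0// ?Cw_le ?Sw_le.
Qed.

Lemma measurable_Cw : measurable_fun setT Cw.
Proof.
have k1 (z : R * R) : `|cos (z.1 * z.2)| <= 1 by rewrite ler_norml cos_geN1 cos_le1.
have := measurable_parametric integrable_w measurable_cos2 k1.
by apply: eq_measurable_fun => om _; apply: eq_Rintegral => x _; rewrite mulrC.
Qed.

Lemma measurable_Sw : measurable_fun setT Sw.
Proof.
have k1 (z : R * R) : `|sin (z.1 * z.2)| <= 1 by rewrite ler_norml sin_geN1 sin_le1.
have := measurable_parametric integrable_w measurable_sin2 k1.
by apply: eq_measurable_fun => om _; apply: eq_Rintegral => x _; rewrite mulrC.
Qed.

Lemma measurable_power_spectrum : measurable_fun setT power_spectrum.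
Proof.
apply: measurable_funD; apply: measurable_funX; [exact: measurable_Cw|exact: measurable_Sw].
Qed.

(** The spectrum is a double integral of [w x * w y] against a cosine of [x - (y + s)]. Integrating
    over the frequency first, against the exponential, leaves a Poisson kernel. *)
Lemma poisson_spectrum (e s : R) : 0 < e ->
  \int[mu]_om (kern e 1 om * (power_spectrum om * cos (om * s))) =
  \int[mu]_y (w y * \int[mu]_x (w x * (e / (e ^+ 2 + (x - (y + s)) ^+ 2)))).
Proof.
move=> e0; have e01 : 0 < (1 : R) <= 1 by rewrite ltr01 lexx.
(* The integral in x is already carried out inside [k], so the triple integral is reordered by two
   exchanges of two variables each. *)
pose k (z : R * R) := cos (z.1 * (z.2 + s)) * Cw z.1 + sin (z.1 * (z.2 + s)) * Sw z.1.
have mprod : measurable_fun setT (fun z : R * R => z.1 * (z.2 + s)).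
  by apply: measurable_funM => //; apply: measurable_funD.
have mc : measurable_fun setT (@cos R).
  by apply: continuous_measurable_fun; exact: continuous_cos.
have msn : measurable_fun setT (@sin R).
  by apply: continuous_measurable_fun; exact: continuous_sin.
have mk : measurable_fun setT k.
  apply: measurable_funD; apply: measurable_funM.
  - exact: measurableT_comp mc mprod.
  - exact: measurableT_comp measurable_Cw measurable_fst.
  - exact: measurableT_comp msn mprod.
  - exact: measurableT_comp measurable_Sw measurable_fst.
have kB z : `|k z| <= W + W.
  apply: le_trans (ler_normD _ _) _; apply: lerD; rewrite normrM -[leRHS]mul1r ler_pM//.
  - by rewrite ler_norml cos_geN1 cos_le1.
  - exact: Cw_le.
  - by rewrite ler_norml sin_geN1 sin_le1.
  - exact: Sw_le.
transitivity (\int[mu]_om (kern e 1 om * \int[mu]_y (w y * k (om, y)))).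
  by apply: eq_Rintegral => om _; rewrite Rintegral_cos_shift.
rewrite (kernel_fubini (integrable_kern e0 e01) integrable_w mk kB).
apply: eq_Rintegral => y _; congr (_ * _).
pose k2 (z : R * R) := cos (z.1 * (z.2 - (y + s))).
have mk2 : measurable_fun setT k2.
  apply: measurableT_comp mc _; apply: measurable_funM => //; exact: measurable_funB.
have k2B z : `|k2 z| <= 1 by rewrite ler_norml cos_geN1 cos_le1.
transitivity (\int[mu]_om (kern e 1 om * \int[mu]_x (w x * k2 (om, x)))).
  by apply: eq_Rintegral => om _; rewrite Rintegral_cosB.
rewrite (kernel_fubini (integrable_kern e0 e01) integrable_w mk2 k2B).
apply: eq_Rintegral => x _; congr (_ * _); rewrite -kern_poisson//.
by apply: eq_Rintegral => om _; rewrite /k2/= mulrC [_ * om]mulrC mulrC.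
Qed.

Lemma integrable_Mpoisson (g : R -> R) (C : R) : measurable_fun setT g ->
  (forall x, `|g x| <= C) ->
  mu.-integrable setT (EFin \o (fun v => g v * (1 + v ^+ 2)^-1)).
Proof.
move=> mg gC; have := @integrableMr _ _ _ (@lebesgue_measure R) setT measurableT g _ mg _ integrable_poisson; apply.
exists C; split; first exact: num_real.
by move=> B CB x _; apply: le_trans (ltW CB).
Qed.

Lemma poisson_kernel_scale (e c : R) : 0 < e ->
  \int[mu]_x (w x * (e / (e ^+ 2 + (x - c) ^+ 2))) =
  \int[mu]_v (w (e * v + c) * (1 + v ^+ 2)^-1).
Proof.
move=> e0.
pose f x := w x * (e^-1 * (1 + (e^-1 * x + (- (e^-1 * c))) ^+ 2)^-1).
have q0 (x : R) : 0 < 1 + x ^+ 2 by rewrite ltr_pwDl ?sqr_ge0.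
transitivity (\int[mu]_x f x).
  apply: eq_Rintegral => x _; rewrite /f; congr (_ * _).
  have := q0 ((x - c) / e); rewrite (_ : 1 + _ = (e ^+ 2 + (x - c) ^+ 2) / e ^+ 2); last first.
    by field; rewrite gt_eqF.
  rewrite pmulr_lgt0 ?invr_gt0 ?exprn_gt0// => q1.
  rewrite (_ : e^-1 * x - e^-1 * c = (x - c) / e); last by ring.
  rewrite (_ : 1 + ((x - c) / e) ^+ 2 = (e ^+ 2 + (x - c) ^+ 2) / e ^+ 2); last first.
    by field; rewrite gt_eqF.
  by rewrite invf_div; field; rewrite !gt_eqF.
have intf : mu.-integrable setT (EFin \o f).
  apply: (@integrable_bnd_supp _ (M * e^-1)).
  - apply: measurable_funM => //; apply: measurable_funM => //.
    apply: (measurableT_comp (f := fun x : R => (1 + x ^+ 2)^-1)).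
      by apply: continuous_measurable_fun; exact: continuous_oneDsqrV.
    exact: (measurable_affine e^-1 (- (e^-1 * c))).
  - move=> x; rewrite normrM ler_pM// ger0_norm; last by rewrite mulr_ge0 ?invr_ge0 ?(ltW e0) ?(ltW (q0 _)).
    by rewrite ler_piMr ?invr_ge0 ?(ltW e0)//; exact: oneDsqrV_le1.
  - by move=> x /w0 wx; rewrite /f wx mul0r.
rewrite (Rintegral_affine c e0 intf) -RintegralZl//; last exact: integrable_affine.
apply: eq_Rintegral => v _; rewrite /f.
rewrite (_ : e^-1 * (e * v + c) - e^-1 * c = v); last by field; rewrite gt_eqF.
by field; rewrite !gt_eqF.
Qed.

Definition en (n : nat) : R := n.+1%:R^-1.

Lemma en_gt0 n : 0 < en n. Proof. by rewrite invr_gt0. Qed.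

Lemma cvg_en : en n @[n --> \oo] --> (0 : R). Proof. exact: cvg_harmonic. Qed.

(** After rescaling, the Poisson weight is fixed and the argument of [w] tends to [c]; [pi] is the
    total mass of the weight. *)
Lemma cvg_poisson (c : R) : {for c, continuous w} ->
  \int[mu]_v (w (en n * v + c) * (1 + v ^+ 2)^-1) @[n --> \oo] --> pi * w c.
Proof.
move=> wc.
have mwa (e : R) : measurable_fun setT (fun v => w (e * v + c)).
  by apply: measurableT_comp mw _; exact: (measurable_affine e c).
have mq : measurable_fun setT (fun x : R => (1 + x ^+ 2)^-1).
  by apply: continuous_measurable_fun; exact: continuous_oneDsqrV.
rewrite (_ : pi * w c = \int[mu]_v (w c * (1 + v ^+ 2)^-1)); last first.
  by rewrite RintegralZl ?integral_poisson 1?mulrC//; exact: integrable_poisson.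
have [] // := @cvg_Rintegral_dominated _ _ _ (@lebesgue_measure R) setT
  (fun n v => w (en n * v + c) * (1 + v ^+ 2)^-1) (fun v => w c * (1 + v ^+ 2)^-1)
  (fun v => M * (1 + v ^+ 2)^-1).
- by move=> n; apply: measurable_funM; [exact: mwa|exact: mq].
- by apply: measurable_funM; [exact: measurable_cst|exact: mq].
- apply: aeW => v _; apply: cvgMr_tmp; apply: continuous_cvg => //.
  rewrite -[X in _ --> X]add0r -[X in _ --> X + _](mul0r v).
  by apply: cvgD; [apply: cvgMr_tmp; exact: cvg_en|exact: cvg_cst].
- have := integrableZl measurableT M integrable_poisson; exact: eq_integrable.
- move=> n v _; rewrite normrM ler_pM// ger0_norm// invr_ge0 addr_ge0 ?sqr_ge0//.
Qed.

Lemma poisson_integral_le (e c : R) : 0 < e ->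
  `|\int[mu]_v (w (e * v + c) * (1 + v ^+ 2)^-1)| <= M * pi.
Proof.
move=> e0.
have mwa : measurable_fun setT (fun v => w (e * v + c)).
  by apply: measurableT_comp mw _; exact: (measurable_affine e c).
have ip := integrable_Mpoisson mwa (fun v => wM (e * v + c)).
apply: le_trans (le_normr_Rintegral measurableT ip) _.
rewrite -integral_poisson -RintegralZl//; last exact: integrable_poisson.
apply: le_Rintegral => //; first exact: integrable_norm ip.
  by have := integrableZl measurableT M integrable_poisson; exact: eq_integrable.
by move=> v _; rewrite normrM ler_pM// ger0_norm// invr_ge0 addr_ge0 ?sqr_ge0.
Qed.

(** The Poisson integrals converge at each [y] for which [y + s] is a continuity point of [w]. By
    [wD] this leaves out finitely many [y], and [M * pi * |w y|] dominates. *)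
Lemma cvg_spectrum (s : R) :
  \int[mu]_om (kern (en n) 1 om * (power_spectrum om * cos (om * s))) @[n --> \oo] -->
  pi * autocorr s.
Proof.
pose I n y := \int[mu]_v (w (en n * v + (y + s)) * (1 + v ^+ 2)^-1).
rewrite (_ : (fun n => _) = fun n => \int[mu]_y (w y * I n y)); last first.
  apply/funext => n; rewrite (poisson_spectrum s (en_gt0 n)).
  by apply: eq_Rintegral => y _; rewrite (poisson_kernel_scale _ (en_gt0 n)).
have iww : mu.-integrable setT (EFin \o (fun y => w y * w (y + s))).
  apply: (@integrable_bnd_supp _ (M * M)).
  - apply: measurable_funM => //; apply: measurableT_comp mw _.
    exact: measurable_funD.
  - by move=> x; rewrite normrM ler_pM.
  - by move=> x /w0 ->; rewrite mul0r.
rewrite /autocorr -RintegralZl//.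
have [] // := @cvg_Rintegral_dominated _ _ _ (@lebesgue_measure R) setT
  (fun n y => w y * I n y) (fun y => pi * (w y * w (y + s))) (fun y => (M * pi) * `|w y|).
- move=> n; apply: measurable_funM => //.
  pose k (z : R * R) := w (en n * z.2 + (z.1 + s)).
  have mk : measurable_fun setT k.
    apply: measurableT_comp mw _; apply: measurable_funD; first exact: measurable_funM.
    exact: measurable_funD.
  have := measurable_parametric integrable_poisson mk (fun z => wM _).
  by apply: eq_measurable_fun => y _; apply: eq_Rintegral => v _; rewrite mulrC.
- apply: measurable_funM => //; apply: measurable_funM => //.
  by apply: measurableT_comp mw _; exact: measurable_funD.
- pose Ds := (fun x => x - s) @` [set x | ~ {for x, continuous w}].
  have cDs : countable Ds by apply: finite_set_countable; exact: finite_image.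
  exists Ds; split; first exact: countable_measurable.
    exact: countable_lebesgue_measure0.
  move=> y /= nc; exists (y + s); last by rewrite addrK.
  apply: contra_not nc => cy _.
  by rewrite mulrCA; apply: cvgMl_tmp; exact: cvg_poisson.
- by have := integrableZl measurableT (M * pi) integrable_norm_w; exact: eq_integrable.
- by move=> n y _; rewrite normrM mulrC ler_wpM2r// poisson_integral_le ?en_gt0.
Qed.

Lemma kern01E (om : R) : kern 0 1 om = if 0 < om then 1 else 0.
Proof. by rewrite /kern subrr powRr0 mul0r oppr0 expR0 mulr1. Qed.

Lemma cvg_kern (m s : R) : kern (en n) m s @[n --> \oo] --> kern 0 m s.
Proof.
rewrite /kern; case: ifP => s0; last exact: cvg_cst.
apply: cvgMl_tmp; apply: continuous_cvg; first exact: continuous_expR.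
by apply: cvgN; apply: cvgMr_tmp; exact: cvg_en.
Qed.

(** At [s = 0] the damped integrands are nonnegative and increase as the damping decreases, so the
    known limit of their integrals proves integrability too. [kern 0 1] is the indicator of the
    positive frequencies. *)
Lemma integral_spectrum :
  (\int[mu]_om (kern 0 1 om * power_spectrum om)%:E = (pi * autocorr 0)%:E)%E.
Proof.
have mP := measurable_power_spectrum.
have mf n : measurable_fun setT (fun om => (kern (en n) 1 om * power_spectrum om)%:E).
  by apply/measurable_EFinP; apply: measurable_funM => //; exact: measurable_kern.
have := @cvg_monotone_convergence _ _ _ (@lebesgue_measure R) setT measurableT
  (fun n om => (kern (en n) 1 om * power_spectrum om)%:E) mf.
move=> /(_ (fun n om _ => mulr_ge0 (kern_ge0 _ _ _) (power_spectrum_ge0 om))).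
have nd (om : R) : setT om ->
    {homo (fun n => (kern (en n) 1 om * power_spectrum om)%:E) : n m / (n <= m)%N >-> (n <= m)%E}.
  move=> _ n m nm; rewrite lee_fin ler_wpM2r ?power_spectrum_ge0// le_kern//.
  by rewrite /en lef_pV2 ?posrE// ler_nat.
move=> /(_ nd) h1.
have e01 : 0 < (1 : R) <= 1 by rewrite ltr01 lexx.
have ikP n : mu.-integrable setT (EFin \o (fun om => kern (en n) 1 om * power_spectrum om)).
  apply: (integrable_Mbnd (B := 2 * W ^+ 2)) => //; first exact: integrable_kern (en_gt0 n) e01.
  by move=> om; rewrite ger0_norm ?power_spectrum_ge0// power_spectrum_le.
have h2 : (\int[mu]_om (kern (en n) 1 om * power_spectrum om)%:E)%E @[n --> \oo] --> (pi * autocorr 0)%:E.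
  rewrite (_ : (fun n => _) = fun n => (\int[mu]_om (kern (en n) 1 om * (power_spectrum om * cos (om * 0))))%:E).
    by apply: cvg_EFin; [exact: nearW|exact: cvg_spectrum 0].
  apply/funext => n; rewrite /Rintegral; under [in RHS]eq_integral do rewrite mulr0 cos0 mulr1.
  by rewrite fineK//; exact: integrable_fin_num (ikP n).
have := cvg_unique _ h1 h2 => <- //.
apply: eq_integral => om _; apply/esym/cvg_lim => //.
by apply: cvg_EFin; [exact: nearW|apply: cvgMr_tmp; exact: cvg_kern].
Qed.

Lemma measurable_kP : measurable_fun setT (fun om => kern 0 1 om * power_spectrum om).
Proof.
by apply: measurable_funM; [exact: measurable_kern|exact: measurable_power_spectrum].
Qed.

Lemma integrable_kP : mu.-integrable setT (EFin \o (fun om => kern 0 1 om * power_spectrum om)).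
Proof.
have mk := measurable_kP.
apply/integrableP; split; first exact/measurable_EFinP.
under eq_integral do rewrite gee0_abs ?lee_fin ?mulr_ge0 ?kern_ge0 ?power_spectrum_ge0//.
by rewrite integral_spectrum ltry.
Qed.

(** The spectrum, now known to be integrable, dominates its damped versions, so the damping can be
    removed for every [s]. *)
Lemma cosine_transform_spectrum (s : R) :
  \int[mu]_om (kern 0 1 om * power_spectrum om * cos (om * s)) = pi * autocorr s.
Proof.
have mcs : measurable_fun setT (fun om : R => cos (om * s)).
  by apply: eq_measurable_fun (measurable_cosM s) => om _; rewrite mulrC.
have mP := measurable_power_spectrum.
have [] := @cvg_Rintegral_dominated _ _ _ (@lebesgue_measure R) setT
  (fun n om => kern (en n) 1 om * (power_spectrum om * cos (om * s)))
  (fun om => kern 0 1 om * power_spectrum om * cos (om * s))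
  (fun om => kern 0 1 om * power_spectrum om) measurableT _ _ _ integrable_kP _.
- by move=> n; apply: measurable_funM; [exact: measurable_kern|exact: measurable_funM].
- by apply: measurable_funM => //; exact: measurable_kP.
- by apply: aeW => om _; rewrite -mulrA; apply: cvgMr_tmp; exact: cvg_kern.
- move=> n om _; rewrite !normrM (ger0_norm (kern_ge0 _ _ _)) (ger0_norm (power_spectrum_ge0 _)).
  rewrite ler_pM ?kern_ge0 ?mulr_ge0 ?power_spectrum_ge0//.
    by rewrite le_kern// ltW ?en_gt0.
  by rewrite ler_piMr ?power_spectrum_ge0// ler_norml cos_geN1 cos_le1.
by move=> _ h; have c := @cvg_spectrum s; rewrite -(cvg_lim (@Rhausdorff R) h) (cvg_lim (@Rhausdorff R) c).
Qed.

Lemma autocorr_le s : `|autocorr s| <= M * W.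
Proof.
have iww : mu.-integrable setT (EFin \o (fun y => w y * w (y + s))).
  apply: (integrable_Mbnd integrable_w) => //.
  by apply: measurableT_comp mw _; exact: measurable_funD.
apply: le_trans (le_normr_Rintegral measurableT iww) _.
rewrite -RintegralZl//; last exact: integrable_norm_w.
apply: le_Rintegral => //; first exact: integrable_norm iww.
  by have := integrableZl measurableT M integrable_norm_w; exact: eq_integrable.
by move=> y _; rewrite normrM mulrC ler_wpM2r.
Qed.

Lemma measurable_autocorr : measurable_fun setT autocorr.
Proof.
apply: (@measurable_parametric _ _ R w (fun z => w (z.2 + z.1)) M integrable_w).
  by apply: measurableT_comp mw _; exact: measurable_funD.
by move=> z.
Qed.

Lemma autocorr0 s : b - a < s -> autocorr s = 0.
Proof.
move=> bas; transitivity (\int[mu]_y (0 : R)); last by rewrite Rintegral_cst// mul0r.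
apply: eq_Rintegral => y _; have [/andP[ay yb]|/w0 ->] := boolP (a <= y <= b); last by rewrite mul0r.
by rewrite (w0 (x := y + s)) ?mulr0// negb_and -!ltNge; apply/orP; right; lra.
Qed.

(** Parseval's identity for the damped kernel, by exchanging the two integrals and inverting the
    spectrum. *)
Lemma spectrum_kern_trig (e m : R) : 0 < e -> 0 < m <= 1 ->
  \int[mu]_om (kern 0 1 om * power_spectrum om * kern_trig e m om 0) =
  pi * \int[mu]_s (kern e m s * autocorr s).
Proof.
move=> e0 m01.
have k1 (z : R * R) : `|cos (z.1 * z.2)| <= 1 by rewrite ler_norml cos_geN1 cos_le1.
have ik := integrable_kern e0 m01.
have h := kernel_fubini integrable_kP ik measurable_cos2 k1.
transitivity (\int[mu]_x (kern 0 1 x * power_spectrum x * (\int[mu]_y (kern e m y * cos (x * y))))).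
  by apply: eq_Rintegral => om _; congr (_ * _); apply: eq_Rintegral => s _; rewrite addr0.
rewrite h.
rewrite -(RintegralZl pi measurableT (integrable_Mbnd ik measurable_autocorr autocorr_le)).
by apply: eq_Rintegral => s _; rewrite cosine_transform_spectrum mulrCA.
Qed.

Variable m : R.
Hypothesis m01 : 0 < m < 1.

Let m01' : 0 < m <= 1. Proof. by case/andP: m01 => -> /ltW ->. Qed.

Let h := trunc_kern (b - a) m.

(** The undamped power kernel is not integrable at infinity. Cutting it where the autocorrelation
    vanishes provides a dominating function uniform in [e]. *)
Lemma kern_autocorr (e : R) : 
  \int[mu]_s (kern e m s * autocorr s) =
  \int[mu]_s ((if s <= b - a then kern e m s else 0) * autocorr s).
Proof.
by apply: eq_Rintegral => s _; case: ifPn => //; rewrite -ltNge => /autocorr0 ->; rewrite !mulr0.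
Qed.

Lemma cvg_kern_autocorr :
  \int[mu]_s (kern (en n) m s * autocorr s) @[n --> \oo] --> \int[mu]_s (h s * autocorr s).
Proof.
under eq_fun do rewrite kern_autocorr.
have ik := integrableZl measurableT (M * W) (integrable_trunc_kern (b - a) m01').
have [] // := @cvg_Rintegral_dominated _ _ _ (@lebesgue_measure R) setT
  (fun n s => (if s <= b - a then kern (en n) m s else 0) * autocorr s)
  (fun s => h s * autocorr s) (fun s => M * W * h s).
- move=> n; apply: measurable_funM; last exact: measurable_autocorr.
  apply: measurable_fun_ifT => //; last exact: measurable_kern.
  exact: measurable_fun_ler.
- apply: measurable_funM; [exact: measurable_trunc_kern|exact: measurable_autocorr].
- apply: aeW => s _; apply: cvgMr_tmp; rewrite /h /trunc_kern; case: ifP => _; last exact: cvg_cst.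
  exact: cvg_kern.
- move=> n s _; rewrite normrM mulrC ler_pM ?autocorr_le//.
  rewrite ger0_norm; last by case: ifP => // _; exact: kern_ge0.
  by rewrite /h /trunc_kern; case: ifP => // _; rewrite le_kern// ltW// en_gt0.
Qed.

(** Below frequency 1 the spectrum is bounded and the power integrable, because [m < 1]; above it
    the power is at most 1 and the spectrum integrable. *)
Lemma integrable_spectrum_powR :
  mu.-integrable setT (EFin \o (fun om => kern 0 1 om * power_spectrum om * om `^ (- m))).
Proof.
have /andP[m0 m1] := m01.
have i1 := proj1 (@integrable_mkcond _ _ _ (@lebesgue_measure R) `]0, 1]%classic _
  (measurable_itv _)) (integrable_powR_bnd (_ : 0 < 1 - m)).
have {}i1 := i1 ltac:(by rewrite subr_gt0).
have i2 := integrableD measurableT (integrableZl measurableT (2 * W ^+ 2) i1) integrable_kP.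
apply: le_integrable i2 => //.
  by apply/measurable_EFinP; apply: measurable_funM => //; exact: measurable_kP.
move=> om _; rewrite /= kern01E; have [omp|omp] := ltP 0 om; last by rewrite !mul0r normr0 abse_ge0.
rewrite mul1r (_ : 1 - m - 1 = - m); last by ring.
have W2 : 0 <= 2 * W ^+ 2 by rewrite mulr_ge0 ?sqr_ge0.
have P0 := power_spectrum_ge0 om; have PW := power_spectrum_le om.
move: (2 * W ^+ 2) (power_spectrum om) (powR_ge0 om (- m)) W2 P0 PW => B P o0' B0 P0 PB.
rewrite patchE; case: ifPn => oi.
  rewrite -EFinM -EFinD lee_fin !ger0_norm ?addr_ge0 ?mulr_ge0//.
  rewrite (@le_trans _ _ (B * om `^ (- m)))//; first by rewrite ler_wpM2r.
  by rewrite lerDl.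
rewrite (_ : point = 0%E)// mule0 add0e lee_fin !ger0_norm ?mulr_ge0// ler_piMr//.
have om1 : 1 <= om.
  move: oi; rewrite notin_setE/= in_itv/= omp/= => /negP; rewrite -ltNge; exact: ltW.
apply: le_trans (ler_powR om1 _ : _ <= om `^ 0) _; first by rewrite oppr_le0 ltW.
by rewrite powRr0.
Qed.

(** As the damping tends to 0, om / e tends to infinity and its arctangent to [pi / 2]: this is
    where the cosine in the energy identity comes from. Domination uses (e^2 + om^2)^(-m/2) <=
    om^(-m). *)
Lemma cvg_spectrum_kern_trig :
  \int[mu]_om (kern 0 1 om * power_spectrum om * kern_trig (en n) m om 0) @[n --> \oo] -->
  Gamma m * cos (m * (pi / 2)) * \int[mu]_om (kern 0 1 om * power_spectrum om * om `^ (- m)).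
Proof.
have /andP[m0 m1] := m01.
rewrite -RintegralZl//; last exact: integrable_spectrum_powR.
have ig := integrableZl measurableT (Gamma m) integrable_spectrum_powR.
have mkt (e : R) : 0 < e -> measurable_fun setT (fun om => kern_trig e m om 0).
  move=> e0.
  have k1 (z : R * R) : `|cos (z.1 * z.2)| <= 1 by rewrite ler_norml cos_geN1 cos_le1.
  have := measurable_parametric (integrable_kern e0 m01') measurable_cos2 k1.
  by apply: eq_measurable_fun => om _; apply: eq_Rintegral => s _; rewrite addr0.
have [] // := @cvg_Rintegral_dominated _ _ _ (@lebesgue_measure R) setT
  (fun n om => kern 0 1 om * power_spectrum om * kern_trig (en n) m om 0)
  (fun om => Gamma m * cos (m * (pi / 2)) * (kern 0 1 om * power_spectrum om * om `^ (- m)))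
  (fun om => Gamma m * (kern 0 1 om * power_spectrum om * om `^ (- m))).
- move=> n; apply: measurable_funM; [exact: measurable_kP|exact: mkt (en_gt0 n)].
- apply: measurable_funM => //; apply: measurable_funM => //; exact: measurable_kP.
- apply: aeW => om _; rewrite kern01E; have [omp|omp] := ltP 0 om; last first.
    rewrite !mul0r mulr0; under eq_fun do rewrite !mul0r; exact: cvg_cst.
  rewrite !mul1r mulrCA.
  apply: cvgMl_tmp; under eq_fun do rewrite (kern_trigE _ (en_gt0 _) m01').
  rewrite mulrAC; apply: cvgM.
    apply: cvgMl_tmp.
    rewrite (_ : om `^ (- m) = (0 ^+ 2 + om ^+ 2) `^ (- (m / 2))); last first.
      rewrite expr0n/= add0r -powR_mulrn ?(ltW omp)// -powRrM; congr (_ `^ _); by field.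
    have c0 : {for (0 ^+ 2 + om ^+ 2), continuous (@powR R ^~ (- (m / 2)))}.
      by apply: continuous_powR_gt0; rewrite expr0n/= add0r exprn_gt0.
    have hc : (fun n => en n ^+ 2 + om ^+ 2) @ \oo --> 0 ^+ 2 + om ^+ 2.
      apply: cvgD; last exact: cvg_cst.
      under eq_fun do rewrite expr2.
      by rewrite expr2; apply: cvgM; exact: cvg_en.
    exact: (cvg_comp _ _ hc c0).
  apply: continuous_cvg; first exact: continuous_cos.
  apply: cvgMl_tmp.
  have : (fun n => om / en n) @ \oo --> +oo.
    rewrite (_ : (fun n => _) = fun n => om * n.+1%:R); last first.
      by apply/funext => n; rewrite /en invrK.
    have hn : (n.+1%:R : R) @[n --> \oo] --> +oo.
      by have /cvgryPge := @cvgr_idn R => hn; apply/cvgryPge => A; have [N _ NA] := hn A; exists N => // n /= Nn; apply: NA => /=; rewrite (leq_trans Nn).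
    exact: (cvg_comp _ _ hn (gt0_cvgMry omp cvg_id)).
  by move=> /cvg_comp; apply; exact: cvgy_atan.
- move=> n om _; rewrite normrM (ger0_norm (mulr_ge0 (kern_ge0 _ _ _) (power_spectrum_ge0 _))).
  rewrite [leRHS]mulrCA; rewrite kern01E; have [omp|omp] := ltP 0 om; last by rewrite !mul0r.
  rewrite ler_wpM2l ?mulr_ge0 ?power_spectrum_ge0//.
  rewrite (kern_trigE _ (en_gt0 _) m01') !normrM (ger0_norm (ltW (Gamma_gt0 m01'))).
  rewrite ger0_norm ?powR_ge0// -mulrA ler_wpM2l ?(ltW (Gamma_gt0 m01'))//.
  rewrite (@le_trans _ _ ((en n ^+ 2 + om ^+ 2) `^ (- (m / 2))))//.
    by rewrite ler_piMr ?powR_ge0// ler_norml cos_geN1 cos_le1.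
  rewrite (_ : om `^ (- m) = (om ^+ 2) `^ (- (m / 2))); last first.
    rewrite -powR_mulrn ?(ltW omp)// -powRrM; congr (_ `^ _); by field.
  rewrite !powRN lef_pV2 ?posrE ?powR_gt0 ?exprn_gt0// ?ltr_pwDr ?sqr_ge0 ?exprn_gt0//.
  by rewrite ge0_ler_powR ?nnegrE ?addr_ge0 ?sqr_ge0 ?divr_ge0 ?(ltW m0)// lerDr sqr_ge0.
Qed.

Lemma spectrum_autocorr :
  Gamma m * cos (m * (pi / 2)) * \int[mu]_om (kern 0 1 om * power_spectrum om * om `^ (- m)) =
  pi * \int[mu]_s (h s * autocorr s).
Proof.
have c1 := cvg_spectrum_kern_trig.
have c2 : \int[mu]_om (kern 0 1 om * power_spectrum om * kern_trig (en n) m om 0) @[n --> \oo] -->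
    pi * \int[mu]_s (h s * autocorr s).
  under eq_fun do rewrite (spectrum_kern_trig (en_gt0 _) m01').
  by apply: cvgMl_tmp; exact: cvg_kern_autocorr.
by rewrite -(cvg_lim (@Rhausdorff R) c1) (cvg_lim (@Rhausdorff R) c2).
Qed.

(** After the shift y = x - s, exchanging the integrals pairs [w] with its convolution by the power
    kernel, which is the fractional integral up to the factor [Gamma m]. *)
Lemma autocorr_frac :
  \int[mu]_s (h s * autocorr s) =
  \int[mu]_(x in `[a, b]) (\int[mu]_(xi in `[a, x]) ((x - xi) `^ (m - 1) * w xi) * w x).
Proof.
have mk : measurable_fun setT (fun z : R * R => w (z.2 - z.1)).
  by apply: measurableT_comp mw _; exact: measurable_funB.
have kf := kernel_fubini (integrable_trunc_kern (b - a) m01') integrable_w mk (fun z => wM _).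
transitivity (\int[mu]_s (h s * \int[mu]_x (w x * w (x - s)))).
  apply: eq_Rintegral => s _; congr (_ * _); rewrite /autocorr.
  rewrite (@Rintegral_shift R (- s)); last first.
    apply: (integrable_Mbnd integrable_w) => //.
    by apply: measurableT_comp mw _; exact: measurable_funD.
  by apply: eq_Rintegral => x _; rewrite subrK mulrC.
rewrite kf [RHS]Rintegral_mkcond; apply: eq_Rintegral => x _ /=.
rewrite patchE; case: ifPn => [|]; rewrite ?inE ?notin_setE/= in_itv/=; last first.
  by move=> /negP /w0 ->; rewrite mul0r.
by move=> axb; rewrite mulrC (frac_conv mw wM w0 m01 axb).
Qed.

Lemma normc_fourier om :
  complex.ComplexField.Normc.normc (fourier w om) ^+ 2 = power_spectrum om / (2 * pi).
Proof.
rewrite /fourier /complex.ComplexField.Normc.normc /= sqr_sqrtr ?addr_ge0 ?sqr_ge0//.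
rewrite sqrrN !exprMn exprVn sqr_sqrtr ?mulr_ge0 ?pi_ge0// -mulrDr mulrC //.
Qed.

End autocorrelation.

(** * Negative norms and fractional integrals on a line *)

Section Hneg.
Context {R : realType}.
Notation mu := (@lebesgue_measure R).
Variables (w : R -> R) (a b M : R).
Hypothesis mw : measurable_fun setT w.
Hypothesis wM : forall x, `|w x| <= M.
Hypothesis w0 : forall x, ~~ (a <= x <= b) -> w x = 0.
Hypothesis wD : finite_set [set x | ~ {for x, continuous w}].

(** The order [m / 2] gives the weight |om|^(-m) after squaring. The integrand is even, and the
    resulting factor 2 turns the 1 / (2 pi) of the unitary normalization into 1 / pi. *)
Lemma Hneg_normE (m : R) : 
  (Hneg_norm (m / 2) w ^+ 2 = (pi^-1)%:E *
   \int[mu]_om (kern 0 1 om * power_spectrum w om * om `^ (- m))%:E)%E.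
Proof.
transitivity (\int[mu]_om (`|om| `^ (- m) * (power_spectrum w om / (2 * pi)))%:E)%E.
  transitivity (Hneg_norm (m / 2) w `^ 2)%E.
    have : (0 <= Hneg_norm (m / 2) w)%E by exact: Lnorm_ge0.
    case: (Hneg_norm (m / 2) w) => [r r0||//].
      by rewrite poweR_EFin -EFin_expe -powR_mulrn.
    by rewrite poweRyr// expe2 mulyy.
  rewrite /Hneg_norm powR_Lnorm//; apply: eq_integral => om _.
  rewrite abse_EFin poweR_EFin; congr EFin.
  rewrite -normc_fourier powR_mulrn// real_normK ?num_real// exprMn; congr (_ * _).
  by rewrite -powR_mulrn ?powR_ge0// -powRrM; congr (_ `^ _); field.
have mPm : measurable_fun setT (fun om : R => (`|om| `^ (- m) * (power_spectrum w om / (2 * pi)))%:E).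
  apply/measurable_EFinP; apply: measurable_funM.
    exact: (measurableT_comp (measurable_powR (- m)) (@normr_measurable _ setT)).
  apply: measurable_funM => //; exact: (measurable_power_spectrum mw wM w0).
rewrite ge0_integral_even//; last 2 first.
- move=> om; rewrite lee_fin mulr_ge0 ?powR_ge0 ?divr_ge0 ?power_spectrum_ge0 ?mulr_ge0 ?pi_ge0//.
- move=> om; rewrite normrN /power_spectrum; congr (_ * (_ / _))%:E; congr (_ + _).
    by congr (_ ^+ 2); apply: eq_Rintegral => x _; rewrite mulNr cosN.
  rewrite -[in LHS]sqrrN -mulN1r -RintegralZl//; last exact: (integrable_sin_w mw wM w0).
  by congr (_ ^+ 2); apply: eq_Rintegral => x _; rewrite [- om * x]mulNr sinN; ring.
rewrite (_ : (pi^-1)%:E = (2 * (2 * pi)^-1)%:E); last first.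
  by congr EFin; rewrite invfM mulrA mulfV ?mul1r.
rewrite EFinM -muleA; congr (_ * _)%E.
rewrite -ge0_integralZl ?lee_fin ?invr_ge0 ?mulr_ge0 ?pi_ge0//; last 2 first.
- apply/measurable_EFinP; apply: measurable_funM => //; exact: (measurable_kP mw wM w0).
- by move=> om _; rewrite lee_fin !mulr_ge0 ?kern_ge0 ?power_spectrum_ge0 ?powR_ge0.
rewrite [LHS]integral_mkcond; apply: eq_integral => om _; rewrite patchE kern01E.
case: ifPn => [|]; rewrite ?inE ?notin_setE/= in_itv/= andbT.
  by move=> omp; rewrite omp gtr0_norm// -EFinM; congr EFin; ring.
by move=> /negP/negbTE ->; rewrite !mul0r mule0.
Qed.

Lemma Hneg_frac (m : R) : 0 <= m < 1 ->
  ((cos (m * (pi / 2)))%:E * Hneg_norm (m / 2) w ^+ 2 =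
   (\int[mu]_(x in `[a, b]) (frac_int a m w x * w x))%:E)%E.
Proof.
move=> /andP[m0 m1]; rewrite Hneg_normE.
have pi0 : pi != 0 :> R by rewrite gt_eqF// pi_gt0.
(* For order 0 the fractional integral is the identity and the claim is Plancherel's theorem, the
   value of the autocorrelation at 0. *)
have [->|mn0] := eqVneq m 0.
  under eq_integral do rewrite oppr0 powRr0 mulr1.
  rewrite (integral_spectrum mw wM w0 wD) mul0r cos0 mul1e -EFinM mulrA mulVf// mul1r.
  congr EFin; rewrite /autocorr [RHS]Rintegral_mkcond; apply: eq_Rintegral => x _.
  rewrite addr0 patchE /frac_int eqxx; case: ifPn => //; rewrite notin_setE/= in_itv/=.
  by move=> /negP /w0 ->; rewrite mul0r.
have m01 : 0 < m < 1 by rewrite lt_neqAle eq_sym mn0 m0.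
have ip := integrable_spectrum_powR mw wM w0 wD m01.
have g0 : Gamma m != 0 by rewrite gt_eqF// Gamma_gt0// (ltW m1) andbT; case/andP: m01.
rewrite -[X in ((pi^-1)%:E * X)%E]fineK; last exact: (integrable_fin_num measurableT ip).
rewrite -!EFinM; congr EFin.
have := spectrum_autocorr mw wM w0 wD m01.
rewrite (autocorr_frac mw wM w0 m01) /Rintegral; set S := fine _ => h.
transitivity ((Gamma m)^-1 * (pi^-1 * (Gamma m * cos (m * (pi / 2)) * S))).
  by rewrite [RHS]mulrCA -!mulrA mulKf// mulrCA.
rewrite h mulKf// -RintegralZl//.
  by apply: eq_Rintegral => x _; rewrite /frac_int (negbTE mn0) mulrA.
(* What remains is the integrability that allows 1 / Gamma(m) to be taken out; it is read off the
   convolution form, which is bounded and measurable. *)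
pose k (z : R * R) := w (z.1 - z.2).
have mk : measurable_fun setT k by apply: measurableT_comp mw _; exact: measurable_funB.
have m01' : 0 < m <= 1 by case/andP: m01 => -> /ltW.
have it := integrable_trunc_kern (b - a) m01'.
have mc := measurable_parametric it mk (fun z => wM _).
have igS : mu.-integrable `[a, b]
    (EFin \o (fun x => (\int[mu]_s (trunc_kern (b - a) m s * k (x, s))) * w x)); last first.
  move: igS; apply: eq_integrable => // x; rewrite inE/= in_itv/= => axb.
  by congr EFin; congr (_ * _); rewrite -(frac_conv mw wM w0 m01 axb).
apply: (@integrableS _ _ _ _ setT) => //.
apply: (@integrable_bnd_supp _ a b _ ((\int[mu]_s trunc_kern (b - a) m s) * M * M)).
- exact: measurable_funM.
- move=> x; rewrite normrM ler_pM//.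
  have ik : mu.-integrable setT (EFin \o (fun s => trunc_kern (b - a) m s * k (x, s))).
    apply: (@integrable_Mbnd _ _ (fun s => k (x, s)) M it); last by move=> s; exact: wM.
    exact: (measurableT_comp mk (pair1_measurable x)).
  apply: le_trans (le_normr_Rintegral measurableT ik) _.
  rewrite -RintegralZr//; apply: le_Rintegral => //.
  + exact: integrable_norm ik.
  + by have := integrableZr measurableT M it; exact: eq_integrable.
  + move=> s _; rewrite normrM (ger0_norm (trunc_kern_ge0 _ _ _)).
    by rewrite ler_wpM2l ?trunc_kern_ge0//; exact: wM.
- by move=> x /w0 ->; rewrite mulr0.
Qed.

End Hneg.

(** * Triangles, polynomials and slices of the plane *)

Section barycentric.
Context {R : realType}.
Implicit Types (P Q S z : R * R) (V : triangle R).

Lemma ord3P (i : 'I_3) : [\/ i = 0, i = 1 | i = 2%:R].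
Proof.
case: i => -[|[|[|//]]] i3; [apply: Or31|apply: Or32|apply: Or33]; exact: val_inj.
Qed.

Lemma ord3E : (1 + 2%:R = 0 :> 'I_3) * (1 + 1 = 2%:R :> 'I_3) * (2%:R + 1 = 0 :> 'I_3) *
  (2%:R + 2%:R = 1 :> 'I_3) * (0 + 1 = 1 :> 'I_3) * (0 + 2%:R = 2%:R :> 'I_3).
Proof. by do ![split]; apply: val_inj. Qed.

Lemma big_ord3 (T : Type) (idx : T) (op : Monoid.law idx) (F : 'I_3 -> T) :
  \big[op/idx]_(i < 3) F i = op (op (F 0) (F 1)) (F 2%:R).
Proof.
rewrite !big_ord_recr big_ord0 /= Monoid.mul1m.
by congr (op (op (F _) (F _)) (F _)); apply: val_inj.
Qed.

Lemma sum3 (W : nmodType) (F : 'I_3 -> W) : \sum_(i < 3) F i = F 0 + F 1 + F 2%:R.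
Proof. exact: big_ord3. Qed.

(** Twice the signed area of the triangle PQS. *)
Definition orient P Q S : R :=
  (Q.1 - P.1) * (S.2 - P.2) - (S.1 - P.1) * (Q.2 - P.2).

Lemma area2E V : area2 V = orient (V 0) (V 1) (V 2%:R). Proof. by []. Qed.

Lemma orientC P Q S : orient Q P S = - orient P Q S.
Proof. by rewrite /orient; ring. Qed.

Lemma orient_rot P Q S : orient Q S P = orient P Q S.
Proof. by rewrite /orient; ring. Qed.

Lemma area2_rot V i : orient (V i) (V (i + 1)) (V (i + 2%:R)) = area2 V.
Proof.
case: (ord3P i) => ->; rewrite ?ord3E area2E//; first exact: orient_rot.
by rewrite -[RHS]orient_rot -[RHS]orient_rot.
Qed.

(** The barycentric coordinates as ratios of signed areas, by Cramer's rule; the orientation of [V]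
    cancels in the quotient. *)
Definition lam V (i : 'I_3) z : R := orient z (V (i + 1)) (V (i + 2%:R)) / area2 V.

Variable V : triangle R.
Hypothesis V0 : area2 V != 0.

Lemma sum_lam z : \sum_i lam V i z = 1.
Proof.
rewrite sum3 /lam !ord3E -!mulrDl (_ : _ + _ + _ = area2 V) ?mulfV//.
by rewrite area2E /orient; ring.
Qed.

Lemma lam_barycenter (l : 'I_3 -> R) i : \sum_i l i = 1 -> lam V i (barycenter V l) = l i.
Proof.
rewrite /barycenter !sum3 => l1.
apply: (mulIf V0); rewrite /lam divfK//.
have {l1} l0E : l 0 = 1 - l 1 - l 2%:R by rewrite -l1; ring.
by case: (ord3P i) => ->; rewrite !ord3E area2E /orient/= l0E; ring.
Qed.

Lemma barycenter_lam z : barycenter V (fun i => lam V i z) = z.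
Proof.
rewrite [RHS]surjective_pairing /barycenter !sum3 /lam !ord3E.
by congr pair; apply: (mulIf V0); rewrite !mulrDl -!mulrA ![_^-1 * (_ * area2 V)]mulrCA mulVf// !mulr1 area2E /orient; ring.
Qed.

Lemma open_triangleE : open_triangle V = [set z | forall i, 0 < lam V i z].
Proof.
apply/seteqP; split => z /=.
  by move=> [l [l0 l1 ->]] i; rewrite lam_barycenter.
by move=> h; exists (fun i => lam V i z); rewrite sum_lam barycenter_lam.
Qed.

Lemma hullE (S : set 'I_3) :
  hull V S = [set z | (forall i, 0 <= lam V i z) /\ forall i, ~ S i -> lam V i z = 0].
Proof.
apply/seteqP; split => z /=.
  move=> [l [l0 l1 lS ->]]; split => i; rewrite lam_barycenter//; exact: lS.
by move=> [h1 h2]; exists (fun i => lam V i z); rewrite sum_lam barycenter_lam.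
Qed.

Lemma closed_triangleE : closed_triangle V = [set z | forall i, 0 <= lam V i z].
Proof. by rewrite /closed_triangle hullE; apply/seteqP; split => z /=; [case|]. Qed.

Lemma lam_affine i z z' (t : R) :
  lam V i (z.1 + t * z'.1, z.2 + t * z'.2) =
  lam V i z + t * (lam V i z' - lam V i (0, 0)).
Proof. by rewrite /lam -mulrBl mulrA -mulrDl /orient/=; congr (_ / _); ring. Qed.

Lemma measurable_lam i : measurable_fun setT (lam V i).
Proof.
apply: measurable_funM => //; apply: measurable_funB; apply: measurable_funM;
  apply: measurable_funB => //; exact: measurable_cst.
Qed.

Lemma measurable_open_triangle : measurable (open_triangle V).
Proof.
rewrite open_triangleE.
rewrite (_ : [set z | _] = \bigcap_(i in [set: 'I_3]) (lam V i @^-1` `]0, +oo[)); last first.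
  apply/seteqP; split => z /= h i; first by move=> _ /=; rewrite in_itv/= h.
  by have := h i Logic.I; rewrite /= in_itv/= andbT.
apply: fin_bigcap_measurable => // i _.
by rewrite -[X in measurable X]setTI; exact: measurable_lam.
Qed.

End barycentric.

(** * Evaluation of bivariate polynomials *)

Section polynomials.
Context {R : realType}.
Implicit Types (p : {poly {poly R}}) (z : R * R).

Lemma evE p z : ev p z = \sum_(j < size p) \sum_(i < size p`_j) p`_j`_i * z.1 ^+ i * z.2 ^+ j.
Proof.
rewrite /ev (horner_coef p).
rewrite horner_sum; apply: eq_bigr => j _.
by rewrite -polyC_exp hornerM hornerC horner_coef mulr_suml.
Qed.

Lemma measurable_ev p : measurable_fun setT (ev p).
Proof.
rewrite (_ : ev p = fun z => \sum_(j < size p) \sum_(i < size p`_j) p`_j`_i * z.1 ^+ i * z.2 ^+ j); last first.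
  by apply/funext => z; exact: evE.
apply: measurable_sum => j; apply: measurable_sum => i.
by apply: measurable_funM; [apply: measurable_funM => //|]; apply: measurable_funX.
Qed.

Lemma ev_bounded p (B : R) : exists2 M, 0 <= M & forall z, `|z.1| <= B -> `|z.2| <= B -> `|ev p z| <= M.
Proof.
exists (\sum_(j < size p) \sum_(i < size p`_j) `|p`_j`_i| * `|B| ^+ i * `|B| ^+ j).
  by apply: sumr_ge0 => j _; apply: sumr_ge0 => i _; rewrite !mulr_ge0 ?exprn_ge0.
move=> z z1 z2; rewrite evE.
apply: le_trans (ler_norm_sum _ _ _) _; apply: ler_sum => j _.
apply: le_trans (ler_norm_sum _ _ _) _; apply: ler_sum => i _.
rewrite !normrM !normrX; apply: ler_pM; rewrite ?mulr_ge0 ?exprn_ge0//.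
  by rewrite ler_wpM2l// lerXn2r ?nnegrE// (le_trans z1)// ler_norm.
by rewrite lerXn2r ?nnegrE// (le_trans z2)// ler_norm.
Qed.

Lemma continuous_ev1 p (y : R) : continuous (fun x => ev p (x, y)).
Proof. by move=> x; exact: continuous_horner. Qed.

Lemma continuous_ev2 p (x : R) : continuous (fun y => ev p (x, y)).
Proof.
move=> y; rewrite (_ : (fun y => _) = horner (\poly_(j < size p) (p`_j).[x])).
  exact: continuous_horner.
apply/funext => t; rewrite horner_poly /ev /= (horner_coef p) horner_sum.
by apply: eq_bigr => j _; rewrite -polyC_exp hornerM hornerC.
Qed.

Lemma evD p q z : ev (p + q) z = ev p z + ev q z.
Proof. by rewrite /ev !hornerD. Qed.

Lemma evM p q z : ev (p * q) z = ev p z * ev q z.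
Proof. by rewrite /ev !hornerM. Qed.

Lemma evZ (c : R) p z : ev (c%:P *: p) z = c * ev p z.
Proof. by rewrite /ev hornerZ hornerM hornerC. Qed.

End polynomials.

(** * Partial fractional integrals in the plane *)

Section plane.
Context {R : realType}.
Notation mu := (@lebesgue_measure R).
Variables (a b c d : R).
Implicit Types (W G : R * R -> R).

Definition in_rect (z : R * R) := (a <= z.1 <= b) && (c <= z.2 <= d).

Lemma integrable_plane W (M : R) : measurable_fun setT W -> (forall z, `|W z| <= M) ->
  (forall z, ~~ in_rect z -> W z = 0) -> (mu \x mu)%E.-integrable setT (EFin \o W).
Proof.
move=> mW WM W0.
have ig : mu.-integrable setT (EFin \o (fun x => M * \1_(`[a, b]%classic : set R) x)).
  by have := integrableZl measurableT M (integrable_indic_itv a b true false); exact: eq_integrable.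
apply: (integrable_prod_dominated _ ig (integrable_indic_itv c d true false)); first exact: mW.
move=> x y.
  have M0 : 0 <= M by exact: le_trans (WM (0, 0)).
  have [|/W0 ->] := boolP (in_rect (x, y)); last by rewrite normr0 mulr_ge0.
  move=> /andP[/= xab ycd]; rewrite !indicE !mem_set/= ?in_itv//= mulr1 normr1 mulr1.
  by apply: le_trans (WM _) _; exact: ler_norm.
Qed.

Definition frac_slice (m : R) W (z : R * R) : R := frac_int a m (fun x => W (x, z.2)) z.1.

(** Agrees with [frac_slice] over [[a, b]]. As a convolution with a fixed integrable kernel it is
    bounded and jointly measurable on the whole plane. *)
Definition frac_ext (m : R) W (z : R * R) : R :=
  if m == 0 then W z
  else (Gamma m)^-1 * \int[mu]_s (trunc_kern (b - a) m s * W (z.1 - s, z.2)).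

Section one_function.
Variables (W : R * R -> R) (M m : R).
Hypothesis mW : measurable_fun setT W.
Hypothesis WM : forall z, `|W z| <= M.
Hypothesis W0 : forall z, ~~ in_rect z -> W z = 0.
Hypothesis m01 : 0 <= m < 1.

Lemma measurable_slice y : measurable_fun setT (fun x => W (x, y)).
Proof. exact: measurableT_comp mW (pair2_measurable y). Qed.

Lemma slice0 y x : ~~ (a <= x <= b) -> W (x, y) = 0.
Proof. by move=> xab; apply: W0; rewrite /in_rect/= (negbTE xab). Qed.

Lemma frac_extE z : a <= z.1 <= b -> frac_slice m W z = frac_ext m W z.
Proof.
rewrite /frac_slice /frac_ext /frac_int => zab.
have [//|mn0] := eqVneq m 0; first by rewrite -surjective_pairing.
have m01' : 0 < m < 1 by rewrite lt_neqAle eq_sym mn0.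
by rewrite (frac_conv (measurable_slice _) (fun x => WM (x, z.2)) (@slice0 z.2) m01' zab).
Qed.

Lemma frac_ext_bounded : exists B, forall z, `|frac_ext m W z| <= B.
Proof.
rewrite /frac_ext; have [_|mn0] := eqVneq m 0; first by exists M.
have m01' : 0 < m <= 1 by case/andP: m01 => m0 /ltW ->; rewrite lt_neqAle eq_sym mn0 m0.
have it := integrable_trunc_kern (b - a) m01'.
exists (`|(Gamma m)^-1| * ((\int[mu]_s trunc_kern (b - a) m s) * M)) => z.
rewrite normrM ler_wpM2l//.
have mk : measurable_fun setT (fun s : R => W (z.1 - s, z.2)).
  apply: measurableT_comp (measurable_slice z.2) _; exact: measurable_funB.
have ik := integrable_Mbnd it mk (fun s => WM _).
apply: le_trans (le_normr_Rintegral measurableT ik) _.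
rewrite -RintegralZr//; apply: le_Rintegral => //.
- exact: integrable_norm ik.
- by have := integrableZr measurableT M it; exact: eq_integrable.
- move=> s _; rewrite normrM (ger0_norm (trunc_kern_ge0 _ _ _)).
  by rewrite ler_wpM2l ?trunc_kern_ge0//; exact: WM.
Qed.

Lemma measurable_frac_ext : measurable_fun setT (frac_ext m W).
Proof.
rewrite /frac_ext; have [//|mn0] := eqVneq m 0.
have m01' : 0 < m <= 1 by case/andP: m01 => m0 /ltW ->; rewrite lt_neqAle eq_sym mn0 m0.
have it := integrable_trunc_kern (b - a) m01'.
apply: measurable_funM => //.
pose k (z : (R * R) * R) := W (z.1.1 - z.2, z.1.2).
have mk : measurable_fun setT k.
  apply: measurableT_comp mW _; apply/measurable_fun_pairP; split => /=.
    by apply: measurable_funB => //; exact: measurableT_comp.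
  exact: (measurableT_comp measurable_snd measurable_fst).
exact: (measurable_parametric it mk (fun z => WM _)).
Qed.

End one_function.
End plane.

Section discontinuities.
Context {R : realType}.

(** Away from the roots of the nonconstant affine functions each sign is locally constant, and a
    function that vanishes identically makes the indicator 0. *)
Lemma finite_discontinuities_affine (A B : 'I_3 -> R) :
  finite_set [set t | ~ {for t, continuous (\1_[set t | forall i, 0 < A i + t * B i] : R -> R)}].
Proof.
apply: (@sub_finite_set _ _ ((fun i => - A i / B i) @` setT)); last first.
  exact: finite_image.
move=> t /=; apply: contra_notP => tN.
have cA i : {for t, continuous (fun s : R => A i + s * B i)}.
  by apply: cvgD; [exact: cvg_cst|apply: cvgM => //; exact: cvg_cst].
apply: cvg_near_cst; have [h|] := pselect (forall i, 0 < A i + t * B i).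
  have ni i : \forall x \near t, 0 < A i + x * B i by exact: (cvgr_gt _ (cA i)).
  near=> x; rewrite !indicE !mem_set// => i.
  by case: (ord3P i) => ->; near: x; exact: ni.
move=> /existsNP[i /negP]; rewrite -leNgt le_eqVlt => /orP[/eqP Ai|Ai]; last first.
  have ni : \forall x \near t, A i + x * B i < 0 by exact: (cvgr_lt _ (cA i)).
  near=> x; rewrite !indicE !memNset//= => /(_ i); rewrite ltNge; first by rewrite (ltW Ai).
  by move/negP; apply; apply: ltW; near: x.
have Bi : B i = 0.
  apply: contrapT => /eqP Bi; apply: tN; exists i => //.
  by move/eqP: Ai; rewrite addr_eq0 => /eqP ->; rewrite opprK mulfK.
have {}Ai : A i = 0 by move: Ai; rewrite Bi mulr0 addr0.
by apply: nearW => x; rewrite !indicE !memNset//= => /(_ i); rewrite Bi Ai mulr0 addr0 ltxx.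
Unshelve. all: by end_near. Qed.

End discontinuities.

Section broken_functions.
Context {R : realType}.
Notation mu := (@lebesgue_measure R).
Variables (a b c d : R) (K : nat) (D : 'I_K -> triangle R).
Hypothesis hD : triangulation a b c d D.
Implicit Types v w : broken R K.

Let D0 k : area2 (D k) != 0. Proof. by case: hD. Qed.

Definition plane_fun v (z : R * R) : R := to_fun D v z.1 z.2.

Lemma plane_funE v z : plane_fun v z = \sum_(k < K) \1_(open_triangle (D k)) z * ev (v k) z.
Proof. by case: z. Qed.

Lemma open_triangle_in_rect k z : open_triangle (D k) z -> in_rect a b c d z.
Proof.
move=> [l [l0 l1 zE]].
have : closed_rect a b c d z.
  have [_ <- _ _] := hD; exists k => //.
  by exists l; split => // i; [exact: (ltW (l0 i))|case].
by case => /=; rewrite !in_itv/= /in_rect => -> ->.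
Qed.

Lemma plane_fun0 v z : ~~ in_rect a b c d z -> plane_fun v z = 0.
Proof.
move=> zr; rewrite plane_funE big1// => k _.
by rewrite indicE memNset ?mul0r// => /open_triangle_in_rect; exact/negP.
Qed.

Lemma measurable_indic_triangle k : measurable_fun setT (\1_(open_triangle (D k)) : R * R -> R).
Proof. by apply: measurable_indic; exact: measurable_open_triangle. Qed.

Lemma measurable_plane_fun v : measurable_fun setT (plane_fun v).
Proof.
rewrite (_ : plane_fun v = fun z => \sum_(k < K) \1_(open_triangle (D k)) z * ev (v k) z); last first.
  by apply/funext => z; exact: plane_funE.
apply: measurable_sum => k; apply: measurable_funM; first exact: measurable_indic_triangle.
exact: measurable_ev.
Qed.

Lemma rect_ev_bounded p : exists2 M, 0 <= M & forall z, in_rect a b c d z -> `|ev p z| <= M.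
Proof.
have [M M0 h] := ev_bounded p (`|a| + `|b| + `|c| + `|d|); exists M => // z /andP[h1 h2].
have ab (x y t : R) : x <= t <= y -> `|t| <= `|x| + `|y|.
  move=> /andP[xt ty]; rewrite ler_norml; apply/andP; split.
    by rewrite opprD; apply: le_trans xt; have := ler_norm (- x); rewrite normrN; have := normr_ge0 y; lra.
  by apply: le_trans ty _; rewrite ler_wpDl// ler_norm.
have := ab _ _ _ h1; have := ab _ _ _ h2; have := normr_ge0 a; have := normr_ge0 b.
have := normr_ge0 c; have := normr_ge0 d => ? ? ? ? ? ?.
by apply: h; lra.
Qed.

Lemma indic_ev_bounded k p :
  exists2 M, 0 <= M & forall z, `|\1_(open_triangle (D k)) z * ev p z| <= M.
Proof.
have [M M0 h] := rect_ev_bounded p; exists M => // z; rewrite indicE.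
have [zk|] := boolP (z \in _); last by rewrite mul0r normr0.
by rewrite mul1r; apply: h; apply: open_triangle_in_rect; rewrite -inE; exact: zk.
Qed.

Lemma plane_fun_bounded v : exists M, forall z, `|plane_fun v z| <= M.
Proof.
have /all_sig2[M M0 h] k := cid2 (indic_ev_bounded k (v k)).
exists (\sum_k M k) => z; rewrite plane_funE.
by apply: le_trans (ler_norm_sum _ _ _) _; apply: ler_sum.
Qed.

Lemma finite_discontinuities_sum (F : 'I_K -> R -> R) :
  (forall k, finite_set [set t | ~ {for t, continuous (F k)}]) ->
  finite_set [set t | ~ {for t, continuous (fun t => \sum_k F k t)}].
Proof.
move=> h; apply: (@sub_finite_set _ _ (\bigcup_(k in [set: 'I_K]) [set t | ~ {for t, continuous (F k)}])).
  move=> t /=; apply: contra_notP => tN; apply: cvg_big => [|k _]; first by move=> x; exact: add_continuous.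
  by apply: contrapT => tk; apply: tN; exists k.
by apply: bigcup_finite.
Qed.

Lemma finite_discontinuitiesM (F G : R -> R) : continuous G ->
  finite_set [set t | ~ {for t, continuous F}] ->
  finite_set [set t | ~ {for t, continuous (fun t => F t * G t)}].
Proof.
move=> cG; apply: sub_finite_set => t /=; apply: contra_not => cF.
by apply: cvgM => //; exact: cG.
Qed.

Lemma plane_fun_slice1 v y :
  finite_set [set x | ~ {for x, continuous (fun x => plane_fun v (x, y))}].
Proof.
rewrite (_ : (fun x => _) = fun x => \sum_(k < K) \1_(open_triangle (D k)) (x, y) * ev (v k) (x, y)).
  apply: finite_discontinuities_sum => k; apply: finite_discontinuitiesM; first exact: continuous_ev1.
  rewrite (_ : (fun t : R => _) = \1_[set t | forall i, 0 < lam (D k) i (0, y) + t * (lam (D k) i (1, 0) - lam (D k) i (0, 0))]).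
    exact: finite_discontinuities_affine.
  apply/funext => t; rewrite !indicE; congr (_%:R); congr nat_of_bool; apply/idP/idP;
    rewrite !inE open_triangleE//= => h i; have := h i;
    by rewrite -lam_affine/= add0r mulr1 mulr0 addr0.
by apply/funext => x; rewrite plane_funE.
Qed.

Lemma plane_fun_slice2 v x :
  finite_set [set y | ~ {for y, continuous (fun y => plane_fun v (x, y))}].
Proof.
rewrite (_ : (fun y => _) = fun y => \sum_(k < K) \1_(open_triangle (D k)) (x, y) * ev (v k) (x, y)).
  apply: finite_discontinuities_sum => k; apply: finite_discontinuitiesM; first exact: continuous_ev2.
  rewrite (_ : (fun t : R => _) = \1_[set t | forall i, 0 < lam (D k) i (x, 0) + t * (lam (D k) i (0, 1) - lam (D k) i (0, 0))]).
    exact: finite_discontinuities_affine.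
  apply/funext => t; rewrite !indicE; congr (_%:R); congr nat_of_bool; apply/idP/idP;
    rewrite !inE open_triangleE//= => h i; have := h i;
    by rewrite -lam_affine/= add0r mulr1 mulr0 addr0.
by apply/funext => y; rewrite plane_funE.
Qed.

End broken_functions.

(** * Fractional quadratic forms in the plane *)

Section energy.
Context {R : realType}.
Notation mu := (@lebesgue_measure R).
Notation plane := (mu \x mu)%E.
Variables (a b c d m : R).
Hypothesis m01 : 0 <= m < 1.
Implicit Types (W G : R * R -> R).

Definition rect_fun W := [/\ measurable_fun setT W, exists M, forall z, `|W z| <= M &
  forall z, ~~ in_rect a b c d z -> W z = 0].

Lemma integrable_rect_fun W : rect_fun W -> plane.-integrable setT (EFin \o W).
Proof. by move=> [mW [M WM] W0]; exact: (integrable_plane mW WM W0). Qed.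

Definition energy W G := \int[plane]_z (frac_ext a b m W z * G z).

Lemma rect_fun_energy W G : rect_fun W -> rect_fun G -> rect_fun (fun z => frac_ext a b m W z * G z).
Proof.
move=> [mW [M WM] W0] [mG [M' GM] G0]; split.
- by apply: measurable_funM => //; exact: (measurable_frac_ext _ _ mW WM m01).
- have [B WB] := frac_ext_bounded a b mW WM m01; exists (B * M') => z.
  by rewrite normrM ler_pM.
- by move=> z zr; rewrite G0// mulr0.
Qed.

Lemma integrable_energy W G : rect_fun W -> rect_fun G ->
  plane.-integrable setT (EFin \o (fun z => frac_ext a b m W z * G z)).
Proof. by move=> rW rG; apply: integrable_rect_fun; exact: rect_fun_energy. Qed.

Lemma energyDr W G G' : rect_fun W -> rect_fun G -> rect_fun G' ->
  energy W (fun z => G z + G' z) = energy W G + energy W G'.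
Proof.
move=> rW rG rG'; rewrite /energy -RintegralD//; try exact: integrable_energy.
by apply: eq_Rintegral => z _; rewrite mulrDr.
Qed.

Lemma energyZr k W G : rect_fun W -> rect_fun G ->
  energy W (fun z => k * G z) = k * energy W G.
Proof.
move=> rW rG; rewrite /energy -RintegralZl//; last exact: integrable_energy.
by apply: eq_Rintegral => z _; rewrite mulrCA.
Qed.

Lemma integrable_frac_kernel W z : 0 < m <= 1 -> rect_fun W ->
  mu.-integrable setT (EFin \o (fun s => trunc_kern (b - a) m s * W (z.1 - s, z.2))).
Proof.
move=> m01' [mW [M WM] W0]; apply: integrable_Mbnd (integrable_trunc_kern _ m01') _ (fun s => WM _).
apply: measurableT_comp (measurable_slice mW z.2) _; exact: measurable_funB.
Qed.

Lemma frac_extD W G z : rect_fun W -> rect_fun G ->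
  frac_ext a b m (fun z => W z + G z) z = frac_ext a b m W z + frac_ext a b m G z.
Proof.
move=> rW rG; rewrite /frac_ext; have [//|mn0] := eqVneq m 0.
have m01' : 0 < m <= 1 by case/andP: m01 => m0 /ltW ->; rewrite lt_neqAle eq_sym mn0 m0.
rewrite -mulrDr -RintegralD//; try exact: integrable_frac_kernel.
by congr (_ * _); apply: eq_Rintegral => s _; rewrite mulrDr.
Qed.

Lemma frac_extZ k W z : rect_fun W ->
  frac_ext a b m (fun z => k * W z) z = k * frac_ext a b m W z.
Proof.
move=> rW; rewrite /frac_ext; have [//|mn0] := eqVneq m 0.
have m01' : 0 < m <= 1 by case/andP: m01 => m0 /ltW ->; rewrite lt_neqAle eq_sym mn0 m0.
rewrite mulrCA -(RintegralZl k measurableT (integrable_frac_kernel z m01' rW)).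
by congr (_ * _); apply: eq_Rintegral => s _; rewrite mulrCA.
Qed.

Lemma energyDl W W' G : rect_fun W -> rect_fun W' -> rect_fun G ->
  energy (fun z => W z + W' z) G = energy W G + energy W' G.
Proof.
move=> rW rG rG'; rewrite /energy -RintegralD//; try exact: integrable_energy.
by apply: eq_Rintegral => z _; rewrite frac_extD// mulrDl.
Qed.

Lemma energyZl k W G : rect_fun W -> rect_fun G ->
  energy (fun z => k * W z) G = k * energy W G.
Proof.
move=> rW rG; rewrite /energy -RintegralZl//; last exact: integrable_energy.
by apply: eq_Rintegral => z _; rewrite frac_extZ// mulrA.
Qed.

Lemma energy_restrict W (T : set (R * R)) (h : R * R -> R) : rect_fun W ->
  (forall z, T z -> in_rect a b c d z) ->
  \int[plane]_(z in T) (frac_slice a m W z * h z) = energy W (fun z => \1_T z * h z).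
Proof.
move=> [mW [M WM] W0] Tr; rewrite Rintegral_mkcond; apply: eq_Rintegral => z _.
rewrite patchE indicE; case: ifPn => [|_]; last by rewrite mul0r mulr0.
by rewrite inE => /Tr /andP[zab _]; rewrite mul1r (frac_extE mW WM W0).
Qed.

Lemma slice_energy W y : rect_fun W ->
  \int[mu]_(x in `[a, b]) (frac_int a m (fun x => W (x, y)) x * W (x, y)) =
  \int[mu]_x (frac_ext a b m W (x, y) * W (x, y)).
Proof.
move=> [mW [M WM] W0]; rewrite Rintegral_mkcond; apply: eq_Rintegral => x _.
rewrite patchE mem_setE in_itv/=; case: ifPn.
  by move=> xab; rewrite -(frac_extE mW WM W0)//.
by move=> xab; rewrite W0 ?mulr0// /in_rect/= (negbTE xab).
Qed.

(** The identity on a line is applied to every horizontal slice and integrated by Fubini. Dividing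
    by the cosine is possible because [m < 1] keeps the angle below [pi / 2]; finiteness of the
    extended integral comes out of the same identity. *)
Lemma Hneg_energy W : rect_fun W ->
  (forall y, finite_set [set x | ~ {for x, continuous (fun x => W (x, y))}]) ->
  (\int[mu]_(y in `[c, d]) (Hneg_norm (m / 2) (fun x => W (x, y)) ^+ 2))%E =
  ((cos (m * (pi / 2)))^-1 * energy W W)%:E.
Proof.
move=> rW Wd; have cos0 : 0 < cos (m * (pi / 2)).
  apply: cos_gt0_pihalf; have p0 := pi_gt0 R; case/andP: m01 => m0 m1.
  apply/andP; split; first by apply: lt_le_trans (_ : 0 <= _); [rewrite oppr_lt0 divr_gt0|rewrite mulr_ge0// divr_ge0// ltW].
  by rewrite gtr_pMl// divr_gt0.
pose g y := \int[mu]_x (frac_ext a b m W (x, y) * W (x, y)).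
have iE := integrable_energy rW rW.
have ig : mu.-integrable setT (EFin \o g).
  exact: integrable_Rfubini2 iE.
have g0 y : ~~ (c <= y <= d) -> g y = 0.
  move=> ycd; transitivity (\int[mu]_(_ in [set: R]) (0 : R)); last by rewrite /Rintegral integral0.
  apply: eq_Rintegral => x _; case: rW => _ _ W0.
  by rewrite W0 ?mulr0// /in_rect/= (negbTE ycd) andbF.
transitivity (\int[mu]_(y in `[c, d]) ((cos (m * (pi / 2)))^-1 * g y)%:E)%E.
  apply: eq_integral => y _; case: (rW) (slice_energy y rW) => mW [M WM] W0 sE.
  have := Hneg_frac (measurable_slice mW y) (fun x => WM (x, y)) (slice0 W0 y) (Wd y) m01.
  rewrite sE -/(g y); move: (Hneg_norm _ _ ^+ 2)%E => H hE.
  by rewrite EFinM -hE muleA -EFinM mulVf ?mul1e// (gt_eqF cos0).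
rewrite integral_mkcond.
transitivity (\int[mu]_y ((cos (m * (pi / 2)))^-1 * g y)%:E)%E.
  apply: eq_integral => y _; rewrite patchE mem_setE in_itv/=.
  by case: ifPn => // /g0 ->; rewrite mulr0.
rewrite /energy (Rfubini2 iE) -/g.
rewrite -RintegralZl// /Rintegral fineK//.
by apply: integrable_fin_num => //; have := integrableZl measurableT ((cos (m * (pi / 2)))^-1) ig; exact: eq_integrable.
Qed.

End energy.

(** * Exchange of the two coordinates *)

Section swap.
Context {R : realType}.
Notation mu := (@lebesgue_measure R).
Notation plane := (mu \x mu)%E.
Variables (a b c d : R).
Implicit Types (W : R * R -> R).

Lemma rect_fun_swap W : rect_fun a b c d W -> rect_fun c d a b (W \o swap_pair).
Proof.
move=> [mW [M WM] W0]; split.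
- by apply: measurableT_comp mW _; exact: measurable_swap.
- by exists M => z /=.
- by move=> z zr /=; apply: W0; move: zr; rewrite /in_rect/= andbC.
Qed.

Lemma Rintegral_swap W : rect_fun a b c d W ->
  \int[plane]_z W (swap_pair z) = \int[plane]_z W z.
Proof.
move=> rW; rewrite (Rfubini2 (integrable_rect_fun rW)).
exact: (Rfubini1 (integrable_rect_fun (rect_fun_swap rW))).
Qed.

End swap.

(** Linearity over [R]. Scalars enter as constants [x%:P] because bivariate polynomials are here a
    module over [{poly R}]. *)
Definition additive_homogeneous {R : realType} {J : Type} (L : (J -> {poly {poly R}}) -> R) :=
  (forall v w, L (fun k => v k + w k) = L v + L w) /\
  (forall x v, L (fun k => x%:P *: v k) = x * L v).

Section fractional_forms.
Context {R : realType}.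
Notation mu := (@lebesgue_measure R).
Notation plane := (mu \x mu)%E.
Variables (a b c d : R) (K : nat) (D : 'I_K -> triangle R).
Hypothesis hD : triangulation a b c d D.
Implicit Types v w : broken R K.

Lemma plane_funD v w : plane_fun D (fun k => v k + w k) = fun z => plane_fun D v z + plane_fun D w z.
Proof.
apply/funext => z; rewrite !plane_funE -big_split; apply: eq_bigr => k _.
by rewrite evD mulrDr.
Qed.

Lemma plane_funZ x v : plane_fun D (fun k => x%:P *: v k) = fun z => x * plane_fun D v z.
Proof.
apply/funext => z; rewrite !plane_funE mulr_sumr; apply: eq_bigr => k _.
by rewrite evZ mulrCA.
Qed.

Lemma rect_fun_plane_fun v : rect_fun a b c d (plane_fun D v).
Proof.
split; [exact: measurable_plane_fun hD v|exact: plane_fun_bounded hD v|].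
by move=> z; exact: plane_fun0 hD v z.
Qed.

Lemma rect_fun_triangle k p : rect_fun a b c d (fun z => \1_(open_triangle (D k)) z * ev p z).
Proof.
split.
- by apply: measurable_funM; [exact: measurable_indic_triangle hD k|exact: measurable_ev].
- by have [M _ ?] := indic_ev_bounded hD k p; exists M.
- move=> z zr; rewrite indicE memNset ?mul0r// => /(open_triangle_in_rect hD).
  exact/negP.
Qed.

Section x_form.
Variable m : R.
Hypothesis m01 : 0 <= m < 1.

Lemma energy_sumr W (I : Type) (r : seq I) (G : I -> R * R -> R) : rect_fun a b c d W ->
  (forall i, rect_fun a b c d (G i)) ->
  energy a b m W (fun z => \sum_(i <- r) G i z) = \sum_(i <- r) energy a b m W (G i).
Proof.
move=> rW rG; rewrite /energy -Rintegral_sum// => [|i]; last exact: (integrable_energy m01 rW (rG i)).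
by apply: eq_Rintegral => z _; rewrite mulr_sumr.
Qed.

Lemma ip_frac_slice v w :
  ip D (fun _ z => frac_int a m (fun x => to_fun D v x z.2) z.1) (evb w) =
  energy a b m (plane_fun D v) (plane_fun D w).
Proof.
rewrite [in RHS](_ : plane_fun D w = fun z => \sum_(k < K) \1_(open_triangle (D k)) z * ev (w k) z); last first.
  by apply/funext => z; exact: plane_funE.
rewrite energy_sumr; [|exact: rect_fun_plane_fun|by move=> k; exact: rect_fun_triangle].
apply: eq_bigr => k _.
rewrite -(energy_restrict m01 _ (rect_fun_plane_fun v))//.
exact: (open_triangle_in_rect hD).
Qed.

End x_form.

Lemma energy_linearl m w : 0 <= m < 1 ->
  additive_homogeneous (fun v => energy a b m (plane_fun D v) (plane_fun D w)).
Proof.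
move=> m01; have rp := rect_fun_plane_fun; split => [v v'|x v].
  by rewrite plane_funD (energyDl m01 (rp _) (rp _) (rp _)).
by rewrite plane_funZ (energyZl m01 _ (rp _) (rp _)).
Qed.

Lemma energy_linearr m v : 0 <= m < 1 ->
  additive_homogeneous (fun w => energy a b m (plane_fun D v) (plane_fun D w)).
Proof.
move=> m01; have rp := rect_fun_plane_fun; split => [w w'|x w].
  by rewrite plane_funD (energyDr m01 (rp _) (rp _) (rp _)).
by rewrite plane_funZ (energyZr m01 _ (rp _) (rp _)).
Qed.

Lemma Hneg_slices1 m v : 0 <= m < 1 ->
  (\int[mu]_(y in `[c, d]) (Hneg_norm (m / 2) (fun x => to_fun D v x y) ^+ 2))%E =
  ((cos (m * (pi / 2)))^-1 * energy a b m (plane_fun D v) (plane_fun D v))%:E.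
Proof.
move=> m01; exact: (Hneg_energy m01 (rect_fun_plane_fun v) (plane_fun_slice1 hD v)).
Qed.

(** The form in the y direction is the one in the x direction after reflection in the diagonal, so
    that all its properties are inherited. *)
Definition yenergy m v w := energy c d m (plane_fun D v \o swap_pair) (plane_fun D w \o swap_pair).

Lemma ip_frac_slice2 m v w : 0 <= m < 1 ->
  ip D (fun _ z => frac_int c m (fun y => to_fun D v z.1 y) z.2) (evb w) =
  yenergy m v w.
Proof.
move=> m01; have rv := rect_fun_swap (rect_fun_plane_fun v).
have [mv [M vM] v0] := rv.
rewrite /yenergy /energy.
rewrite -(Rintegral_swap (rect_fun_energy m01 rv (rect_fun_swap (rect_fun_plane_fun w)))).
pose F k z := \1_(open_triangle (D k)) z * ev (w k) z.
have rF k : rect_fun a b c d (fun z => frac_ext c d m (plane_fun D v \o swap_pair) (swap_pair z) * F k z).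
  have := rect_fun_swap (rect_fun_energy m01 rv (rect_fun_swap (rect_fun_triangle k (w k)))).
  by congr rect_fun; apply/funext => -[x y].
transitivity (\sum_(k < K) \int[plane]_z (frac_ext c d m (plane_fun D v \o swap_pair) (swap_pair z) * F k z)).
  apply: eq_bigr => k _; rewrite Rintegral_mkcond; apply: eq_Rintegral => z _.
  rewrite patchE /F indicE; case: ifPn => [|_]; last by rewrite mul0r mulr0.
  rewrite inE => /(open_triangle_in_rect hD)/andP[_ zcd]; rewrite mul1r; congr (_ * _).
  by rewrite -(frac_extE mv vM v0).
rewrite -Rintegral_sum// => [|k]; last exact: integrable_rect_fun (rF k).
apply: eq_Rintegral => z _; rewrite -mulr_sumr; congr (_ * _).
by rewrite /F -plane_funE; case: z.
Qed.

Lemma yenergy_linearl m w : 0 <= m < 1 -> additive_homogeneous (fun v => yenergy m v w).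
Proof.
move=> m01; have rp v := rect_fun_swap (rect_fun_plane_fun v); split => [v v'|x v].
  by rewrite /yenergy -(energyDl m01 (rp _) (rp _) (rp _)) plane_funD.
by rewrite /yenergy -(energyZl m01 _ (rp _) (rp _)) plane_funZ.
Qed.

Lemma yenergy_linearr m v : 0 <= m < 1 -> additive_homogeneous (yenergy m v).
Proof.
move=> m01; have rp w := rect_fun_swap (rect_fun_plane_fun w); split => [w w'|x w].
  by rewrite /yenergy -(energyDr m01 (rp _) (rp _) (rp _)) plane_funD.
by rewrite /yenergy -(energyZr m01 _ (rp _) (rp _)) plane_funZ.
Qed.

Lemma Hneg_slices2 m v : 0 <= m < 1 ->
  (\int[mu]_(x in `[a, b]) (Hneg_norm (m / 2) (fun y => to_fun D v x y) ^+ 2))%E =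
  ((cos (m * (pi / 2)))^-1 * yenergy m v v)%:E.
Proof.
move=> m01; exact: (Hneg_energy m01 (rect_fun_swap (rect_fun_plane_fun v)) (plane_fun_slice2 hD v)).
Qed.

End fractional_forms.

(** * The divergence theorem on a triangle *)

Section poly_slices.
Context {R : realType}.
Implicit Types p : {poly {poly R}}.

Lemma ev_swapXY p z : ev (swapXY p) z = ev p (swap_pair z).
Proof. exact: horner2_swapXY. Qed.

Definition yslice p (x : R) : {poly R} := (swapXY p).[x%:P].

Lemma ysliceE p x y : (yslice p x).[y] = ev p (x, y).
Proof. exact: horner2_swapXY. Qed.

Lemma yslice_dy p x : yslice (dy p) x = (yslice p x)^`().
Proof. by rewrite /yslice !horner_swapXY deriv_map. Qed.

Lemma swapXY_dx p : swapXY (dx p) = dy (swapXY p).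
Proof.
apply/polyP => i; apply/polyP => j.
rewrite coef_swapXY /dx /dy coef_map_id0 ?deriv0// !coef_deriv coefMn coef_swapXY.
by [].
Qed.

Lemma Rintegral_itv_dy p x (u v : R) : u < v ->
  \int[lebesgue_measure]_(y in `]u, v[) ev (dy p) (x, y) = ev p (x, v) - ev p (x, u).
Proof.
move=> uv; set F := horner (yslice p x).
have dF y : is_derive y (1 : R) F (yslice p x)^`().[y] by exact: is_derive_poly.
have cF : continuous F by exact: continuous_horner.
have iF : lebesgue_measure.-integrable `[u, v] (EFin \o horner (yslice p x)^`()).
  apply: continuous_compact_integrable; first exact: segment_compact.
  by apply: continuous_subspaceT; exact: continuous_horner.
transitivity (\int[lebesgue_measure]_(y in `[u, v]) (yslice p x)^`().[y]).
  rewrite -Rintegral_itv_obnd_cbnd -?Rintegral_itv_bndo_bndc; last 2 first.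
  - by apply: integrableS iF => //; apply: subset_itv; rewrite bnd_simp.
  - by apply: integrableS iF => //; apply: subset_itv; rewrite bnd_simp.
  by apply: eq_Rintegral => y _; rewrite -yslice_dy ysliceE.
rewrite /Rintegral (@continuous_FTC2 _ _ F)//.
- by rewrite /= /F !ysliceE.
- apply: continuous_subspaceT; exact: continuous_horner.
- split; first by move=> y _; exact: derivable_horner.
  + exact/cvg_at_right_filter/cF.
  + exact/cvg_at_left_filter/cF.
- by move=> y _; rewrite /F -derivE.
Qed.

End poly_slices.

Section triangle_slices.
Context {R : realType}.
Notation mu := (@lebesgue_measure R).
Notation plane := (mu \x mu)%E.
Variables (V : triangle R) (p : {poly {poly R}}).
Hypothesis V0 : area2 V != 0.
Let A := area2 V.

(* The value of [p] above [x] on the line through two vertices, signed by the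
   direction in which the edge crosses the vertical line. *)
Definition crossing (P Q : R * R) (x : R) : R :=
  let s := (x - P.1) / (Q.1 - P.1) in
  Num.sg (Q.1 - P.1) * (\1_(`]0, 1[%classic : set R) s * ev p (x, P.2 + s * (Q.2 - P.2))).

Definition line (P Q : R * R) (x : R) := P.2 + (x - P.1) / (Q.1 - P.1) * (Q.2 - P.2).

Lemma crossingE P Q x : x != P.1 -> x != Q.1 -> crossing P Q x =
  if P.1 < x < Q.1 then ev p (x, line P Q x)
  else if Q.1 < x < P.1 then - ev p (x, line P Q x) else 0.
Proof.
rewrite /crossing => xP xQ; rewrite indicE mem_setE in_itv/=.
case: (ltgtP P.1 Q.1) => PQ.
- have q0 : 0 < Q.1 - P.1 by rewrite subr_gt0.
  rewrite gtr0_sg// mul1r pmulr_lgt0 ?invr_gt0// ltr_pdivrMr// mul1r subr_gt0 ltrBlDr subrK.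
  case: ifPn => _; first by rewrite mul1r.
  rewrite mul0r; case: ifPn => // /andP[h1 h2].
  by have := lt_trans h1 h2; rewrite ltNge (ltW PQ).
- have q0 : Q.1 - P.1 < 0 by rewrite subr_lt0.
  rewrite ltr0_sg// mulN1r nmulr_lgt0 ?invr_lt0// ltr_ndivrMr// mul1r subr_lt0 ltrBDr subrK.
  rewrite [(x < _) && _]andbC.
  case: (boolP (P.1 < x < Q.1)) => [/andP[h1 h2]|_].
    by have := lt_trans h1 h2; rewrite ltNge (ltW PQ).
  by case: ifPn => _; rewrite ?mul1r// mul0r oppr0.
- rewrite PQ subrr sgr0 mul0r; case: ifPn => [/andP[h1 h2]|_].
    by have := lt_trans h1 h2; rewrite ltxx.
  case: ifPn => [/andP[h1 h2]|//].
  by have := lt_trans h1 h2; rewrite ltxx.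
Qed.

Lemma orient_line P Q x y : P.1 != Q.1 ->
  orient (x, y) P Q = (Q.1 - P.1) * (y - line P Q x).
Proof.
move=> PQ; have q0 : Q.1 - P.1 != 0 by rewrite subr_eq0 eq_sym.
by rewrite /orient /line/=; field.
Qed.

(** The set is the open interval between [u] and [v], whose order is given by the sign of [k]. Both
    orientations of a triangle are covered at once. *)
Lemma slice_integral (x u v k : R) : 0 < k * (u - v) ->
  \int[mu]_y (\1_[set y | 0 < - k * (y - u) /\ 0 < k * (y - v)] y * ev (dy p) (x, y)) =
  Num.sg k * (ev p (x, u) - ev p (x, v)).
Proof.
case: (ltgtP k 0) => [k0|k0|->]; last by rewrite mul0r ltxx.
- rewrite nmulr_rgt0// subr_lt0 => uv.
  rewrite ltr0_sg// mulN1r opprB -Rintegral_itv_dy// [RHS]Rintegral_mkcond.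
  apply: eq_Rintegral => y _; rewrite patchE mem_setE indicE in_itv/=.
  rewrite (_ : (y \in _) = (u < y < v)); first by case: ifPn => _; rewrite ?mul1r ?mul0r.
  apply/idP/idP; rewrite inE/= mulNr oppr_gt0 nmulr_rlt0// nmulr_rgt0// subr_lt0 subr_gt0.
    by move=> [-> ->].
  by move=> /andP.
- rewrite pmulr_rgt0// subr_gt0 => uv.
  rewrite gtr0_sg// mul1r -Rintegral_itv_dy// [RHS]Rintegral_mkcond.
  apply: eq_Rintegral => y _; rewrite patchE mem_setE indicE in_itv/=.
  rewrite (_ : (y \in _) = (v < y < u)); first by case: ifPn => _; rewrite ?mul1r ?mul0r.
  apply/idP/idP; rewrite inE/= mulNr oppr_gt0 pmulr_rlt0// pmulr_rgt0// subr_lt0 subr_gt0.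
    by move=> [-> ->].
  by move=> /andP[-> ->].
Qed.

Definition slice_dy x := \int[mu]_y (\1_(open_triangle V) (x, y) * ev (dy p) (x, y)).

Lemma sum3_rot (F : 'I_3 -> R) i : \sum_j F j = F i + F (i + 1) + F (i + 2%:R).
Proof. by rewrite sum3; case: (ord3P i) => ->; rewrite ?ord3E//; ring. Qed.

Lemma ord3D (i : 'I_3) : (i + 1 + 1 = i + 2%:R) * (i + 1 + 2%:R = i) * (i + 2%:R + 1 = i) *
  (i + 2%:R + 2%:R = i + 1).
Proof. by do ![split]; case: (ord3P i) => ->; apply: val_inj. Qed.

(** The vertical line separates [V i] from the other two vertices, so it meets the triangle between
    its two edges at [V i], and the fundamental theorem of calculus applies between the two
    crossings. *)
Lemma slice_dy_alone x i :
  (V i).1 < x /\ x < (V (i + 1)).1 /\ x < (V (i + 2%:R)).1 \/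
  x < (V i).1 /\ (V (i + 1)).1 < x /\ (V (i + 2%:R)).1 < x ->
  slice_dy x = - (Num.sg A * \sum_j crossing (V j) (V (j + 1)) x).
Proof.
set P := V i; set Q := V (i + 1); set S := V (i + 2%:R) => H.
have AE : A = orient P Q S by rewrite /P /Q /S area2_rot.
pose k := (Q.1 - P.1) / A; pose r := (S.1 - P.1) / (Q.1 - P.1).
have [xP xQ xS] : [/\ x != P.1, x != Q.1 & x != S.1].
  by case: H => -[h1 [h2 h3]]; rewrite !neq_lt h1 h2 h3 !orbT.
have QP : Q.1 - P.1 != 0.
  by rewrite subr_eq0; case: H => -[h1 [h2 h3]]; rewrite neq_lt ?(lt_trans h1 h2) ?(lt_trans h2 h1) ?orbT.
have SP : S.1 - P.1 != 0.
  by rewrite subr_eq0; case: H => -[h1 [h2 h3]]; rewrite neq_lt ?(lt_trans h1 h3) ?(lt_trans h3 h1) ?orbT.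
have r0 : 0 < r.
  case: H => -[h1 [h2 h3]]; first by rewrite divr_gt0// subr_gt0 ?(lt_trans h1 h2) ?(lt_trans h1 h3).
  by rewrite nmulr_rgt0 ?invr_lt0 subr_lt0 ?(lt_trans h2 h1) ?(lt_trans h3 h1).
have kuv : 0 < k * (line S P x - line P Q x).
  have -> : k * (line S P x - line P Q x) = (x - P.1) / (S.1 - P.1).
    have -> : line S P x - line P Q x = (x - P.1) * A / ((S.1 - P.1) * (Q.1 - P.1)).
      have PS : P.1 - S.1 != 0 by rewrite -opprB oppr_eq0.
      by rewrite AE /orient /line; field; rewrite PS QP SP.
    by rewrite /k; field; rewrite V0 QP SP.
  case: H => -[h1 [h2 h3]]; first by rewrite divr_gt0// subr_gt0 ?(lt_trans h1 h3).
  by rewrite nmulr_rgt0 ?invr_lt0 subr_lt0 ?(lt_trans h3 h1).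
transitivity (Num.sg k * (ev p (x, line S P x) - ev p (x, line P Q x))).
  rewrite -(slice_integral x kuv) /slice_dy; apply: eq_Rintegral => y _; congr (_ * _).
  rewrite !indicE; congr (_%:R); congr nat_of_bool.
  (* Up to the positive factor [r], the two coordinates that vanish on the edges at [V i] are the
     inequalities of [slice_integral]. *)
  have l1 : lam V (i + 1) (x, y) = r * (- k * (y - line S P x)).
    rewrite /lam !ord3D -/S -/P -/A orient_line; last by rewrite -subr_eq0.
    by rewrite /r /k; field; apply/andP.
  have l2 : lam V (i + 2%:R) (x, y) = k * (y - line P Q x).
    rewrite /lam !ord3D -/P -/Q -/A orient_line; last by rewrite eq_sym -subr_eq0.
    by rewrite /k mulrAC.
  apply/idP/idP; rewrite !inE open_triangleE//=.
    move=> h; have := h (i + 1); have := h (i + 2%:R).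
    by rewrite l1 l2 (pmulr_rgt0 _ r0).
  move=> [h1 h2] j.
  have {h1}h1 : 0 < lam V (i + 1) (x, y) by rewrite l1 pmulr_rgt0.
  have {h2}h2 : 0 < lam V (i + 2%:R) (x, y) by rewrite l2.
  (* The third coordinate is positive for free: by the first component of the barycentric identity,
     it balances the other two on the opposite side of the line. *)
  have h0 : 0 < lam V i (x, y).
    have := congr1 fst (barycenter_lam V0 (x, y)); have := sum_lam V0 (x, y).
    rewrite /barycenter/= !(sum3_rot _ i) -/P -/Q -/S => s1 xE.
    have : lam V i (x, y) * (x - P.1) = lam V (i + 1) (x, y) * (Q.1 - x) + lam V (i + 2%:R) (x, y) * (S.1 - x).
      have : (lam V i (x, y) + lam V (i + 1) (x, y) + lam V (i + 2%:R) (x, y)) * x =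
        lam V i (x, y) * P.1 + lam V (i + 1) (x, y) * Q.1 + lam V (i + 2%:R) (x, y) * S.1.
        by rewrite s1 mul1r.
      by rewrite mulrBr !mulrBr !mulrDl => e; lra.
    case: H => -[j1 [j2 j3]] e.
      by rewrite -(@pmulr_lgt0 _ (x - P.1)) ?subr_gt0// e addr_gt0// mulr_gt0// subr_gt0.
    by rewrite -(@nmulr_llt0 _ (x - P.1)) ?subr_lt0// e ltr_wnDl// ?ltW// pmulr_rlt0// subr_lt0.
  have [->//|->//|->//] : [\/ j = i, j = i + 1 | j = i + 2%:R].
  by case: (ord3P i) (ord3P j) => -> [] ->; rewrite !ord3E; [apply: Or31|apply: Or32|apply: Or33|
    apply: Or33|apply: Or31|apply: Or32|apply: Or32|apply: Or33|apply: Or31].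
rewrite (sum3_rot _ i) !ord3D -/P -/Q -/S !crossingE//.
rewrite /k sgrM sgrV.
case: H => -[h1 [h2 h3]].
  rewrite gtr0_sg ?subr_gt0 ?(lt_trans h1 h2)// h1 h2 h3 (lt_gtF h2) (lt_gtF h3) (lt_gtF h1)/=.
  by ring.
rewrite ltr0_sg ?subr_lt0 ?(lt_trans h2 h1)// h1 h2 h3 (lt_gtF h2) (lt_gtF h3) (lt_gtF h1)/=.
by ring.
Qed.

Lemma slice_dy_out x : (forall i, (V i).1 < x) \/ (forall i, x < (V i).1) ->
  slice_dy x = - (Num.sg A * \sum_j crossing (V j) (V (j + 1)) x).
Proof.
move=> H; rewrite big1 ?mulr0 ?oppr0 => [|j _].
  rewrite /slice_dy -[RHS](_ : \int[mu]_(_ in [set: R]) (0 : R) = 0); last by rewrite /Rintegral integral0.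
  apply: eq_Rintegral => y _; rewrite indicE memNset ?mul0r// => -[l [l0 l1 [xE _]]].
  have : \sum_i l i * ((V i).1 - x) = 0.
    by under eq_bigr do rewrite mulrBr; rewrite sumrB -mulr_suml l1 mul1r -xE subrr.
  case: H => H /eqP; apply/negP; rewrite sum3.
    by rewrite lt_eqF// !ltr_wnDr ?ltW// nmulr_llt0 ?subr_lt0.
  by rewrite gt_eqF// !addr_gt0 ?mulr_gt0 ?subr_gt0.
have xN i : x != (V i).1 by case: H => /(_ i); rewrite neq_lt => ->; rewrite ?orbT.
rewrite crossingE//.
by case: H => H; rewrite !(lt_gtF (H _)) ?andbF.
Qed.

Lemma slice_dyE x : (forall i, x != (V i).1) ->
  slice_dy x = - (Num.sg A * \sum_j crossing (V j) (V (j + 1)) x).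
Proof.
move=> xV.
(* Of the eight sign patterns, two put all vertices on one side of the line and six isolate one
   vertex. *)
have /orP x0 := lt_total (xV 0); have /orP x1 := lt_total (xV 1); have /orP x2 := lt_total (xV 2%:R).
case: x0 x1 x2 => x0 [] x1 [] x2.
- by apply: slice_dy_out; right => i; case: (ord3P i) => ->.
- by apply: (@slice_dy_alone x 2%:R); rewrite !ord3E; left.
- by apply: (@slice_dy_alone x 1); rewrite !ord3E; left.
- by apply: (@slice_dy_alone x 0); rewrite !ord3E; right.
- by apply: (@slice_dy_alone x 0); rewrite !ord3E; left.
- by apply: (@slice_dy_alone x 1); rewrite !ord3E; right.
- by apply: (@slice_dy_alone x 2%:R); rewrite !ord3E; right.
- by apply: slice_dy_out; left => i; case: (ord3P i) => ->.
Qed.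

Definition segment_int (P Q : R * R) :=
  \int[mu]_(s in `[0, 1]) ev p (P.1 + s * (Q.1 - P.1), P.2 + s * (Q.2 - P.2)).

Let seg (P Q : R * R) (s : R) :=
  \1_(`]0, 1[%classic : set R) s * ev p (P.1 + s * (Q.1 - P.1), P.2 + s * (Q.2 - P.2)).

Lemma measurable_segment P Q :
  measurable_fun setT (fun s : R => ev p (P.1 + s * (Q.1 - P.1), P.2 + s * (Q.2 - P.2))).
Proof.
apply: measurableT_comp (measurable_ev p) _; apply/measurable_fun_pairP.
by split; apply: measurable_funD => //; apply: measurable_funM.
Qed.

Lemma integrable_segment P Q : mu.-integrable setT (EFin \o seg P Q).
Proof.
have mc := measurable_segment P Q.
have [M M0 h] := ev_bounded p (`|P.1| + `|Q.1 - P.1| + (`|P.2| + `|Q.2 - P.2|)).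
have seg0 s : ~~ (0 <= s <= 1) -> seg P Q s = 0.
  move=> s01; rewrite /seg indicE memNset ?mul0r// => /=; rewrite in_itv/= => /andP[/ltW s0 /ltW s1].
  by move: s01; rewrite s0 s1.
apply: (@integrable_bnd_supp _ 0 1 (seg P Q) M); [| |exact: seg0].
  by apply: measurable_funM => //; apply: measurable_indic.
move=> s; have [s01|/seg0 ->] := boolP (0 <= s <= 1); last by rewrite normr0.
have {}s01 : `|s| <= 1 by case/andP: s01 => s0 s1; rewrite ger0_norm.
rewrite /seg normrM indicE; apply: le_trans (_ : 1 * M <= _); last by rewrite mul1r.
apply: ler_pM => //; first by case: (_ \in _); rewrite ?normr1 ?normr0.
by apply: h; rewrite /=; apply: le_trans (ler_normD _ _) _; rewrite normrM;
  [rewrite ler_wpDr ?addr_ge0//|rewrite ler_wpDl ?addr_ge0//]; rewrite lerD2l ler_piMl.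
Qed.

Lemma Rintegral_segment P Q : \int[mu]_s seg P Q s = segment_int P Q.
Proof.
transitivity (\int[mu]_(s in `]0, 1[) ev p (P.1 + s * (Q.1 - P.1), P.2 + s * (Q.2 - P.2))).
  rewrite [RHS]Rintegral_mkcond; apply: eq_Rintegral => s _.
  by rewrite patchE /seg indicE; case: ifPn => _; rewrite ?mul1r ?mul0r.
have mc D : measurable_fun D (EFin \o (fun s : R => ev p (P.1 + s * (Q.1 - P.1), P.2 + s * (Q.2 - P.2)))).
  by apply: measurable_funTS; apply/measurable_EFinP; exact: measurable_segment.
rewrite /segment_int /Rintegral; congr fine.
by rewrite integral_itv_obnd_cbnd ?integral_itv_bndo_bndc//; exact: mc.
Qed.

(** Substitute s = (x - P.1) / (Q.1 - P.1); the sign built into [crossing] restores the sign lost in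
    the Jacobian. A vertical edge gives 0 on both sides. *)
Lemma integral_crossing P Q : mu.-integrable setT (EFin \o crossing P Q) /\
  \int[mu]_x crossing P Q x = (Q.1 - P.1) * segment_int P Q.
Proof.
have iS := integrable_segment P Q; rewrite -Rintegral_segment.
case: (ltgtP (Q.1 - P.1) 0) => q0.
- have q0' : 0 < - (Q.1 - P.1) by rewrite oppr_gt0.
  have iSN := integrable_opp iS.
  have cE x : crossing P Q x = -1 * seg P Q (- ((- (Q.1 - P.1))^-1 * x + P.1 / (Q.1 - P.1))).
    have -> : - ((- (Q.1 - P.1))^-1 * x + P.1 / (Q.1 - P.1)) = (x - P.1) / (Q.1 - P.1).
      by rewrite invrN; ring.
    by rewrite /crossing /seg divfK ?lt_eqF// ltr0_sg// [P.1 + _]addrC subrK.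
  have iA := integrable_affine (P.1 / (Q.1 - P.1)) (_ : 0 < (- (Q.1 - P.1))^-1) iSN.
  rewrite invr_gt0 in iA; have {}iA := iA q0'.
  have iN := integrableZl measurableT (-1) iA.
  split; first by move: iN; apply: eq_integrable => // x _; rewrite /= cE.
  under eq_Rintegral do rewrite cE.
  rewrite RintegralZl// (Rintegral_opp iS).
  have := Rintegral_affine (P.1 / (Q.1 - P.1)) (_ : 0 < (- (Q.1 - P.1))^-1) iSN.
  rewrite invr_gt0 => /(_ q0') ->.
  by rewrite mulrA invrN mulrN mulfV ?lt_eqF.
- have cE x : crossing P Q x = seg P Q ((Q.1 - P.1)^-1 * x + - P.1 / (Q.1 - P.1)).
    have -> : (Q.1 - P.1)^-1 * x + - P.1 / (Q.1 - P.1) = (x - P.1) / (Q.1 - P.1) by ring.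
    by rewrite /crossing /seg divfK ?gt_eqF// gtr0_sg// mul1r [P.1 + _]addrC subrK.
  have iA := integrable_affine (- P.1 / (Q.1 - P.1)) (_ : 0 < (Q.1 - P.1)^-1) iS.
  rewrite invr_gt0 in iA; have {}iA := iA q0.
  split; first by move: iA; apply: eq_integrable => // x _; rewrite /= cE.
  under eq_Rintegral do rewrite cE.
  have := Rintegral_affine (- P.1 / (Q.1 - P.1)) (_ : 0 < (Q.1 - P.1)^-1) iS.
  rewrite invr_gt0 => /(_ q0) ->.
  by rewrite mulrA mulfV ?gt_eqF// mul1r.
- have cE x : crossing P Q x = 0 by rewrite /crossing q0 sgr0 mul0r.
  split; first by have := @integrable0 _ _ _ mu setT; apply: eq_integrable => // x _; rewrite /= cE.
  by under eq_Rintegral do rewrite cE; rewrite q0 mul0r /Rintegral integral0.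
Qed.

Definition bound_rect := \sum_i (`|(V i).1| + `|(V i).2|).

Lemma triangle_in_rect z : open_triangle V z ->
  in_rect (- bound_rect) bound_rect (- bound_rect) bound_rect z.
Proof.
move=> [l [l0 l1 ->]]; rewrite /in_rect /barycenter/=.
have l1' i : l i <= 1.
  by rewrite -l1 (bigD1 i)//= lerDl sumr_ge0// => j _; rewrite ltW.
rewrite -!ler_norml; apply/andP; split; apply: le_trans (ler_norm_sum _ _ _) _; apply: ler_sum => i _;
  rewrite normrM (gtr0_norm (l0 i)).
  by apply: le_trans (ler_piMl _ (l1' i)) _ => //; rewrite lerDl.
by apply: le_trans (ler_piMl _ (l1' i)) _ => //; rewrite lerDr.
Qed.

Lemma rect_fun_single (r : {poly {poly R}}) : rect_fun (- bound_rect) bound_rect (- bound_rect) bound_rect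
  (fun z => \1_(open_triangle V) z * ev r z).
Proof.
split.
- apply: measurable_funM; last exact: measurable_ev.
  by apply: measurable_indic; exact: measurable_open_triangle.
- have [M M0 h] := ev_bounded r bound_rect; exists M => z.
  rewrite indicE; have [zk|_] := boolP (z \in _); last by rewrite mul0r normr0.
  rewrite mul1r; rewrite inE in zk; move: (triangle_in_rect zk) => /andP[h1 h2].
  by apply: h; rewrite ler_norml.
- move=> z zr; rewrite indicE memNset ?mul0r// => /triangle_in_rect.
  exact/negP.
Qed.

Lemma Rintegral_triangle (r : {poly {poly R}}) :
  \int[plane]_(z in open_triangle V) ev r z = \int[plane]_z (\1_(open_triangle V) z * ev r z).
Proof.
rewrite Rintegral_mkcond; apply: eq_Rintegral => z _; rewrite patchE indicE.
by case: ifPn => _; rewrite ?mul1r ?mul0r.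
Qed.

Lemma triangle_dy : \int[plane]_(z in open_triangle V) ev (dy p) z =
  - (Num.sg A * \sum_j ((V (j + 1)).1 - (V j).1) * segment_int (V j) (V (j + 1))).
Proof.
rewrite Rintegral_triangle (Rfubini1 (integrable_rect_fun (rect_fun_single (dy p)))).
have ic j : mu.-integrable setT (EFin \o crossing (V j) (V (j + 1))) by case: (integral_crossing (V j) (V (j + 1))).
transitivity (\int[mu]_x (- Num.sg A * \sum_j crossing (V j) (V (j + 1)) x)).
  rewrite /Rintegral; congr fine.
  (* The slice formula fails at most on the vertical lines through the vertices, a null set of
     abscissae. *)
  have cN : countable (range (fun i => (V i).1)) by exact/finite_set_countable/finite_image.
  apply: (@ae_integral_nonmeasurable _ _ R mu setT (range (fun i => (V i).1))) => //.
  - exact: countable_measurable.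
  - exact: countable_lebesgue_measure0.
  - apply/measurable_EFinP; apply: measurable_funM => //; apply: measurable_sum => j.
    by apply/measurable_EFinP; exact: (measurable_int mu).
  - move=> x _ xN; congr EFin; rewrite mulNr; apply: slice_dyE => i.
    by apply/eqP => xE; apply: xN; exists i.
rewrite RintegralZl//; last exact: integrable_sumR.
rewrite Rintegral_sum// mulNr; congr (- (_ * _)); apply: eq_bigr => j _.
by case: (integral_crossing (V j) (V (j + 1))).
Qed.

End triangle_slices.

Section divergence_theorem.
Context {R : realType}.
Notation mu := (@lebesgue_measure R).
Notation plane := (mu \x mu)%E.
Implicit Types (V : triangle R) (p : {poly {poly R}}).

Lemma edge_intE V i p : edge_int V i (ev p) =
  edge_length V i * segment_int p (V (i + 1)) (V (i + 2%:R)).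
Proof. by []. Qed.

Lemma edge_length_gt0 V i : area2 V != 0 -> 0 < edge_length V i.
Proof.
move=> V0; rewrite /edge_length sqrtr_gt0.
have h : area2 V = (edge_vec V i).1 * (V i - V (i + 1)).2 - (V i - V (i + 1)).1 * (edge_vec V i).2.
  by rewrite -(area2_rot V i) /orient /edge_vec/=; ring.
rewrite lt_neqAle addr_ge0 ?sqr_ge0// andbT eq_sym.
apply: contra V0; rewrite paddr_eq0 ?sqr_ge0// !sqrf_eq0 h => /andP[/eqP -> /eqP ->].
by rewrite mul0r mulr0 subrr.
Qed.

Lemma normalE V i : area2 V != 0 -> normal V i =
  (Num.sg (area2 V) / edge_length V i * (edge_vec V i).2,
   - (Num.sg (area2 V) / edge_length V i * (edge_vec V i).1)).
Proof.
move=> V0; rewrite /normal.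
rewrite (_ : _ * _ - _ = - area2 V) ?sgrN ?opprK//.
by rewrite -(area2_rot V i) /orient /edge_vec/=; ring.
Qed.

Lemma Rintegral_triangle_dy V p : area2 V != 0 ->
  \int[plane]_(z in open_triangle V) ev (dy p) z = \sum_i (normal V i).2 * edge_int V i (ev p).
Proof.
(* One sum numbers an edge by its initial vertex, the other by the opposite vertex; starting them at
   1 and 0 aligns the terms. *)
move=> V0; rewrite triangle_dy// (sum3_rot (fun j => _ * _) 1) [RHS](sum3_rot _ 0) !ord3E.
rewrite !normalE// !edge_intE/= !ord3E.
have L i : edge_length V i != 0 by rewrite gt_eqF// edge_length_gt0.
by field; rewrite !L.
Qed.

Definition swap_triangle V : triangle R := fun i => swap_pair (V i).

Lemma area2_swap V : area2 (swap_triangle V) = - area2 V.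
Proof. by rewrite /area2/=; ring. Qed.

Lemma open_swap_triangle V z : open_triangle (swap_triangle V) z <-> open_triangle V (swap_pair z).
Proof.
split=> -[l [l0 l1 zE]]; exists l; split => //; first by rewrite zE.
by case: z zE => x y [-> ->].
Qed.

Lemma edge_length_swap V i : edge_length (swap_triangle V) i = edge_length V i.
Proof. by rewrite /edge_length /edge_vec/= addrC. Qed.

Lemma edge_int_swap V i p : edge_int (swap_triangle V) i (ev (swapXY p)) = edge_int V i (ev p).
Proof.
rewrite /edge_int edge_length_swap; congr (_ * _); apply: eq_Rintegral => s _.
by rewrite ev_swapXY.
Qed.

Lemma normal_swap V i : area2 V != 0 -> (normal (swap_triangle V) i).2 = (normal V i).1.
Proof.
move=> V0; rewrite !normalE ?area2_swap ?oppr_eq0//= edge_length_swap sgrN.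
by rewrite mulNr mulNr opprK.
Qed.

(** Reflection in the diagonal reduces this to the y derivative. It reverses orientation, but the
    outward normal does not depend on orientation, so its components are merely exchanged. *)
Lemma Rintegral_triangle_dx V p : area2 V != 0 ->
  \int[plane]_(z in open_triangle V) ev (dx p) z = \sum_i (normal V i).1 * edge_int V i (ev p).
Proof.
move=> V0; have V0' : area2 (swap_triangle V) != 0 by rewrite area2_swap oppr_eq0.
transitivity (\sum_i (normal (swap_triangle V) i).2 * edge_int (swap_triangle V) i (ev (swapXY p))).
  rewrite -Rintegral_triangle_dy// !Rintegral_triangle -swapXY_dx.
  rewrite -(Rintegral_swap (rect_fun_single V0 (dx p))).
  apply: eq_Rintegral => z _; rewrite ev_swapXY !indicE; congr (_%:R * _); congr nat_of_bool.
  by apply/idP/idP; rewrite !inE => /open_swap_triangle.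
by apply: eq_bigr => i _; rewrite normal_swap// edge_int_swap.
Qed.

End divergence_theorem.

(** * Edges of a conforming mesh *)

Section small_parameters.
Context {R : realType}.

(** Below the least of the thresholds all conditions hold together. Neighbourhoods of edge midpoints
    are explored with this and affine inequalities, without topology of the plane. *)
Lemma finite_small (I : finType) (P : I -> R -> Prop) :
  (forall i, exists2 s, 0 < s & forall t, 0 < t <= s -> P i t) ->
  exists2 s, 0 < s & forall t, 0 < t <= s -> forall i, P i t.
Proof.
move=> h; have /choice[f fP] : forall i, exists s, 0 < s /\ forall t, 0 < t <= s -> P i t.
  by move=> i; have [s s0 hs] := h i; exists s.
exists (\big[Order.min/1]_i f i).
  by apply: lt_bigmin => // i _; case: (fP i).
move=> t /andP[t0 ts] i; have [_] := fP i; apply; rewrite t0 (le_trans ts)//.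
exact: bigmin_le.
Qed.

Lemma affine_gt0_small (A B : R) : 0 < A ->
  exists2 s, 0 < s & forall t, 0 < t <= s -> 0 < A + t * B.
Proof.
move=> A0; have B1 : 0 < 1 + `|B| by rewrite ltr_pwDl.
exists (A / (1 + `|B|)); first by rewrite divr_gt0.
move=> t /andP[t0]; rewrite ler_pdivlMr// => h.
have : - (t * B) <= t * `|B| by rewrite -mulrN ler_wpM2l ?(ltW t0)// -normrN ler_norm.
rewrite mulrDr mulr1 in h; lra.
Qed.

Lemma affine_ge0_lim (A B : R) :
  (forall s, 0 < s -> exists2 t, 0 < t <= s & 0 <= A + t * B) -> 0 <= A.
Proof.
move=> h; rewrite leNgt; apply/negP; rewrite -oppr_gt0 => /affine_gt0_small -/(_ (- B))[s s0 hs].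
have [t ts] := h s s0; have := hs t ts; rewrite mulrN; lra.
Qed.

End small_parameters.

Section segments.
Context {R : realType}.
Implicit Types (P Q S z : R * R) (V : triangle R) (t : R).

Definition lin z z' t : R * R := (z.1 + t * (z'.1 - z.1), z.2 + t * (z'.2 - z.2)).

Lemma lin_sym z z' t : lin z' z t = lin z z' (1 - t).
Proof. by rewrite /lin; congr pair; ring. Qed.

Lemma lam_lin V j z z' t : lam V j (lin z z' t) = (1 - t) * lam V j z + t * lam V j z'.
Proof. by rewrite /lam /orient /lin/=; ring. Qed.

Definition mid V i := lin (V (i + 1)) (V (i + 2%:R)) 2^-1.

Section one_triangle.
Variable V : triangle R.
Hypothesis V0 : area2 V != 0.

Lemma lam_vertex i j : lam V j (V i) = (j == i)%:R.
Proof.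
have -> : V i = barycenter V (fun j => (j == i)%:R).
  rewrite /barycenter [LHS]surjective_pairing; congr pair;
    by rewrite (bigD1 i)//= eqxx mul1r big1 ?addr0// => k /negbTE ->; rewrite mul0r.
by rewrite lam_barycenter// (bigD1 i)//= eqxx big1 ?addr0// => k /negbTE ->.
Qed.

Lemma ord3_neq (i : 'I_3) : (i == i + 1 = false) * (i == i + 2%:R = false) *
  (i + 1 == i + 2%:R = false) * (i + 2%:R == i + 1 = false) * (i + 1 == i = false) * (i + 2%:R == i = false).
Proof. by do ![split]; case: (ord3P i) => ->. Qed.

Lemma ord3_rotP (i j : 'I_3) : [\/ j = i, j = i + 1 | j = i + 2%:R].
Proof.
by case: (ord3P i) (ord3P j) => -> [] ->; rewrite !ord3E; [apply: Or31|apply: Or32|apply: Or33|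
    apply: Or33|apply: Or31|apply: Or32|apply: Or32|apply: Or33|apply: Or31].
Qed.

Lemma lam_mid i j : lam V j (mid V i) = if j == i then 0 else 2^-1.
Proof.
rewrite /mid lam_lin !lam_vertex; case: (ord3_rotP i j) => ->; rewrite ?eqxx !ord3_neq/=; lra.
Qed.

Lemma edgeE i : edge V i = [set z | exists2 t, 0 <= t <= 1 & z = lin (V (i + 1)) (V (i + 2%:R)) t].
Proof.
apply/seteqP; split => z /=.
  move=> [l [l0]]; rewrite (sum3_rot _ i) => l1 li ->; exists (l (i + 2%:R)).
    by rewrite l0/= -l1 lerDr addr_ge0.
  have {}li : l i = 0 by apply: li => /=; rewrite eqxx.
  rewrite li add0r in l1.
  have {}l1 : l (i + 1) = 1 - l (i + 2%:R) by rewrite -l1 addrK.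
  by rewrite /barycenter /lin !(sum3_rot _ i) li l1; congr pair; ring.
move=> [t /andP[t0 t1] ->]; rewrite /edge hullE//; split => j.
  rewrite lam_lin !lam_vertex addr_ge0// mulr_ge0 ?subr_ge0//.
move=> /= /negP; rewrite negbK => /eqP ->.
by rewrite lam_lin !lam_vertex !ord3_neq !mulr0 addr0.
Qed.

Lemma vertex_edge i j : edge V i (V j) <-> j != i.
Proof.
rewrite /edge hullE//=; split => [[_ /(_ i)]|ji].
  rewrite lam_vertex; apply: contraPneq => ->; rewrite eqxx => /(_ (fun h => negP h isT)) /eqP.
  by rewrite oner_eq0.
split=> k; first by rewrite lam_vertex.
move=> /negP; rewrite negbK => /eqP ->; rewrite lam_vertex eq_sym (negbTE ji).
by [].
Qed.

Lemma mid_edge i : edge V i (mid V i).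
Proof. by rewrite edgeE; exists 2^-1 => //; lra. Qed.

Lemma edge_closed i : edge V i `<=` closed_triangle V.
Proof. by move=> z [l [l0 l1 _ zE]]; exists l; split => // j []. Qed.

End one_triangle.

(** A common edge recorded by its endpoints, in either order. Unlike equality of point sets, this
    form gives direct access to lengths, normals and sides. *)
Definition shared V i V' j :=
  V (i + 1) = V' (j + 1) /\ V (i + 2%:R) = V' (j + 2%:R) \/
  V (i + 1) = V' (j + 2%:R) /\ V (i + 2%:R) = V' (j + 1).

Lemma shared_mid V i V' j : shared V i V' j -> mid V i = mid V' j.
Proof. by rewrite /mid => -[] [-> ->] //; rewrite lin_sym; congr lin; lra. Qed.

Lemma shared_edge V i V' j : area2 V != 0 -> area2 V' != 0 -> shared V i V' j -> edge V i = edge V' j.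
Proof.
move=> V0 V0' [] [h1 h2]; rewrite !edgeE// h1 h2// .
have t01 t : 0 <= t <= 1 -> 0 <= 1 - t <= 1.
  by move=> /andP[t0 t1]; rewrite subr_ge0 t1 gerBl.
apply/seteqP; split => z [t /t01 ht ->]; exists (1 - t) => //; first exact: lin_sym.
exact: lin_sym.
Qed.

(** An affine function that vanishes on the line of edge [i]; its sign tells on which side [z]
    lies. *)
Definition side V i z := orient (V (i + 1)) (V (i + 2%:R)) z.

Lemma side_vertex V i : side V i (V i) = area2 V.
Proof. by rewrite /side -(area2_rot V i) -[LHS]orient_rot -[LHS]orient_rot. Qed.

Lemma lam_side V i z : lam V i z = side V i z / side V i (V i).
Proof. by rewrite side_vertex /lam /side; congr (_ / _); exact/esym/orient_rot. Qed.

Lemma shared_side V i V' j : shared V i V' j ->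
  (forall z, side V' j z = side V i z) \/ (forall z, side V' j z = - side V i z).
Proof.
by move=> [] [h1 h2]; [left|right] => z; rewrite /side h1 h2// orientC.
Qed.

(** A small step from the common midpoint towards [V i] enters both open triangles, as the only
    coordinates that vanish at the midpoint become positive. *)
Lemma shared_same_side V i V' j : area2 V != 0 -> area2 V' != 0 -> shared V i V' j ->
  0 < side V i (V i) * side V i (V' j) -> exists z, open_triangle V z /\ open_triangle V' z.
Proof.
move=> V0 V0' sh ss; pose y := lin (mid V i) (V i).
have l'0 : 0 < lam V' j (V i).
  have d0 x w : 0 < x * w -> 0 < x / w :> R.
    move=> xw; have w0 : w != 0 by apply: contraTneq xw => ->; rewrite mulr0 ltxx.
    have -> : x / w = x * w * (w^-1) ^+ 2 by field.
    by rewrite mulr_gt0// exprn_even_gt0//= invr_eq0.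
  by rewrite lam_side; case: (shared_side sh) => sE; rewrite !sE ?invrN ?mulrNN; exact: d0.
have [s s0 hs] : exists2 s, 0 < s & forall t, 0 < t <= s -> forall (h : bool * 'I_3),
    0 < if h.1 then lam V h.2 (y t) else lam V' h.2 (y t).
  apply: finite_small => -[[] h] /=.
    have [->|hi] := eqVneq h i.
      exists 1 => // t /andP[t0 t1]; rewrite lam_lin lam_mid// eqxx mulr0 add0r lam_vertex// eqxx mulr1.
      by [].
    have h2 : (0 : R) < 2^-1 by lra.
    have [s s0 hs] := affine_gt0_small (lam V h (V i) - 2^-1) h2; exists s => // t /hs.
    by rewrite lam_lin lam_mid// (negbTE hi); congr (0 < _); ring.
  have [->|hi] := eqVneq h j.
    exists 1 => // t /andP[t0 t1]; rewrite lam_lin (shared_mid sh) lam_mid// eqxx mulr0 add0r.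
    exact: mulr_gt0.
  have h2 : (0 : R) < 2^-1 by lra.
  have [s s0 hs] := affine_gt0_small (lam V' h (V i) - 2^-1) h2; exists s => // t /hs.
  by rewrite lam_lin (shared_mid sh) lam_mid// (negbTE hi); congr (0 < _); ring.
have ss' : 0 < s <= s by rewrite s0 lexx.
exists (y s); rewrite !open_triangleE//; split => h.
  exact: (hs s ss' (true, h)).
exact: (hs s ss' (false, h)).
Qed.

End segments.

(** * The four sides of the rectangle *)

Section rectangle_sides.
Context {R : realType}.
Variables (a b c d : R).

(* [in_rect] is the conjunction of four affine inequalities [0 <= rect_side s z]. *)
Definition rect_side (s : bool * bool) (z : R * R) : R :=
  match s with
  | (false, false) => z.1 - a | (false, true) => b - z.1
  | (true, false) => z.2 - c | (true, true) => d - z.2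
  end.

Lemma rect_side_lin s z z' t : rect_side s (lin z z' t) = (1 - t) * rect_side s z + t * rect_side s z'.
Proof. by case: s => -[] []; rewrite /rect_side /lin/=; ring. Qed.

Lemma in_rectP z : in_rect a b c d z <-> forall s, 0 <= rect_side s z.
Proof.
rewrite /in_rect; split=> [/andP[/andP[h1 h2] /andP[h3 h4]] [[] []]|h]; rewrite /rect_side ?subr_ge0//.
have := h (false, false); have := h (false, true); have := h (true, false); have := h (true, true).
by rewrite /rect_side !subr_ge0 => -> -> -> ->.
Qed.

Lemma in_rect_side z s : in_rect a b c d z -> 0 <= rect_side s z.
Proof. by move/in_rectP. Qed.

Lemma rect_boundaryP z : rect_boundary a b c d z <->
  (forall s, 0 <= rect_side s z) /\ exists s, rect_side s z = 0.
Proof.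
rewrite -in_rectP /rect_boundary /closed_rect; split => /= [[[h1 h2] h]|[zr [s s0]]].
  rewrite /= !in_itv/= in h1 h2 h; split; first by rewrite /in_rect h1.
  apply: contrapT => /forallNP hs; apply: h.
  have zr : in_rect a b c d z by rewrite /in_rect h1.
  have {}hs s : 0 < rect_side s z.
    by rewrite lt_neqAle eq_sym; apply/andP; split; [exact/eqP/hs|exact: in_rect_side].
  have := hs (false, false); have := hs (false, true); have := hs (true, false); have := hs (true, true).
  by rewrite /rect_side !subr_gt0 => -> -> -> ->.
rewrite !in_itv/=; split; first by move: zr => /andP[].
move: s0; case: s => -[] []; rewrite /rect_side => /eqP; rewrite subr_eq0 => /eqP ->;
  by rewrite ltxx ?andbF => -[].
Qed.

Lemma rect_side_lam V s z : area2 V != 0 ->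
  rect_side s z = \sum_i lam V i z * rect_side s (V i).
Proof.
move=> V0; have s1 := sum_lam V0 z; rewrite -[z in LHS](barycenter_lam V0).
by case: s => -[] []; rewrite /rect_side /barycenter/=; under [RHS]eq_bigr do rewrite mulrBr;
  rewrite sumrB -mulr_suml s1 mul1r.
Qed.

(** Otherwise the three vertices would be collinear. *)
Lemma rect_side_vertices V s : area2 V != 0 -> exists i, rect_side s (V i) != 0.
Proof.
move=> V0; apply: contrapT => /forallNP h; move: V0; rewrite (_ : area2 V = 0) ?eqxx//.
have e i : rect_side s (V i) = 0 by apply: contrapT => /eqP; exact: h.
have := e 0; have := e 1; have := e 2%:R; rewrite /area2.
by case: s {h e} => -[] []; rewrite /rect_side => /eqP h2 /eqP h1 /eqP h0;
  move: h2 h1 h0; rewrite !subr_eq0 => /eqP h2 /eqP h1 /eqP h0;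
  rewrite -?h2 -?h1 -?h0 ?h2 ?h1 ?h0; ring.
Qed.

End rectangle_sides.

Section mesh_edges.
Context {R : realType}.
Variables (a b c d : R) (K : nat) (D : 'I_K -> triangle R).
Hypothesis hD : triangulation a b c d D.

Let D0 k : area2 (D k) != 0. Proof. by case: hD. Qed.

(** The ray from [V i] through the midpoint of the opposite edge, prolonged beyond it: a probe of
    what lies across the edge. *)
Definition outer V i t : R * R := lin (V i) (mid V i) (1 + t).

Lemma closed_in_rect k z : closed_triangle (D k) z -> in_rect a b c d z.
Proof.
have [_ hU _ _] := hD => zk.
have : closed_rect a b c d z by rewrite -hU; exists k.
by case => /=; rewrite !in_itv/= /in_rect => -> ->.
Qed.

Lemma vertex_in_rect k i : in_rect a b c d (D k i).
Proof.
apply: (@closed_in_rect k); rewrite closed_triangleE// => j /=.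
by rewrite lam_vertex.
Qed.

Lemma mid_in_rect k i : in_rect a b c d (mid (D k) i).
Proof. by apply: (@closed_in_rect k); apply: (@edge_closed _ _ i); exact: mid_edge. Qed.

(** By conformity the midpoint is in the hull of the common vertices. Its coordinates at both ends
    of the edge are nonzero, so both ends are common vertices. *)
Lemma mid_shared k l i : k != l -> closed_triangle (D l) (mid (D k) i) ->
  exists j, shared (D k) i (D l) j.
Proof.
move=> kl ml; have [_ _ _ /(_ _ _ kl) hI] := hD.
have : (closed_triangle (D k) `&` closed_triangle (D l)) (mid (D k) i).
  by split => //; apply: (@edge_closed _ _ i); exact: mid_edge.
rewrite hI hullE//= => -[_ h].
have sv j : j != i -> exists j', D k j = D l j'.
  move=> ji; apply: contrapT => /h; rewrite lam_mid// (negbTE ji) => /eqP.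
  by rewrite invr_eq0 pnatr_eq0.
have [|j1 e1] := sv (i + 1); first by rewrite ord3_neq.
have [|j2 e2] := sv (i + 2%:R); first by rewrite ord3_neq.
have j12 : j1 != j2.
  apply/eqP => j12; have := lam_vertex (D0 k) (i + 1) (i + 1); rewrite eqxx e1 j12 -e2.
  by rewrite lam_vertex// ord3_neq => /eqP; rewrite eq_sym oner_eq0.
case: (ord3_rotP j1 j2) j12 e1 e2 => -> ; first by rewrite eqxx.
  by move=> _ e1 e2; exists (j1 + 2%:R); left; rewrite !ord3D.
move=> _ e1 e2; exists (j1 + 1); right; rewrite !ord3D.
by [].
Qed.

Lemma edge_shared k l i j : k != l -> edge (D k) i = edge (D l) j -> shared (D k) i (D l) j.
Proof.
move=> kl e; have [|j' sh] := @mid_shared k l i kl.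
  by apply: (@edge_closed _ _ j); rewrite -e; exact: mid_edge.
rewrite (_ : j = j')//; apply/eqP; apply: contraT => jj'.
have : edge (D l) j' (D l j) by rewrite vertex_edge.
by rewrite -(shared_edge (D0 k) (D0 l) sh) e vertex_edge// eqxx.
Qed.

(** On the same side the open triangles would overlap, and on the line itself the neighbour would be
    degenerate. *)
Lemma opposite_sides k l i j : k != l -> shared (D k) i (D l) j ->
  side (D k) i (D k i) * side (D k) i (D l j) < 0.
Proof.
move=> kl sh; rewrite ltNge; apply/negP; rewrite le_eqVlt => /orP[|].
  rewrite eq_sym mulf_eq0 side_vertex (negbTE (D0 k))/=.
  have := D0 l; rewrite -(side_vertex _ j).
  by case: (shared_side sh) => ->; rewrite ?oppr_eq0 => /negbTE ->.
move=> /(shared_same_side (D0 k) (D0 l) sh)[z [zk zl]].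
have [_ _ /(_ _ _ kl) h _] := hD.
by have : set0 z by rewrite -h.
Qed.

Lemma vertex_side k j s : 0 <= rect_side a b c d s (D k j).
Proof. exact/in_rect_side/vertex_in_rect. Qed.

Lemma mid_side0 k i s : rect_side a b c d s (mid (D k) i) = 0 ->
  [/\ rect_side a b c d s (D k (i + 1)) = 0, rect_side a b c d s (D k (i + 2%:R)) = 0 &
    0 < rect_side a b c d s (D k i)].
Proof.
have -> : rect_side a b c d s (mid (D k) i) =
    2^-1 * (rect_side a b c d s (D k (i + 1)) + rect_side a b c d s (D k (i + 2%:R))).
  by rewrite /mid rect_side_lin; field.
move/eqP; rewrite mulf_eq0 invr_eq0 pnatr_eq0/= paddr_eq0 ?vertex_side// => /andP[/eqP e1 /eqP e2].
split => //; rewrite lt_neqAle vertex_side andbT eq_sym.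
have [j] := rect_side_vertices a b c d s (D0 k).
by case: (ord3_rotP i j) => ->; rewrite ?e1 ?e2 ?eqxx.
Qed.

(** If no side function vanishes at the midpoint, a short step across the edge stays in the
    rectangle. If one does, it vanishes at both ends, hence on the whole edge, and becomes negative
    beyond it. *)
Lemma boundary_outer k i : edge (D k) i `<=` rect_boundary a b c d <->
  forall t, 0 < t -> ~~ in_rect a b c d (outer (D k) i t).
Proof.
split=> [h t t0|h].
  have /rect_boundaryP[_ [s ms]] := h _ (mid_edge (D0 k) i).
  have [e1 e2 vi] := mid_side0 ms.
  apply/negP => /in_rectP /(_ s); rewrite rect_side_lin ms mulr0 addr0.
  by rewrite leNgt pmulr_llt0// opprD addNKr oppr_lt0 t0.
have [s ms] : exists s, rect_side a b c d s (mid (D k) i) = 0.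
  apply: contrapT => /forallNP ms.
  have {}ms s : 0 < rect_side a b c d s (mid (D k) i).
    rewrite lt_neqAle eq_sym; apply/andP; split; first exact/eqP/ms.
    exact/in_rect_side/mid_in_rect.
  have [s s0 hs] := finite_small (fun s => affine_gt0_small
    (rect_side a b c d s (mid (D k) i) - rect_side a b c d s (D k i)) (ms s)).
  have /negP := h s s0; apply; apply/in_rectP => s'.
  have : 0 < s <= s by rewrite s0 lexx.
  move=> /hs /(_ s') /ltW.
  by congr (0 <= _); rewrite /outer rect_side_lin; ring.
move=> z zE; apply/rect_boundaryP; split.
  by move=> s'; apply: in_rect_side; apply: (@closed_in_rect k); exact: (@edge_closed _ _ i).
move: zE; rewrite edgeE// => -[t _ ->]; exists s; rewrite rect_side_lin.
by have [-> -> _] := mid_side0 ms; rewrite !mulr0 addr0.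
Qed.

(** The opposite vertex of the neighbour would lie across the side of the rectangle that carries the
    edge, hence outside the rectangle. *)
Lemma boundary_not_shared k l i j : k != l -> shared (D k) i (D l) j ->
  ~ edge (D k) i `<=` rect_boundary a b c d.
Proof.
move=> kl sh h; have /rect_boundaryP[_ [s ms]] := h _ (mid_edge (D0 k) i).
have [e1 e2 vi] := mid_side0 ms.
have := vertex_side l j s; rewrite (rect_side_lam _ _ _ _ s (D l j) (D0 k)) (sum3_rot _ i) e1 e2 !mulr0 !addr0.
rewrite leNgt pmulr_llt0// lam_side; have := opposite_sides kl sh.
case: (ltgtP (side (D k) i (D k i)) 0) => [h0|h0|->]; last by rewrite mul0r ltxx.
  by rewrite nmulr_rlt0// => h1; rewrite nmulr_llt0 ?invr_lt0// h1.
by rewrite pmulr_rlt0// => h1; rewrite pmulr_llt0 ?invr_gt0// h1.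
Qed.

(** Points just across the edge are in the rectangle, hence covered by the mesh. A triangle met by
    such points arbitrarily close to the midpoint contains the midpoint, being closed; if no
    neighbour did, all finitely many triangles would be avoided at once. *)
Lemma interior_shared k i : ~ edge (D k) i `<=` rect_boundary a b c d ->
  exists l j, k != l /\ shared (D k) i (D l) j.
Proof.
move=> /boundary_outer /existsNP[t0 /not_implyP[t00 /negP]]; rewrite negbK => ht0.
have outer_rect t : 0 < t <= t0 -> in_rect a b c d (outer (D k) i t).
  move=> /andP[tp tt0]; apply/in_rectP => s; move/in_rectP : ht0 => /(_ s).
  have /in_rectP/(_ s) := mid_in_rect k i; rewrite /outer !rect_side_lin => m0 ht.
  nra.
apply: contrapT => hN.
have : forall l, exists2 s, 0 < s & forall t, 0 < t <= s -> ~ closed_triangle (D l) (outer (D k) i t).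
  move=> l; have [<-|kl] := eqVneq k l.
    exists 1 => // t /andP[t1 _]; rewrite closed_triangleE//= => /(_ i).
    rewrite /outer lam_lin lam_mid// eqxx lam_vertex// eqxx mulr0 addr0 mulr1 opprD addNKr oppr_ge0 leNgt t1.
    by [].
  apply: contrapT => hs; apply: hN; exists l.
  have [j sh] : exists j, shared (D k) i (D l) j; last by exists j.
  apply: mid_shared => //; rewrite closed_triangleE//= => j.
  apply: (@affine_ge0_lim _ _ (lam (D l) j (mid (D k) i) - lam (D l) j (D k i))) => s s0.
  have [t] : exists t, ~ (0 < t <= s -> ~ closed_triangle (D l) (outer (D k) i t)).
    by apply/existsNP => hh; apply: hs; exists s.
  move=> /not_implyP[ts /contrapT]; rewrite closed_triangleE//= => /(_ j) tj; exists t => //.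
  by move: tj; congr (0 <= _); rewrite /outer lam_lin; ring.
move=> /finite_small[s s0 hs]; pose t := Order.min s t0.
have tp : 0 < t by rewrite lt_min s0.
have [l _ /(hs t)] : (\bigcup_k closed_triangle (D k)) (outer (D k) i t).
  have [_ -> _ _] := hD; have := outer_rect t; rewrite tp ge_min lexx orbT => /(_ isT).
  by rewrite /in_rect /closed_rect => /andP[h1 h2]; split; rewrite /= in_itv/=.
by apply; rewrite tp ge_min lexx.
Qed.

(** Two different neighbours across one edge would both lie opposite to triangle [k], hence on the
    same side of a common edge, which [opposite_sides] excludes. *)
Lemma shared_unique k l l' i j j' : k != l -> k != l' ->
  shared (D k) i (D l) j -> shared (D k) i (D l') j' -> l = l' /\ j = j'.
Proof.
move=> kl kl' sh sh'.
have ll' : l = l'.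
  apply/eqP; apply: contraT => ll'.
  have s1 := opposite_sides kl sh; have s2 := opposite_sides kl' sh'.
  have sh'' : shared (D l) j (D l') j'.
    by case: sh sh' => -[e1 e2] [] [e3 e4]; [left|right|right|left]; split; congruence.
  have := opposite_sides ll' sh''.
  have -> : side (D l) j (D l j) * side (D l) j (D l' j') = side (D k) i (D l j) * side (D k) i (D l' j').
    by case: (shared_side sh) => sE; rewrite !sE ?mulrNN.
  move: s1 s2; case: (ltgtP (side (D k) i (D k i)) 0) => [h|h|->]; last by rewrite mul0r ltxx.
    by rewrite !(nmulr_rlt0 _ h) => h1 h2; rewrite (pmulr_rlt0 _ h1) ltNge (ltW h2).
  by rewrite !(pmulr_rlt0 _ h) => h1 h2; rewrite (nmulr_rlt0 _ h1) ltNge (ltW h2).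
split => //; rewrite -{l'}ll' in kl' sh' *.
apply/eqP; apply: contraT => jj'.
have : edge (D l) j' (D l j) by rewrite vertex_edge.
by rewrite -(shared_edge (D0 k) (D0 l) sh') (shared_edge (D0 k) (D0 l) sh) vertex_edge// eqxx.
Qed.

End mesh_edges.

(** * Summation of the edge terms *)

Section polynomial_functionals.
Context {R : realType}.
Notation mu := (@lebesgue_measure R).
Notation plane := (mu \x mu)%E.
Implicit Types (p q : {poly {poly R}}) (V : triangle R).

Definition linear_functional (L : {poly {poly R}} -> R) :=
  (forall p q, L (p + q) = L p + L q) /\ (forall c p, L (c%:P *: p) = c * L p).

Lemma linear_functional0 L : linear_functional L -> L 0 = 0.
Proof. by move=> [_ LZ]; rewrite -(scale0r (0 : {poly {poly R}})) -polyC0 LZ mul0r. Qed.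

Definition triangle_int V p := \int[plane]_(z in open_triangle V) ev p z.

Lemma triangle_int_linear V : area2 V != 0 -> linear_functional (triangle_int V).
Proof.
move=> V0; have iR p := integrable_rect_fun (rect_fun_single V0 p).
rewrite /triangle_int; split=> [p q|c p]; rewrite !Rintegral_triangle.
  rewrite -RintegralD//.
  by apply: eq_Rintegral => z _; rewrite evD mulrDr.
rewrite -RintegralZl//.
by apply: eq_Rintegral => z _; rewrite evZ mulrCA.
Qed.

Lemma integrable_segment01 p (P Q : R * R) :
  mu.-integrable `[0, 1] (EFin \o (fun s => ev p (P.1 + s * (Q.1 - P.1), P.2 + s * (Q.2 - P.2)))).
Proof.
have mS := measurable_segment p P Q.
have [M M0 h] := ev_bounded p (`|P.1| + `|Q.1 - P.1| + (`|P.2| + `|Q.2 - P.2|)).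
apply: measurable_bounded_integrable => //.
- by have := @lebesgue_measure_itv R `[0, 1] => /= ->; rewrite lte_fin ltr01 sube0 ltry.
- exact: measurable_funTS.
- exists M; split; first exact: num_real.
  move=> x Mx s /=; rewrite in_itv/= => /andP[s0 s1]; apply: le_trans (ltW Mx); apply: h => /=.
    apply: le_trans (ler_normD _ _) _; rewrite normrM ger0_norm//.
    by rewrite ler_wpDr ?addr_ge0// lerD2l ler_piMl.
  apply: le_trans (ler_normD _ _) _; rewrite normrM ger0_norm//.
  by rewrite ler_wpDl ?addr_ge0// lerD2l ler_piMl.
Qed.

Lemma segment_int_linear (P Q : R * R) : linear_functional (fun p => segment_int p P Q).
Proof.
have iS p := integrable_segment01 p P Q.
rewrite /segment_int; split=> [p q|c p].
  by rewrite -RintegralD//; apply: eq_Rintegral => s _; rewrite evD.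
by rewrite -RintegralZl//; apply: eq_Rintegral => s _; rewrite evZ.
Qed.

Lemma edge_int_linear V i : linear_functional (fun p => edge_int V i (ev p)).
Proof.
have [hD hZ] := segment_int_linear (V (i + 1)) (V (i + 2%:R)).
by split=> [p q|c p]; rewrite !edge_intE ?hD ?hZ ?mulrDr// mulrCA.
Qed.

Lemma segment_int_sym p (P Q : R * R) : segment_int p Q P = segment_int p P Q.
Proof.
have iS := integrable_segment p P Q.
rewrite -!Rintegral_segment (Rintegral_opp iS) (Rintegral_shift (-1) (integrable_opp iS)).
apply: eq_Rintegral => s _; rewrite !indicE !mem_setE !in_itv/=.
congr (_%:R * ev p _); last by congr pair; ring.
congr nat_of_bool; apply/idP/idP => /andP[h1 h2]; apply/andP; split; lra.
Qed.

Lemma shared_edge_length V i V' j : shared V i V' j -> edge_length V i = edge_length V' j.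
Proof.
rewrite /edge_length /edge_vec => -[] [-> ->]//=.
by congr (Num.sqrt (_ + _)); rewrite -sqrrN opprB.
Qed.

Lemma shared_edge_int V i V' j p : shared V i V' j -> edge_int V i (ev p) = edge_int V' j (ev p).
Proof.
move=> sh; rewrite !edge_intE (shared_edge_length sh); congr (_ * _).
by case: sh => -[-> ->]//; exact: segment_int_sym.
Qed.

Lemma shared_normal V i V' j : area2 V != 0 -> area2 V' != 0 -> shared V i V' j ->
  side V i (V i) * side V i (V' j) < 0 ->
  (normal V' j).1 = - (normal V i).1 /\ (normal V' j).2 = - (normal V i).2.
Proof.
move=> V0 V0' sh; rewrite !normalE//= -(shared_edge_length sh) -(side_vertex V i) -(side_vertex V' j).
move=> s0.
have sgE : Num.sg (side V i (V' j)) = - Num.sg (side V i (V i)).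
  case: (ltgtP (side V i (V i)) 0) s0 => [h|h|->]; last by rewrite mul0r ltxx.
    by rewrite nmulr_rlt0// => h'; rewrite gtr0_sg// ltr0_sg// opprK.
  by rewrite pmulr_rlt0// => h'; rewrite ltr0_sg// gtr0_sg.
case: sh (shared_side sh) => -[e1 e2] sE.
  have -> : side V' j (V' j) = side V i (V' j) by rewrite /side e1 e2.
  by rewrite /edge_vec e1 e2 sgE/=; split; ring.
have -> : side V' j (V' j) = - side V i (V' j) by rewrite /side e1 e2 orientC.
by rewrite /edge_vec e1 e2 sgrN sgE/=; split; ring.
Qed.

Lemma dxM p q : dx (p * q) = dx p * q + p * dx q.
Proof.
have dxE (r : {poly {poly R}}) : dx r = swapXY (swapXY r)^`() by rewrite -[RHS]/(swapXY (dy _)) -swapXY_dx swapXYK.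
have sM (r s : {poly {poly R}}) : swapXY (r * s) = swapXY r * swapXY s by exact: rmorphM.
have sD (r s : {poly {poly R}}) : swapXY (r + s) = swapXY r + swapXY s by exact: rmorphD.
by rewrite !dxE sM derivM sD !sM !swapXYK.
Qed.

Lemma dyM p q : dy (p * q) = dy p * q + p * dy q.
Proof. exact: derivM. Qed.

Lemma divergence_theorem V (F G : {poly {poly R}}) : area2 V != 0 ->
  triangle_int V (dx F + dy G) =
  \sum_i edge_int V i (ev ((normal V i).1%:P *: F + (normal V i).2%:P *: G)).
Proof.
move=> V0; have [tD _] := triangle_int_linear V0.
rewrite tD /triangle_int Rintegral_triangle_dx// Rintegral_triangle_dy// -big_split.
apply: eq_bigr => i _; have [hD hZ] := edge_int_linear V i.
by rewrite hD !hZ.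
Qed.

End polynomial_functionals.

Section edge_sums.
Context {R : realType}.
Variables (a b c d : R) (K : nat) (D : 'I_K -> triangle R).
Hypothesis hD : triangulation a b c d D.

Let D0 k : area2 (D k) != 0. Proof. by case: hD. Qed.

Definition edge_match (k : 'I_K) (i : 'I_3) (l : 'I_K) (j : 'I_3) : bool :=
  (k != l) && `[< edge (D k) i = edge (D l) j >].

Lemma edge_matchC k i l j : edge_match k i l j = edge_match l j k i.
Proof.
rewrite /edge_match eq_sym; congr andb; apply/idP/idP => /asboolP h; exact/asboolP.
Qed.

Lemma edge_matchP k i l j : edge_match k i l j <-> k != l /\ shared (D k) i (D l) j.
Proof.
split=> [/andP[kl /asboolP h]|[kl h]]; first by split => //; exact: (edge_shared hD).
by rewrite /edge_match kl; apply/asboolP; exact: shared_edge.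
Qed.

Let boundary k i := `[< edge (D k) i `<=` rect_boundary a b c d >].

(** Every edge of a triangle has either exactly one partner or lies on the boundary; stated as a sum
    so that it can be inserted into any sum over edges. *)
Lemma edge_match_sum k i (x : R) :
  (\sum_(l < K) \sum_(j < 3 | edge_match k i l j) x) + (if boundary k i then x else 0) = x.
Proof.
rewrite (pair_big_dep predT (fun l j => edge_match k i l j))/=.
case: ifPn => [/asboolP h|/asboolPn h].
  rewrite big_pred0 ?add0r// => -[l j] /=; apply/negP => /edge_matchP[kl sh].
  exact: (boundary_not_shared hD kl sh).
have [l [j [kl sh]]] := interior_shared hD h.
rewrite (big_pred1 (l, j)) ?addr0// => -[l' j'] /=; apply/idP/idP.
  by move=> /edge_matchP[kl' sh']; have [-> ->] := shared_unique hD kl kl' sh sh'.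
by rewrite xpair_eqE => /andP[/eqP -> /eqP ->]; apply/edge_matchP.
Qed.

(** Distribute each term to its unique partner or to the boundary, split the partners by [k < l] and
    [l < k], and exchange the names in the second half. *)
Lemma sum_edges (I : 'I_K -> 'I_3 -> R) :
  \sum_(k < K) \sum_(i < 3) I k i =
  \sum_(k < K) \sum_(l < K | (k < l)%N) \sum_(i < 3)
    \sum_(j < 3 | `[< edge (D k) i = edge (D l) j >]) (I k i + I l j) +
  \sum_(k < K) \sum_(i < 3 | boundary k i) I k i.
Proof.
transitivity (\sum_(k < K) \sum_(l < K) \sum_(i < 3) \sum_(j < 3 | edge_match k i l j) I k i +
    \sum_(k < K) \sum_(i < 3 | boundary k i) I k i).
  rewrite -big_split; apply: eq_bigr => k _.
  rewrite exchange_big/= [X in _ + X]big_mkcond -big_split; apply: eq_bigr => i _.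
  exact/esym/edge_match_sum.
congr (_ + _).
pose S k l := \sum_(i < 3) \sum_(j < 3 | edge_match k i l j) I k i.
have Skk k : S k k = 0.
  by rewrite /S big1// => i _; rewrite big_pred0// => j; rewrite /edge_match eqxx.
transitivity (\sum_(k < K) \sum_(l < K | (k < l)%N) S k l + \sum_(k < K) \sum_(l < K | (l < k)%N) S k l).
  rewrite -big_split; apply: eq_bigr => k _ /=.
  rewrite (bigID (fun l : 'I_K => (k < l)%N))/=; congr (_ + _).
  rewrite (bigID (fun l : 'I_K => (l < k)%N))/= [X in _ + X]big1 ?addr0 => [|l].
    by apply: eq_bigl => l; rewrite -leqNgt; case: ltngtP.
  rewrite -!leqNgt => /andP[h1 h2]; have -> : l = k by apply/val_inj => /=; apply/eqP; rewrite eqn_leq h1 h2.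
  exact: Skk.
rewrite [X in _ + X](exchange_big_dep predT)//= -big_split; apply: eq_bigr => k _ /=.
rewrite -big_split; apply: eq_bigr => l kl /=.
have knl : k != l by rewrite neq_ltn kl.
rewrite /S [X in _ + X](exchange_big_dep predT)//= -big_split; apply: eq_bigr => i _ /=.
under eq_bigl do rewrite /edge_match knl.
under [X in _ + X]eq_bigl do rewrite edge_matchC /edge_match knl.
by rewrite -big_split.
Qed.

Implicit Types (q v : broken R K).

(** Edge integrands are kept as polynomials, so that an edge integral is a linear functional on them
    and integrability is settled once. *)
Definition flux_poly q1 q2 v k i : {poly {poly R}} :=
  (normal (D k) i).1%:P *: (q1 k * v k) + (normal (D k) i).2%:P *: (q2 k * v k).

Definition q_edge_poly q1 q2 v k i l j : {poly {poly R}} :=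
  (2^-1)%:P *: ((q1 k + q1 l) * ((normal (D k) i).1%:P *: v k + (normal (D l) j).1%:P *: v l) +
                (q2 k + q2 l) * ((normal (D k) i).2%:P *: v k + (normal (D l) j).2%:P *: v l)).

Definition u_edge_poly u p1 p2 k i l j : {poly {poly R}} :=
  (2^-1)%:P *: ((u k + u l) * ((normal (D k) i).1%:P *: p1 k + (normal (D k) i).2%:P *: p2 k +
                ((normal (D l) j).1%:P *: p1 l + (normal (D l) j).2%:P *: p2 l))).

Lemma q_edge_termsE (q : vt_field R K) (v : t_field R K) t :
  q_edge_terms a b c d D q v t =
  \sum_(k < K) \sum_(l < K | (k < l)%N) \sum_(i < 3)
    \sum_(j < 3 | `[< edge (D k) i = edge (D l) j >])
      edge_int (D k) i (ev (q_edge_poly (q.1 t) (q.2 t) (v t) k i l j)) +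
  \sum_(k < K) \sum_(i < 3 | boundary k i) edge_int (D k) i (ev (flux_poly (q.1 t) (q.2 t) (v t) k i)).
Proof.
rewrite /q_edge_terms /interior_edges_int /boundary_edges_int; congr (_ + _).
  apply: eq_bigr => k _; apply: eq_bigr => l _; apply: eq_bigr => i _; apply: eq_bigr => j _.
  congr edge_int; apply/funext => z.
  rewrite /q_edge_poly /dot /vavg /avg /jump evZ evD !evM !evD !evZ /=.
  rewrite /GRing.scale/=; ring.
apply: eq_bigr => k _; apply: eq_bigr => i _; congr edge_int; apply/funext => z.
by rewrite /flux_poly evD !evZ !evM /dot /ev2/=; ring.
Qed.

Lemma u_edge_termsE (u : t_field R K) (pi_ : vt_field R K) t :
  u_edge_terms D u pi_ t =
  \sum_(k < K) \sum_(l < K | (k < l)%N) \sum_(i < 3)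
    \sum_(j < 3 | `[< edge (D k) i = edge (D l) j >])
      edge_int (D k) i (ev (u_edge_poly (u t) (pi_.1 t) (pi_.2 t) k i l j)).
Proof.
apply: eq_bigr => k _; apply: eq_bigr => l _; apply: eq_bigr => i _; apply: eq_bigr => j _.
congr edge_int; apply/funext => z.
by rewrite /u_edge_poly /vjump /avg /dot /ev2 evZ evM !evD !evZ /=; ring.
Qed.

(* On an interior edge, where the normals are opposite, the central fluxes add up
   to the sum of the two one-sided fluxes of [q u]. *)
Lemma edge_terms_sum (q : vt_field R K) (v : t_field R K) t :
  q_edge_terms a b c d D q v t + u_edge_terms D v q t =
  \sum_(k < K) \sum_(i < 3) edge_int (D k) i (ev (flux_poly (q.1 t) (q.2 t) (v t) k i)).
Proof.
rewrite sum_edges q_edge_termsE u_edge_termsE addrAC; congr (_ + _).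
rewrite -big_split; apply: eq_bigr => k _; rewrite -big_split; apply: eq_bigr => l kl.
rewrite -big_split; apply: eq_bigr => i _; rewrite -big_split; apply: eq_bigr => j /asboolP e /=.
have knl : k != l by rewrite neq_ltn kl.
have sh := edge_shared hD knl e.
rewrite -(shared_edge_int _ sh).
have [n1 n2] := shared_normal (D0 k) (D0 l) sh (opposite_sides hD knl sh).
have [eD _] := edge_int_linear (D k) i; rewrite -!eD; congr edge_int; apply/funext => z.
rewrite /q_edge_poly /u_edge_poly /flux_poly n1 n2.
by rewrite !(evD, evM, evZ); field.
Qed.

End edge_sums.

(** * Bilinear forms of time-dependent fields *)

Section L2_time.
Context {R : realType}.
Notation mu := (@lebesgue_measure R).
Variable T : R.
Implicit Types f g : R -> R.

Let mI : measurable (`[0, T]%classic : set (measurableTypeR R)). Proof. exact: measurable_itv. Qed.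

Lemma L2_timeM_integrable f g : L2_time T f -> L2_time T g ->
  mu.-integrable `[0, T] (EFin \o (fun t => f t * g t)).
Proof.
move=> [mf fi] [mg gi].
have := integrableD mI fi gi; apply: le_integrable => //.
  by apply/measurable_EFinP; exact: measurable_funM.
move=> t _ /=; rewrite lee_fin [leRHS]ger0_norm ?addr_ge0 ?sqr_ge0//.
rewrite ler_norml; apply/andP; split; nra.
Qed.

Lemma L2_timeD f g : L2_time T f -> L2_time T g -> L2_time T (fun t => f t + g t).
Proof.
move=> fL gL; have [mf fi] := fL; have [mg gi] := gL; have fg := L2_timeM_integrable fL gL.
split; first exact: measurable_funD.
have := integrableD mI (integrableD mI fi gi) (integrableD mI fg fg).
by apply: eq_integrable => // t _ /=; rewrite -!EFinD; congr EFin; ring.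
Qed.

Lemma L2_time_bndM f g (M : R) : measurable_fun `[0, T] f -> (forall t, t \in `[0, T] -> `|f t| <= M) ->
  L2_time T g -> L2_time T (fun t => f t * g t).
Proof.
move=> mf fM [mg gi]; split; first exact: measurable_funM.
have := integrableZl mI (M ^+ 2) gi; apply: le_integrable => //.
  by apply/measurable_EFinP; apply: measurable_funX; exact: measurable_funM.
move=> t t0T /=; rewrite lee_fin exprMn !normrM ler_wpM2r//.
have h : `|f t| <= `|M| by apply: le_trans (fM t t0T) _; exact: ler_norm.
by apply: ler_pM.
Qed.

Lemma L2_time_bnd f (M : R) : measurable_fun `[0, T] f -> (forall t, t \in `[0, T] -> `|f t| <= M) ->
  L2_time T f.
Proof.
move=> mf fM; have [T0|T0] := leP 0 T; last first.
  split => //; rewrite set_itv_ge; first exact: integrable_set0.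
  by rewrite bnd_simp -ltNge.
rewrite (_ : f = fun t => f t * 1); last by apply/funext => t; rewrite mulr1.
apply: (L2_time_bndM mf fM); split => //.
apply: (@eq_integrable _ _ _ _ _ _ (cst 1%:E)) => //; first by move=> t _ /=; rewrite expr1n.
apply/integrableP; split => //; rewrite /= normr1 integral_cst//= mul1e.
have := @lebesgue_measure_itv R `[0, T] => /= ->; rewrite lte_fin; case: ifP => // _.
by rewrite sube0 ltry.
Qed.

Lemma L2_timeZ c f : L2_time T f -> L2_time T (fun t => c * f t).
Proof. by apply: (@L2_time_bndM (cst c) f `|c|). Qed.

Lemma L2_time_integrable f : L2_time T f -> mu.-integrable `[0, T] (EFin \o f).
Proof.
move=> fL; have : L2_time T (cst 1) by apply: (@L2_time_bnd _ 1) => // t _; rewrite normr1.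
move=> /(L2_timeM_integrable fL); apply: eq_integrable => // t _ /=.
by rewrite mulr1.
Qed.

End L2_time.

Section bilinear_forms.
Context {R : realType} {J : finType}.
Notation mu := (@lebesgue_measure R).
Notation poly2 := {poly {poly R}}.
Variables (T : R) (N : nat).
Implicit Types (X Y : J -> poly2) (x y : R -> J -> poly2).

Let mI : measurable (`[0, T]%classic : set (measurableTypeR R)). Proof. exact: measurable_itv. Qed.

Definition monomial (i j : nat) : poly2 := 'X^i *: 'X^j.

Lemma monomial_expansion p : total_degree_le N p ->
  p = \sum_(j < N.+1) \sum_(i < N.+1) (p`_j`_i)%:P *: monomial i j.
Proof.
move=> pN; transitivity (\poly_(j < N.+1) \poly_(i < N.+1) p`_j`_i).
  apply/polyP => j; rewrite coef_poly; case: ltnP => jN; last first.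
    apply/polyP => i; rewrite coef0 pN//.
    by rewrite (leq_trans jN)// leq_addl.
  apply/polyP => i; rewrite coef_poly; case: ltnP => // iN.
  by rewrite pN// (leq_trans iN)// leq_addr.
rewrite poly_def; apply: eq_bigr => j _; rewrite poly_def scaler_suml; apply: eq_bigr => i _.
by rewrite /monomial scalerA mul_polyC.
Qed.

Definition bilinear_form (B : (J -> poly2) -> (J -> poly2) -> R) :=
  (forall Y, additive_homogeneous (B^~ Y)) /\ (forall X, additive_homogeneous (B X)).

Lemma additive_homogeneous0 (L : (J -> poly2) -> R) : additive_homogeneous L -> L (fun=> 0) = 0.
Proof.
move=> [_ LZ]; have := LZ 0 (fun=> 0); rewrite mul0r => <-; congr L.
by apply/funext => s; rewrite scaler0.
Qed.

Lemma additive_homogeneousN (L : (J -> poly2) -> R) X : additive_homogeneous L ->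
  L (fun s => - X s) = - L X.
Proof.
move=> [_ LZ]; rewrite -[RHS]mulN1r -LZ; congr L; apply/funext => s.
by rewrite polyCN polyC1 scaleN1r.
Qed.

Lemma additive_homogeneousB (L : (J -> poly2) -> R) X Y : additive_homogeneous L ->
  L (fun s => X s - Y s) = L X - L Y.
Proof. by move=> LL; rewrite -additive_homogeneousN//; case: LL => <-. Qed.

Lemma additive_homogeneous_sum (L : (J -> poly2) -> R) (I : Type) (r : seq I) (F : I -> J -> poly2) :
  additive_homogeneous L -> L (fun s => \sum_(a <- r) F a s) = \sum_(a <- r) L (F a).
Proof.
move=> LL; elim: r => [|a r IH].
  by rewrite big_nil -(additive_homogeneous0 LL); congr L; apply/funext => s; rewrite big_nil.
rewrite big_cons -IH; have [<- _] := LL; congr L.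
by apply/funext => s; rewrite big_cons.
Qed.

Let index := (J * ('I_N.+1 * 'I_N.+1))%type.

Definition coordinate (a : index) X : R := (X a.1)`_a.2.1`_a.2.2.

Definition basis (a : index) : J -> poly2 :=
  fun s => if s == a.1 then monomial a.2.2 a.2.1 else 0.

Lemma additive_homogeneous_expansion (L : (J -> poly2) -> R) X : additive_homogeneous L ->
  (forall s, total_degree_le N (X s)) ->
  L X = \sum_(a : index) coordinate a X * L (basis a).
Proof.
move=> LL XN; have [_ LZ] := LL.
under eq_bigr do rewrite -LZ.
rewrite -additive_homogeneous_sum//; congr L; apply/funext => s.
rewrite [LHS](monomial_expansion (XN s)).
rewrite -(pair_bigA _ (fun s' ji => (coordinate (s', ji) X)%:P *: basis (s', ji) s))/=.
rewrite (bigD1 s)//= [X in _ = _ + X]big1 ?addr0 => [|s' s's].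
  rewrite -(pair_bigA _ (fun j i => (coordinate (s, (j, i)) X)%:P *: basis (s, (j, i)) s))/=.
  by apply: eq_bigr => j _; apply: eq_bigr => i _; rewrite /basis /= eqxx.
by rewrite big1// => ji _; rewrite /basis/= eq_sym (negbTE s's) scaler0.
Qed.

Definition L2_fields x := forall s, (forall t, t \in `[0, T] -> total_degree_le N (x t s)) /\
  forall i j, L2_time T (fun t => (x t s)`_j`_i).

Lemma integrable_bilinear_form B x y : bilinear_form B -> L2_fields x -> L2_fields y ->
  mu.-integrable `[0, T] (EFin \o (fun t => B (x t) (y t))).
Proof.
move=> [Bl Br] xL yL.
have cL a z : L2_fields z -> L2_time T (fun t => coordinate a (z t)) by move=> zL; case: (zL a.1) => _; exact.
have iab a b : mu.-integrable `[0, T] (EFin \o (fun t => coordinate a (x t) * (B (basis a) (basis b) * coordinate b (y t)))).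
  by apply: L2_timeM_integrable; [exact: cL|apply: L2_timeZ; exact: cL].
have ia a : mu.-integrable `[0, T] (EFin \o (fun t => \sum_(b <- index_enum index)
    (coordinate a (x t) * (B (basis a) (basis b) * coordinate b (y t))))).
  exact: (integrable_sumR mI (iab a)).
have := integrable_sumR mI ia (index_enum index).
apply: eq_integrable => // t; rewrite inE/= => tT; congr EFin.
have xN s : total_degree_le N (x t s) by case: (xL s) => + _; apply.
have yN s : total_degree_le N (y t s) by case: (yL s) => + _; apply.
rewrite (additive_homogeneous_expansion (Bl (y t)) xN); apply: eq_bigr => a _.
rewrite (additive_homogeneous_expansion (Br (basis a)) yN) mulr_sumr; apply: eq_bigr => b _.
by rewrite [_ * B _ _]mulrC.
Qed.

End bilinear_forms.

Section bilinear_closure.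
Context {R : realType} {J : finType}.
Notation poly2 := {poly {poly R}}.
Implicit Types (X Y : J -> poly2).

Lemma dxD (p q : poly2) : dx (p + q) = dx p + dx q.
Proof. exact: raddfD. Qed.

Lemma dxZ (c : R) (p : poly2) : dx (c%:P *: p) = c%:P *: dx p.
Proof. by rewrite -!mul_polyC dxM /dx map_polyC/= derivC polyC0 mul0r add0r. Qed.

Lemma dyD (p q : poly2) : dy (p + q) = dy p + dy q.
Proof. exact: derivD. Qed.

Lemma dyZ (c : R) (p : poly2) : dy (c%:P *: p) = c%:P *: dy p.
Proof. exact: derivZ. Qed.

Lemma bilinear_formD (B C : (J -> poly2) -> (J -> poly2) -> R) :
  bilinear_form B -> bilinear_form C -> bilinear_form (fun X Y => B X Y + C X Y).
Proof.
move=> [Bl Br] [Cl Cr]; split => Z.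
  have [B1 B2] := Bl Z; have [C1 C2] := Cl Z.
  by split=> [X Y|c X]; rewrite ?B1 ?C1 ?B2 ?C2 ?mulrDr// addrACA.
have [B1 B2] := Br Z; have [C1 C2] := Cr Z.
by split=> [X Y|c X]; rewrite ?B1 ?C1 ?B2 ?C2 ?mulrDr// addrACA.
Qed.

Lemma bilinear_formN (B : (J -> poly2) -> (J -> poly2) -> R) :
  bilinear_form B -> bilinear_form (fun X Y => - B X Y).
Proof.
move=> [Bl Br]; split => Z.
  by have [B1 B2] := Bl Z; split=> [X Y|c X]; rewrite ?B1 ?B2 ?opprD// mulrN.
by have [B1 B2] := Br Z; split=> [X Y|c X]; rewrite ?B1 ?B2 ?opprD// mulrN.
Qed.

Lemma bilinear_form_sum (I : Type) (r : seq I) (P : pred I) (B : I -> (J -> poly2) -> (J -> poly2) -> R) :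
  (forall i, bilinear_form (B i)) -> bilinear_form (fun X Y => \sum_(i <- r | P i) B i X Y).
Proof.
move=> BB; split => Z; split=> [X Y|c X].
- by rewrite -big_split; apply: eq_bigr => i _; have [/(_ Z)[+ _] _] := BB i; exact.
- by rewrite mulr_sumr; apply: eq_bigr => i _; have [/(_ Z)[_ +] _] := BB i; exact.
- by rewrite -big_split; apply: eq_bigr => i _; have [_ /(_ Z)[+ _]] := BB i; exact.
- by rewrite mulr_sumr; apply: eq_bigr => i _; have [_ /(_ Z)[_ +]] := BB i; exact.
Qed.

Definition bilinear_poly (P : (J -> poly2) -> (J -> poly2) -> poly2) :=
  [/\ forall X Y Z, P (fun s => X s + Y s) Z = P X Z + P Y Z,
      forall c X Z, P (fun s => c%:P *: X s) Z = c%:P *: P X Z,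
      forall X Y Z, P Z (fun s => X s + Y s) = P Z X + P Z Y &
      forall c X Z, P Z (fun s => c%:P *: X s) = c%:P *: P Z X].

Lemma bilinear_form_functional (L : poly2 -> R) P :
  linear_functional L -> bilinear_poly P -> bilinear_form (fun X Y => L (P X Y)).
Proof.
move=> [LD LZ] [P1 P2 P3 P4]; split => Z; split=> [X Y|c X].
- by rewrite P1 LD.
- by rewrite P2 LZ.
- by rewrite P3 LD.
- by rewrite P4 LZ.
Qed.

End bilinear_closure.

(** * The scheme as a single bilinear form *)

Section scheme_forms.
Context {R : realType}.
Notation mu := (@lebesgue_measure R).
Notation poly2 := {poly {poly R}}.
Variables (a b c d alpha beta : R).
Hypotheses (halpha : 1 < alpha <= 2) (hbeta : 1 < beta <= 2).
Variables (K : nat) (D : 'I_K -> triangle R).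
Hypothesis hD : triangulation a b c d D.

Let D0 k : area2 (D k) != 0. Proof. by case: hD. Qed.
Let m01 : 0 <= 2 - alpha < 1. Proof. by apply/andP; case/andP: halpha => ? ?; split; lra. Qed.
Let n01 : 0 <= 2 - beta < 1. Proof. by apply/andP; case/andP: hbeta => ? ?; split; lra. Qed.

(* [None] is the index of the scalar unknown, [Some (false, _)] of the two
   components of p and [Some (true, _)] of those of q. *)
Definition fields := (option (bool * bool) * 'I_K)%type -> poly2.

Definition state (u p1 p2 q1 q2 : broken R K) : fields := fun s =>
  match s.1 with
  | None => u s.2
  | Some (false, false) => p1 s.2 | Some (false, true) => p2 s.2
  | Some (true, false) => q1 s.2 | Some (true, true) => q2 s.2
  end.

Implicit Types X Y : fields.

Definition cu X : broken R K := fun k => X (None, k).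
Definition cp1 X : broken R K := fun k => X (Some (false, false), k).
Definition cp2 X : broken R K := fun k => X (Some (false, true), k).
Definition cq1 X : broken R K := fun k => X (Some (true, false), k).
Definition cq2 X : broken R K := fun k => X (Some (true, true), k).

Definition form_q_grad X Y := \sum_(k < K) triangle_int (D k) (cq1 X k * dx (cu Y k) + cq2 X k * dy (cu Y k)).
Definition form_q_phi X Y := \sum_(k < K) triangle_int (D k) (cq1 X k * cp1 Y k + cq2 X k * cp2 Y k).
Definition form_frac X Y := energy a b (2 - alpha) (plane_fun D (cp1 X)) (plane_fun D (cp1 Y)) +
  yenergy c d D (2 - beta) (cp2 X) (cp2 Y).
Definition form_p_pi X Y := \sum_(k < K) triangle_int (D k) (cp1 X k * cq1 Y k + cp2 X k * cq2 Y k).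
Definition form_u_div X Y := \sum_(k < K) triangle_int (D k) (cu X k * (dx (cq1 Y k) + dy (cq2 Y k))).
Definition form_edges X Y :=
  (\sum_(k < K) \sum_(l < K | (k < l)%N) \sum_(i < 3)
    \sum_(j < 3 | `[< edge (D k) i = edge (D l) j >])
      edge_int (D k) i (ev (q_edge_poly D (cq1 X) (cq2 X) (cu Y) k i l j)) +
  \sum_(k < K) \sum_(i < 3 | `[< edge (D k) i `<=` rect_boundary a b c d >])
      edge_int (D k) i (ev (flux_poly D (cq1 X) (cq2 X) (cu Y) k i))) +
  \sum_(k < K) \sum_(l < K | (k < l)%N) \sum_(i < 3)
    \sum_(j < 3 | `[< edge (D k) i = edge (D l) j >])
      edge_int (D k) i (ev (u_edge_poly D (cu X) (cq1 Y) (cq2 Y) k i l j)).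

Definition scheme_form X Y :=
  form_q_grad X Y + form_q_phi X Y - form_frac X Y + form_p_pi X Y + form_u_div X Y - form_edges X Y.

Lemma bilinear_q_grad : bilinear_form form_q_grad.
Proof.
apply: bilinear_form_sum => k; apply: bilinear_form_functional; first exact: triangle_int_linear.
by split=> *; rewrite /cq1 /cq2 /cu ?(dxD, dyD, dxZ, dyZ) -?mul_polyC; ring.
Qed.

Lemma bilinear_q_phi : bilinear_form form_q_phi.
Proof.
apply: bilinear_form_sum => k; apply: bilinear_form_functional; first exact: triangle_int_linear.
by split=> *; rewrite /cq1 /cq2 /cp1 /cp2 -?mul_polyC; ring.
Qed.

Lemma bilinear_p_pi : bilinear_form form_p_pi.
Proof.
apply: bilinear_form_sum => k; apply: bilinear_form_functional; first exact: triangle_int_linear.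
by split=> *; rewrite /cq1 /cq2 /cp1 /cp2 -?mul_polyC; ring.
Qed.

Lemma bilinear_u_div : bilinear_form form_u_div.
Proof.
apply: bilinear_form_sum => k; apply: bilinear_form_functional; first exact: triangle_int_linear.
by split=> *; rewrite /cq1 /cq2 /cu ?(dxD, dyD, dxZ, dyZ) -?mul_polyC; ring.
Qed.

Lemma bilinear_frac : bilinear_form form_frac.
Proof.
apply: bilinear_formD; split => Z; split=> [X Y|x X].
- by have [+ _] := energy_linearl hD (cp1 Z) m01; exact.
- by have [_ +] := energy_linearl hD (cp1 Z) m01; exact.
- by have [+ _] := energy_linearr hD (cp1 Z) m01; exact.
- by have [_ +] := energy_linearr hD (cp1 Z) m01; exact.
- by have [+ _] := yenergy_linearl hD (cp2 Z) n01; exact.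
- by have [_ +] := yenergy_linearl hD (cp2 Z) n01; exact.
- by have [+ _] := yenergy_linearr hD (cp2 Z) n01; exact.
- by have [_ +] := yenergy_linearr hD (cp2 Z) n01; exact.
Qed.

Lemma bilinear_edges : bilinear_form form_edges.
Proof.
apply: bilinear_formD; [apply: bilinear_formD|].
- apply: bilinear_form_sum => k; apply: bilinear_form_sum => l; apply: bilinear_form_sum => i; apply: bilinear_form_sum => j.
  apply: (bilinear_form_functional (edge_int_linear (D k) i)).
  by split=> *; rewrite /q_edge_poly /cq1 /cq2 /cu -?mul_polyC; ring.
- apply: bilinear_form_sum => k; apply: bilinear_form_sum => i.
  apply: (bilinear_form_functional (edge_int_linear (D k) i)).
  by split=> *; rewrite /flux_poly /cq1 /cq2 /cu -?mul_polyC; ring.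
- apply: bilinear_form_sum => k; apply: bilinear_form_sum => l; apply: bilinear_form_sum => i; apply: bilinear_form_sum => j.
  apply: (bilinear_form_functional (edge_int_linear (D k) i)).
  by split=> *; rewrite /u_edge_poly /cq1 /cq2 /cu -?mul_polyC; ring.
Qed.

Lemma bilinear_scheme_form : bilinear_form scheme_form.
Proof.
by do ?[exact: bilinear_q_grad|exact: bilinear_q_phi|exact: bilinear_frac|exact: bilinear_p_pi|
  exact: bilinear_u_div|exact: bilinear_edges|apply: bilinear_formN|apply: bilinear_formD].
Qed.

(* The triple (u, - p, q) makes every term cancel except the fractional one. *)
Lemma scheme_form_diag X :
  scheme_form X (state (cu X) (fun k => - cp1 X k) (fun k => - cp2 X k) (cq1 X) (cq2 X)) = form_frac X X.
Proof.
set Y := state _ _ _ _ _.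
have e1 : form_q_grad X Y + form_u_div X Y = form_edges X Y.
  (* The edge identity concerns time-dependent fields; constant ones, read at time 0, transfer it to
     a single state. *)
  have := edge_terms_sum hD (fun=> cq1 X, fun=> cq2 X) (fun=> cu X) 0.
  rewrite q_edge_termsE u_edge_termsE/= -[LHS]/(form_edges X Y) => ->.
  rewrite -big_split; apply: eq_bigr => k _.
  rewrite -(divergence_theorem (cq1 X k * cu X k) (cq2 X k * cu X k) (D0 k)).
  have [tD _] := triangle_int_linear (D0 k); rewrite /= -tD dxM dyM; congr triangle_int.
  by rewrite /Y /cu /cq1 /cq2 /state/=; ring.
have e2 : form_q_phi X Y + form_p_pi X Y = 0.
  rewrite -big_split big1// => k _.
  have [tD _] := triangle_int_linear (D0 k); rewrite /= -tD.
  rewrite (_ : _ + _ = 0) ?(linear_functional0 (triangle_int_linear (D0 k)))//.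
  by rewrite /Y /cp1 /cp2 /cq1 /cq2 /state/=; ring.
have e3 : form_frac X Y = - form_frac X X.
  rewrite /form_frac.
  have h1 := additive_homogeneousN (cp1 X) (energy_linearr hD (cp1 X) m01).
  have h2 := additive_homogeneousN (cp2 X) (yenergy_linearr hD (cp2 X) n01).
  by rewrite opprD -h1 -h2.
rewrite /scheme_form e3 opprK -e1; have -> : form_p_pi X Y = - form_q_phi X Y.
  by apply/eqP; rewrite -addr_eq0 addrC e2.
by ring.
Qed.

Lemma ip_ev (v w : broken R K) :
  ip D (fun k => ev (v k)) (fun k => ev (w k)) = \sum_(k < K) triangle_int (D k) (v k * w k).
Proof. by apply: eq_bigr => k _; apply: eq_Rintegral => z _; rewrite evM. Qed.

Lemma ip_evD (v w v' w' : broken R K) :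
  ip D (fun k => ev (v k)) (fun k => ev (w k)) + ip D (fun k => ev (v' k)) (fun k => ev (w' k)) =
  \sum_(k < K) triangle_int (D k) (v k * w k + v' k * w' k).
Proof.
rewrite !ip_ev -big_split; apply: eq_bigr => k _.
by have [tD _] := triangle_int_linear (D0 k); rewrite tD.
Qed.

Definition field_state (u : t_field R K) (p q : vt_field R K) (t : R) : fields :=
  state (u t) (p.1 t) (p.2 t) (q.1 t) (q.2 t).

Lemma L2_fields_state T N u p q : L2_Vh T N u -> L2_Vh2 T N p -> L2_Vh2 T N q ->
  L2_fields T N (field_state u p q).
Proof.
move=> [uN uL] [[pN pL] [p'N p'L]] [[qN qL] [q'N q'L]] [[[[] []]|] k]; split.
- by move=> t tT; exact: q'N.
- by move=> i j; exact: q'L.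
- by move=> t tT; exact: qN.
- by move=> i j; exact: qL.
- by move=> t tT; exact: p'N.
- by move=> i j; exact: p'L.
- by move=> t tT; exact: pN.
- by move=> i j; exact: pL.
- by move=> t tT; exact: uN.
- by move=> i j; exact: uL.
Qed.

Lemma BformE T N (u : t_field R K) (p q : vt_field R K) (v : t_field R K) (phi pi_ : vt_field R K) :
  L2_fields T N (field_state u p q) -> L2_fields T N (field_state v phi pi_) ->
  Bform a b c d T alpha beta D u p q v phi pi_ =
  \int[mu]_(t in `[0, T]) ip D (dt u t) (evb (v t)) +
  \int[mu]_(t in `[0, T]) scheme_form (field_state u p q t) (field_state v phi pi_ t).
Proof.
move=> xL yL; have iB B : bilinear_form B -> mu.-integrable `[0, T]
    (EFin \o (fun t => B (field_state u p q t) (field_state v phi pi_ t))).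
  by move=> BB; exact: (integrable_bilinear_form BB xL yL).
have mI : measurable (`[0, T]%classic : set (measurableTypeR R)) by exact: measurable_itv.
have i1 := iB _ bilinear_q_grad; have i2 := iB _ bilinear_q_phi; have i3 := iB _ bilinear_frac.
have i4 := iB _ bilinear_p_pi; have i5 := iB _ bilinear_u_div; have i6 := iB _ bilinear_edges.
rewrite /scheme_form.
(* Splitting the integral of the sum term by term requires integrability of every partial sum. *)
have i12 := iB _ (bilinear_formD bilinear_q_grad bilinear_q_phi).
have i123 := iB _ (bilinear_formD (bilinear_formD bilinear_q_grad bilinear_q_phi) (bilinear_formN bilinear_frac)).
have i1234 := iB _ (bilinear_formD (bilinear_formD (bilinear_formD bilinear_q_grad bilinear_q_phi) (bilinear_formN bilinear_frac)) bilinear_p_pi).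
have i12345 := iB _ (bilinear_formD (bilinear_formD (bilinear_formD (bilinear_formD bilinear_q_grad bilinear_q_phi) (bilinear_formN bilinear_frac)) bilinear_p_pi) bilinear_u_div).
rewrite [X in _ = _ + X](RintegralB mI i12345 i6) (RintegralD mI i1234 i5) (RintegralD mI i123 i4)
  (RintegralB mI i12 i3) (RintegralD mI i1 i2).
rewrite /Bform.
have e1 : \int[mu]_(t in `[0, T]) (ipv D (evv q t) (grad (v t))) =
    \int[mu]_(t in `[0, T]) (form_q_grad (field_state u p q t) (field_state v phi pi_ t)).
  by apply: eq_Rintegral => t _; exact: ip_evD.
have e2 : \int[mu]_(t in `[0, T]) (ipv D (evv q t) (evv phi t)) =
    \int[mu]_(t in `[0, T]) (form_q_phi (field_state u p q t) (field_state v phi pi_ t)).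
  by apply: eq_Rintegral => t _; exact: ip_evD.
have e3 : \int[mu]_(t in `[0, T]) (ipv D (fracD a c alpha beta D p t) (evv phi t)) =
    \int[mu]_(t in `[0, T]) (form_frac (field_state u p q t) (field_state v phi pi_ t)).
  by apply: eq_Rintegral => t _; rewrite /form_frac -(ip_frac_slice2 hD _ _ n01) -(ip_frac_slice hD m01).
have e4 : \int[mu]_(t in `[0, T]) (ipv D (evv p t) (evv pi_ t)) =
    \int[mu]_(t in `[0, T]) (form_p_pi (field_state u p q t) (field_state v phi pi_ t)).
  by apply: eq_Rintegral => t _; exact: ip_evD.
have e5 : \int[mu]_(t in `[0, T]) (ip D (evb (u t)) (divg pi_ t)) =
    \int[mu]_(t in `[0, T]) (form_u_div (field_state u p q t) (field_state v phi pi_ t)).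
  by apply: eq_Rintegral => t _; exact: ip_ev.
have e6 : \int[mu]_(t in `[0, T]) (q_edge_terms a b c d D q v t + u_edge_terms D u pi_ t) =
    \int[mu]_(t in `[0, T]) (form_edges (field_state u p q t) (field_state v phi pi_ t)).
  by apply: eq_Rintegral => t _; rewrite q_edge_termsE u_edge_termsE.
rewrite e1 e2 e3 e4 e5 e6.
by rewrite !addrA.
Qed.

End scheme_forms.

(** * Absolutely continuous functions of time *)

Section primitives.
Context {R : realType}.
Notation mu := (@lebesgue_measure R).
Variable T : R.
Hypothesis T0 : 0 < T.
Implicit Types f g F G : R -> R.

Let mI (x y : R) : measurable (`[x, y]%classic : set (measurableTypeR R)). Proof. exact: measurable_itv. Qed.

Lemma integrable_patch f (x y : R) : mu.-integrable `[x, y] (EFin \o f) ->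
  mu.-integrable setT (EFin \o (f \_ `[x, y])).
Proof.
by move=> fi; rewrite -restrict_EFin; apply/integrable_restrict => //=; rewrite setTI.
Qed.

Definition H1_primitive F f := L2_time T f /\
  forall t, t \in `[0, T] -> F t = F 0 + \int[mu]_(s in `[0, t]) f s.

Lemma integrable_sub f (x y : R) : L2_time T f -> 0 <= x -> y <= T ->
  mu.-integrable `[x, y] (EFin \o f).
Proof.
move=> /L2_time_integrable fi x0 yT; apply: integrableS fi => //.
by apply: subset_itv; rewrite bnd_simp.
Qed.

Lemma primitive_bounded F f : H1_primitive F f -> exists M, forall t, t \in `[0, T] -> `|F t| <= M.
Proof.
move=> [fL FE]; exists (`|F 0| + \int[mu]_(s in `[0, T]) `|f s|) => t tT; rewrite FE//.
move: tT; rewrite in_itv/= => /andP[t0 tT].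
apply: le_trans (ler_normD _ _) _; rewrite lerD2l.
have i0 := integrable_sub fL (lexx 0) (lexx T).
have it := integrable_sub fL (lexx 0) tT.
apply: le_trans (le_normr_Rintegral (mI 0 t) it) _.
rewrite -subr_ge0 (@Rintegral_itvB _ (fun s => `|f s|) _ _ t)//; last exact: integrable_norm i0.
by apply: Rintegral_ge0.
Qed.

Lemma primitive_measurable F f : H1_primitive F f -> measurable_fun `[0, T] F.
Proof.
move=> [fL FE]; have i0 := integrable_sub fL (lexx 0) (lexx T).
have mF : measurable_fun `[0, T] (fun t => \int[mu]_(s in `[0, t]) f s).
  apply: subspace_continuous_measurable_fun; first exact: measurable_itv.
  exact: (parameterized_integral_continuous (ltW T0) i0).
apply: eq_measurable_fun (measurable_funD (measurable_cst (F 0)) mF) => t.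
by rewrite inE/= => tT; rewrite -FE.
Qed.

Lemma primitive_L2 F f : H1_primitive F f -> L2_time T F.
Proof.
by move=> FH; have [M FM] := primitive_bounded FH; exact: (L2_time_bnd (primitive_measurable FH) FM).
Qed.

(** Lebesgue differentiation is applied to [f] cut off outside [[0, T]], which is integrable on the
    line; its primitive differs from [F] by a constant near each interior time. *)
Lemma primitive_ae_derive F f : H1_primitive F f -> exists N : set R,
  [/\ measurable N, mu N = 0 & forall t, 0 < t < T -> ~ N t -> is_derive t (1 : R) F (f t)].
Proof.
move=> [fL FE]; have i0 := integrable_sub fL (lexx 0) (lexx T).
have iT : mu.-integrable setT (EFin \o (f \_ `[0, T])).
  exact: integrable_patch.
have iA y : mu.-integrable [set` Interval (BLeft 0) (BRight y)] (EFin \o (f \_ `[0, T])).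
  by apply: integrableS iT.
have [N [mN N0 hN]] := FTC1 iA (integrable_locally (mI 0 T) i0).
exists N; split => // t /andP[t0 tT] Nt.
have [dt dtE] : derivable (fun x : R => \int[mu]_(s in `[0, x]) (f \_ `[0, T]) s) t 1 /\
    derive1 (fun x : R => \int[mu]_(s in `[0, x]) (f \_ `[0, T]) s) t = (f \_ `[0, T]) t.
  apply: contrapT => h; apply: Nt; apply: hN => /= hh; apply: h; apply: hh.
  by rewrite lte_fin.
have e1 : (f \_ `[0, T]) t = f t by rewrite patchE mem_set//= in_itv/= !ltW.
rewrite e1 in dtE.
have d1 : is_derive t (1 : R) (fun x : R => F 0 + \int[mu]_(s in `[0, x]) (f \_ `[0, T]) s) (f t).
  rewrite -[f t]add0r; apply: is_deriveD.
  by apply: DeriveDef; rewrite -?derive1E.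
apply: near_eq_is_derive d1.
near=> s; have s0 : 0 < s by near: s; exact: lt_nbhsr.
have sT : s < T by near: s; exact: lt_nbhsl.
rewrite [RHS]FE ?in_itv/= ?(ltW s0) ?(ltW sT)//; congr (_ + _); apply: eq_Rintegral => x.
rewrite inE/= in_itv/= => /andP[x0 xs]; rewrite patchE mem_set//= in_itv/= x0/=.
by rewrite (le_trans xs)// ltW.
Unshelve. all: by end_near. Qed.

Lemma Rintegral_from f (y t : R) : L2_time T f -> 0 <= y -> y <= t -> t <= T ->
  \int[mu]_(s in `[y, t]) f s = \int[mu]_(s in `[0, t]) f s - \int[mu]_(s in `[0, y]) f s.
Proof.
move=> fL y0 yt tT; rewrite Rintegral_itvB//; last exact: integrable_sub.
rewrite Rintegral_itv_obnd_cbnd//; apply: integrableS (integrable_sub fL y0 tT) => //.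
by apply: subset_itv; rewrite bnd_simp.
Qed.

(* Product rule for absolutely continuous functions, by Fubini on the square
   [0, t]^2 cut along its diagonal. *)
Lemma primitive_mul F f G g t : H1_primitive F f -> H1_primitive G g -> t \in `[0, T] ->
  F t * G t = F 0 * G 0 + \int[mu]_(s in `[0, t]) (f s * G s + F s * g s).
Proof.
move=> FH GH tT; have [fL FE] := FH; have [gL GE] := GH.
have := tT; rewrite in_itv/= => /andP[t0 tT'].
have it h : L2_time T h -> mu.-integrable setT (EFin \o (h \_ `[0, t])).
  by move=> hL; apply: integrable_patch; exact: integrable_sub.
pose k (z : R * R) : R := \1_[set z : R * R | 0 <= z.1 - z.2] z.
have mk : measurable_fun setT k.
  apply: measurable_indic; rewrite (_ : [set _ | _] = (fun z : R * R => z.1 - z.2) @^-1` `[0, +oo[).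
    by rewrite -[X in measurable X]setTI; apply: measurable_funB.
  by apply/seteqP; split => z /=; rewrite in_itv/= andbT.
have k1 z : `|k z| <= 1 by rewrite /k indicE; case: (_ \in _); rewrite ?normr1 ?normr0.
have kE x y : k (x, y) = (y <= x)%R%:R.
  by rewrite /k indicE; congr (_%:R); congr nat_of_bool; apply/idP/idP; rewrite inE/= subr_ge0.
have := kernel_fubini (it _ fL) (it _ gL) mk k1.
have iFg : mu.-integrable `[0, t] (EFin \o (fun s => F s * g s)).
  by apply: integrableS (L2_timeM_integrable (primitive_L2 FH) gL) => //; apply: subset_itv; rewrite bnd_simp.
have ifG : mu.-integrable `[0, t] (EFin \o (fun s => f s * G s)).
  by apply: integrableS (L2_timeM_integrable fL (primitive_L2 GH)) => //; apply: subset_itv; rewrite bnd_simp.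
have ift := integrable_sub fL (lexx 0) tT'; have igt := integrable_sub gL (lexx 0) tT'.
(* The kernel selects y <= x: the inner integral in y is G x - G 0, and in the other order the inner
   integral in x is F t - F y. *)
have -> : \int[mu]_x ((f \_ `[0, t]) x * \int[mu]_y ((g \_ `[0, t]) y * k (x, y))) =
    \int[mu]_(x in `[0, t]) (f x * G x) - G 0 * \int[mu]_(x in `[0, t]) f x.
  rewrite -RintegralZl// -RintegralB//; last by have := integrableZl (mI 0 t) (G 0) ift; exact: eq_integrable.
  rewrite [RHS]Rintegral_mkcond; apply: eq_Rintegral => x _; rewrite !patchE.
  case: ifPn => [|_]; last by rewrite mul0r.
  rewrite mem_setE in_itv/= => /andP[x0 xt]; rewrite [G 0 * _]mulrC -mulrBr; congr (_ * _).
  rewrite GE ?in_itv/= ?x0 ?(le_trans xt)// addrAC subrr add0r [RHS]Rintegral_mkcond.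
  apply: eq_Rintegral => y _; rewrite !patchE kE !mem_setE !in_itv/=.
  have [yx|xy] := leP y x; rewrite ?andbT ?andbF ?mulr1 ?mulr0//.
  by rewrite (le_trans yx xt) andbT.
have -> : \int[mu]_y ((g \_ `[0, t]) y * \int[mu]_x ((f \_ `[0, t]) x * k (x, y))) =
    F t * \int[mu]_(x in `[0, t]) g x - \int[mu]_(x in `[0, t]) (F x * g x).
  rewrite -RintegralZl// -RintegralB//; last by have := integrableZl (mI 0 t) (F t) igt; exact: eq_integrable.
  rewrite [RHS]Rintegral_mkcond; apply: eq_Rintegral => y _; rewrite !patchE.
  case: ifPn => [|_]; last by rewrite mul0r.
  rewrite mem_setE in_itv/= => /andP[y0 yt]; rewrite mulrC -mulrBl; congr (_ * _).
  rewrite (FE t)// (FE y) ?in_itv/= ?y0 ?(le_trans yt)// opprD addrACA subrr add0r -Rintegral_from//.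
  rewrite [RHS]Rintegral_mkcond; apply: eq_Rintegral => x _; rewrite !patchE kE !mem_setE !in_itv/=.
  have [yx|xy] := leP y x; rewrite ?andbT ?andbF ?mulr1 ?mulr0//=.
  by rewrite (le_trans y0 yx).
rewrite RintegralD// (GE t)//; have := FE t tT.
set IF := \int[mu]_(s in `[0, t]) f s; set IG := \int[mu]_(s in `[0, t]) g s => FtE e.
rewrite -(subrK (G 0 * IF) (\int[mu]_(s in `[0, t]) (f s * G s))) e FtE; ring.
Qed.

Lemma H1_primitive_mul F f G g : H1_primitive F f -> H1_primitive G g ->
  H1_primitive (fun t => F t * G t) (fun t => f t * G t + F t * g t).
Proof.
move=> FH GH; split; last by move=> t tT; exact: primitive_mul.
have [[fL _] [gL _]] := (FH, GH).
have [M FM] := primitive_bounded FH; have [M' GM] := primitive_bounded GH.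
apply: L2_timeD; last exact: (L2_time_bndM (primitive_measurable FH) FM).
have := L2_time_bndM (primitive_measurable GH) GM fL.
by congr (L2_time T); apply/funext => t; rewrite mulrC.
Qed.

Lemma primitive_eq F f G g : (forall t, t \in `[0, T] -> F t = G t) ->
  (forall t, t \in `[0, T] -> f t = g t) -> H1_primitive F f -> H1_primitive G g.
Proof.
have in0 : (0 : R) \in `[0, T] by rewrite in_itv/= lexx ltW.
move=> FG fg [[mf fi] FE]; split; first split.
- by apply: eq_measurable_fun mf => t; rewrite inE => /fg.
- by move: fi; apply: eq_integrable => // t; rewrite inE => /fg ->.
- move=> t tT; rewrite -!FG// FE//; congr (_ + _); apply: eq_Rintegral => s.
  rewrite inE/= in_itv/= => /andP[s0 st]; apply: fg; rewrite in_itv/= s0 (le_trans st)//.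
  by move: tT; rewrite in_itv/= => /andP[].
Qed.

Lemma primitiveD F f G g : H1_primitive F f -> H1_primitive G g ->
  H1_primitive (fun t => F t + G t) (fun t => f t + g t).
Proof.
move=> [fL FE] [gL GE]; split=> [|t tT]; first exact: L2_timeD.
move: (tT); rewrite in_itv/= => /andP[t0 tT'].
by rewrite FE// GE// RintegralD//; [rewrite addrACA|exact: integrable_sub|exact: integrable_sub].
Qed.

Lemma primitiveZ c F f : H1_primitive F f -> H1_primitive (fun t => c * F t) (fun t => c * f t).
Proof.
move=> [fL FE]; split=> [|t tT]; first exact: L2_timeZ.
move: (tT); rewrite in_itv/= => /andP[t0 tT'].
by rewrite FE// mulrDr RintegralZl//; exact: integrable_sub.
Qed.

Lemma primitive_cst c : H1_primitive (fun=> c) (fun=> 0).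
Proof.
split; first by apply: (@L2_time_bnd _ _ _ 0) => // t _; rewrite normr0.
by move=> t _; rewrite /Rintegral integral0 addr0.
Qed.

Lemma primitive_sum (I : Type) (r : seq I) (F f : I -> R -> R) : (forall i, H1_primitive (F i) (f i)) ->
  H1_primitive (fun t => \sum_(i <- r) F i t) (fun t => \sum_(i <- r) f i t).
Proof.
move=> FH; elim: r => [|i r IH].
  by apply: (primitive_eq _ _ (primitive_cst 0)) => t _; rewrite big_nil.
by apply: (primitive_eq _ _ (primitiveD (FH i) IH)) => t _; rewrite big_cons.
Qed.

End primitives.

(** * Polynomial fields that are H^1 in time *)

Section H1_fields.
Context {R : realType} {J : finType}.
Notation mu := (@lebesgue_measure R).
Notation poly2 := {poly {poly R}}.
Variables (T : R) (N : nat).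
Hypothesis T0 : 0 < T.
Implicit Types (x y : R -> J -> poly2).

(** Here [y] is a chosen weak time derivative of [x], fixed everywhere and not only up to null
    sets. *)
Definition H1_fields x y := [/\ forall s t, t \in `[0, T] -> total_degree_le N (x t s),
  L2_fields T N y &
  forall s i j, H1_primitive T (fun t => (x t s)`_j`_i) (fun t => (y t s)`_j`_i)].

Lemma H1_fields_L2 x y : H1_fields x y -> L2_fields T N x.
Proof. by move=> [xN _ xH] s; split=> [|i j]; [exact: xN|exact: (primitive_L2 T0 (xH s i j))]. Qed.

Lemma bilinear_form_primitive B x y : bilinear_form B -> H1_fields x y ->
  H1_primitive T (fun t => B (x t) (x t)) (fun t => B (y t) (x t) + B (x t) (y t)).
Proof.
move=> [Bl Br] [xN yL xH].
have yN s t : t \in `[0, T] -> total_degree_le N (y t s) by case: (yL s) => + _; apply.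
pose c (z : R -> J -> poly2) a (t : R) : R := coordinate (N := N) a (z t).
have cH a : H1_primitive T (c x a) (c y a) by exact: xH.
pose M (a b : J * ('I_N.+1 * 'I_N.+1)) := B (basis a) (basis b).
have BE z w t : (forall s, total_degree_le N (z t s)) -> (forall s, total_degree_le N (w t s)) ->
    B (z t) (w t) = \sum_a \sum_b M a b * (c z a t * c w b t).
  move=> zN wN; rewrite (additive_homogeneous_expansion (Bl (w t)) zN); apply: eq_bigr => a _.
  rewrite (additive_homogeneous_expansion (Br (basis a)) wN) mulr_sumr; apply: eq_bigr => b _.
  by rewrite mulrA mulrC.
have := primitive_sum T0 (index_enum _) (fun a => primitive_sum T0 (index_enum _) (fun b =>
  primitiveZ (M a b) (H1_primitive_mul T0 (cH a) (cH b)))).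
apply: (primitive_eq T0) => // t tT.
  by rewrite BE// => s; exact: xN.
rewrite !BE//; try by [move=> s; exact: xN|move=> s; exact: yN].
rewrite -big_split; apply: eq_bigr => a _; rewrite -big_split; apply: eq_bigr => b _.
by rewrite mulrDr.
Qed.

Lemma H1_fields_scale (h h' : R -> R) x y : H1_primitive T h h' -> H1_fields x y ->
  H1_fields (fun t s => (h t)%:P *: x t s) (fun t s => (h' t)%:P *: x t s + (h t)%:P *: y t s).
Proof.
move=> hH [xN yL xH].
have cE (p : poly2) (e : R) i j : (e%:P *: p)`_j`_i = e * p`_j`_i by rewrite coefZ coefCM.
have zN (e : R) (p : poly2) : total_degree_le N p -> total_degree_le N (e%:P *: p).
  by move=> pN i j ij; rewrite cE pN ?mulr0.
have cH s i j : H1_primitive T (fun t => ((h t)%:P *: x t s)`_j`_i)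
    (fun t => ((h' t)%:P *: x t s + (h t)%:P *: y t s)`_j`_i).
  by apply: (primitive_eq T0 _ _ (H1_primitive_mul T0 hH (xH s i j))) => // t _; rewrite ?coefD ?cE.
split => //; first by move=> s t tT; apply: zN; exact: xN.
move=> s; split=> [t tT i j ij|i j]; last by case: (cH s i j).
case: (yL s) => /(_ t tT i j ij) y0 _.
by rewrite !coefD !cE y0 xN// !mulr0 addr0.
Qed.

Lemma is_derive_sum_seq (I : Type) (r : seq I) (F : I -> R -> R) (f : I -> R) (t : R) :
  (forall i, is_derive t (1 : R) (F i) (f i)) ->
  is_derive t (1 : R) (fun t => \sum_(i <- r) F i t) (\sum_(i <- r) f i).
Proof.
move=> Fd; elim: r => [|i r IH].
  rewrite big_nil (_ : (fun _ => _) = cst 0); first exact: is_derive_cst.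
  by apply/funext => s; rewrite big_nil.
rewrite big_cons (_ : (fun _ => _) = F i + (fun t => \sum_(i <- r) F i t)).
  exact: is_deriveD.
by apply/funext => s; rewrite big_cons.
Qed.

(** The null set is a finite union over the coefficients, so it does not depend on the point [z] of
    the plane. *)
Lemma H1_fields_ae_derive x y : H1_fields x y -> exists Z : set R,
  [/\ measurable Z, mu Z = 0 & forall t, 0 < t < T -> ~ Z t ->
    forall s z, derive1 (fun r => ev (x r s) z) t = ev (y t s) z].
Proof.
move=> [xN yL xH].
have /choice[Z ZP] (a : J * ('I_N.+1 * 'I_N.+1)) := primitive_ae_derive (xH a.1 a.2.2 a.2.1).
exists (\big[setU/set0]_a Z a); split.
- by apply: bigsetU_measurable => a _; case: (ZP a).
- apply/negligibleP; first by apply: bigsetU_measurable => a _; case: (ZP a).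
  elim/big_ind : _ => [||a _]; [exact: negligible_set0|by move=> *; exact: negligibleU|].
  by case: (ZP a) => mZ Z0 _; exact/negligibleP.
move=> t tT Zt s z; have dx (a : J * ('I_N.+1 * 'I_N.+1)) : is_derive t (1 : R) (fun r => (x r a.1)`_a.2.1`_a.2.2) ((y t a.1)`_a.2.1`_a.2.2).
  case: (ZP a) => _ _; apply => // Zat; apply: Zt; by rewrite (bigD1 a)//=; left.
pose m (a : J * ('I_N.+1 * 'I_N.+1)) := ev (basis a s) z.
have evL : additive_homogeneous (fun X : J -> poly2 => ev (X s) z).
  by split=> *; rewrite ?evD ?evZ.
have xE r : r \in `[0, T] -> ev (x r s) z = \sum_a m a * coordinate a (x r).
  move=> rT; rewrite (additive_homogeneous_expansion evL (fun s => xN s r rT)).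
  by apply: eq_bigr => a _; rewrite mulrC.
have tT' : t \in `[0, T] by rewrite in_itv/=; case/andP: tT => /ltW -> /ltW ->.
have yN s' : total_degree_le N (y t s') by case: (yL s') => + _; apply.
have d1 : is_derive t (1 : R) (fun r => \sum_a m a * coordinate a (x r)) (\sum_a m a * coordinate a (y t)).
  by apply: is_derive_sum_seq => a; apply: is_deriveZ.
have d2 : is_derive t (1 : R) (fun r => ev (x r s) z) (\sum_a m a * coordinate a (y t)).
  apply: near_eq_is_derive d1; case/andP: tT => t0 tT; near=> r.
  rewrite xE// in_itv/=; apply/andP; split; apply: ltW.
    by near: r; exact: lt_nbhsr.
  by near: r; exact: lt_nbhsl.
rewrite derive1E derive_val (additive_homogeneous_expansion evL yN).
by apply: eq_bigr => a _; rewrite mulrC.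
Unshelve. all: by end_near. Qed.

End H1_fields.

Lemma H1_Vh_fields {R : realType} (T : R) (K N : nat) (u : t_field R K) : 0 < T -> H1_Vh T N u ->
  exists ut, H1_fields T N u ut.
Proof.
move=> T0 [uN uH].
have /choice[g gP] (a : 'I_K * (nat * nat)) : exists g, H1_primitive T (fun t => (u t a.1)`_a.2.1`_a.2.2) g.
  by have [g [gL gE]] := uH a.1 a.2.2 a.2.1; exists g.
(* Beyond total degree [N] the coefficients of [u] vanish on [[0, T]], and the derivative is set to
   0 there, so that [ut] takes values in V_h at every time. *)
pose ut : t_field R K := fun t k =>
  \poly_(j < N.+1) \poly_(i < N.+1) (if (i + j <= N)%N then g (k, (j, i)) t else 0).
have utE t k i j : (ut t k)`_j`_i = if (i + j <= N)%N then g (k, (j, i)) t else 0.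
  rewrite coef_poly; case: ltnP => jN; last first.
    by rewrite coef0 leqNgt (leq_trans jN)// leq_addl.
  rewrite coef_poly; case: ltnP => iN //.
  by rewrite leqNgt (leq_trans iN)// leq_addr.
have cH k i j : H1_primitive T (fun t => (u t k)`_j`_i) (fun t => (ut t k)`_j`_i).
  have [ij|ij] := leqP (i + j) N.
    by apply: (primitive_eq T0 _ _ (gP (k, (j, i)))) => // t _; rewrite utE ij.
  apply: (primitive_eq T0 _ _ (primitive_cst T 0)) => // t tT; first by rewrite uN.
  by rewrite utE leqNgt ij.
exists ut; split => //; first by move=> k t tT; exact: uN.
move=> k; split=> [t _ i j ij|i j]; first by rewrite utE leqNgt ij.
by case: (cH k i j).
Qed.

(** * The energy balance *)

Section cutoff.
Context {R : realType}.
Notation mu := (@lebesgue_measure R).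
Variables (T t : R).
Hypotheses (t0 : 0 < t) (tT : t < T).

Let T0 : 0 < T. Proof. exact: lt_trans t0 tT. Qed.

Definition cutoff_slope (n : nat) (s : R) : R := - n.+1%:R * \1_(`]t, t + n.+1%:R^-1]%classic : set R) s.

(** Equal to 1 up to [t], then a linear descent to 0 of length 1 / (n + 1). Being defined as a
    primitive of a bounded slope, it is an H^1 multiplier by construction. *)
Definition cutoff (n : nat) (s : R) : R := 1 + \int[mu]_(r in `[0, s]) cutoff_slope n r.

Lemma cutoffE n s : cutoff n s = 1 - n.+1%:R * fine (mu (`]t, t + n.+1%:R^-1] `&` `[0, s])).
Proof.
rewrite /cutoff /cutoff_slope RintegralZl//; last first.
  by apply: integrableS (integrable_indic_itv t (t + n.+1%:R^-1) false false).
by rewrite mulNr /Rintegral integral_indic.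
Qed.

Lemma cutoff_primitive n : H1_primitive T (cutoff n) (cutoff_slope n).
Proof.
split; last by move=> s _; rewrite /cutoff set_itv1 Rintegral_set1 addr0.
apply: (@L2_time_bnd _ _ _ n.+1%:R).
  by apply: measurable_funTS; apply: measurable_funM => //; apply: measurable_indic.
move=> s _; rewrite /cutoff_slope normrM normrN normr_nat indicE.
by case: (_ \in _); rewrite ?normr1 ?mulr1// normr0 mulr0.
Qed.

Lemma cutoff_measure n : mu `]t, t + n.+1%:R^-1] = (n.+1%:R^-1)%:E.
Proof.
have := @lebesgue_measure_itv R `]t, t + n.+1%:R^-1] => /= ->.
by rewrite lte_fin ltrDl invr_gt0 ltr0n -EFinD addrAC subrr add0r.
Qed.

Lemma cutoff_bounded n s : 0 <= cutoff n s <= 1.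
Proof.
rewrite cutoffE subr_ge0 gerBl mulr_ge0 ?fine_ge0// andbT.
rewrite -ler_pdivlMl// mulr1 -lee_fin fineK; last first.
  rewrite ge0_fin_numE//; apply: (@le_lt_trans _ _ (mu `]t, t + n.+1%:R^-1])).
    by apply: le_measure; rewrite ?inE//; apply: measurableI.
  by rewrite cutoff_measure ltry.
rewrite -cutoff_measure; apply: le_measure; rewrite ?inE//; exact: measurableI.
Qed.

Lemma cutoff1 n s : s <= t -> cutoff n s = 1.
Proof.
move=> st; rewrite cutoffE (_ : _ `&` _ = set0) ?measure0 ?mulr0 ?subr0//.
apply/seteqP; split => r //= []; rewrite !in_itv/= => /andP[tr _] /andP[_ rs].
by have := le_trans rs st; rewrite leNgt tr.
Qed.

Lemma cutoff0 n s : t + n.+1%:R^-1 <= s -> cutoff n s = 0.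
Proof.
move=> st; rewrite cutoffE (_ : _ `&` _ = `]t, t + n.+1%:R^-1]%classic).
  by rewrite cutoff_measure/= mulfV ?subrr.
apply/seteqP; split => r /=; first by case.
rewrite !in_itv/= => /andP[tr rt]; rewrite tr rt (le_trans rt st) andbT; split => //.
by rewrite ltW// (lt_trans t0).
Qed.

Lemma cutoff_cvg s : 0 <= s -> (fun n => cutoff n s) @ \oo --> (\1_(`[0, t]%classic : set R) s : R).
Proof.
move=> s0; apply: cvg_near_cst; rewrite indicE mem_setE in_itv/= s0/=.
have [st|ts] := leP s t; first by apply: nearW => n; rewrite cutoff1.
have ts0 : 0 < s - t by rewrite subr_gt0.
near=> n; rewrite cutoff0// -lerBrDl ltW//; near: n.
exact: (near_infty_natSinv_lt (PosNum ts0)).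
Unshelve. all: by end_near. Qed.

Lemma cutoff_vanishing (h : R -> R) : mu.-integrable `[0, T] (EFin \o h) ->
  (forall n, \int[mu]_(s in `[0, T]) (cutoff n s * h s) = 0) ->
  \int[mu]_(s in `[0, t]) h s = 0.
Proof.
move=> ih h0.
have mI : measurable (`[0, T]%classic : set (measurableTypeR R)) by exact: measurable_itv.
have mh : measurable_fun `[0, T] h by apply/measurable_EFinP; exact: (measurable_int mu ih).
have mc n : measurable_fun `[0, T] (cutoff n) by exact: (primitive_measurable T0 (cutoff_primitive n)).
have mi : measurable_fun `[0, T] (\1_(`[0, t]%classic : set R) : R -> R).
  by apply: measurable_funTS; exact: measurable_indic.
have cv : {ae mu, forall s, `[0, T]%classic s ->
    (fun n => cutoff n s * h s) @ \oo --> \1_(`[0, t]%classic : set R) s * h s}.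
  apply: aeW => s; rewrite /= in_itv/= => /andP[s0 _].
  by apply: cvgMr_tmp; exact: cutoff_cvg.
have bd n s : `[0, T]%classic s -> `|cutoff n s * h s| <= `|h s|.
  move=> _; rewrite normrM ler_piMl// ger0_norm; by case/andP: (cutoff_bounded n s).
have [_] := cvg_Rintegral_dominated mI (fun n => measurable_funM (mc n) mh) (measurable_funM mi mh)
  cv (integrable_norm ih) bd.
rewrite (_ : (fun n => _) = cst 0); last by apply/funext => n; exact: h0.
move=> /(cvg_lim (@Rhausdorff R)); rewrite lim_cst// => e.
rewrite [RHS]e Rintegral_mkcond [RHS]Rintegral_mkcond; apply: eq_Rintegral => s _.
rewrite !patchE /= indicE !mem_setE !in_itv/=.
case: (leP 0 s) => //= s0; case: (leP s t) => st; rewrite ?mul1r ?mul0r ?if_same//.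
by rewrite (le_trans st (ltW tT)).
Qed.

End cutoff.

Section field_operations.
Context {R : realType} {J : finType}.
Notation poly2 := {poly {poly R}}.
Variables (T : R) (N : nat).
Hypothesis T0 : 0 < T.
Implicit Types (x y : R -> J -> poly2).

Lemma coef_scale (p : poly2) (e : R) i j : (e%:P *: p)`_j`_i = e * p`_j`_i.
Proof. by rewrite coefZ coefCM. Qed.

Lemma L2_fieldsB x y : L2_fields T N x -> L2_fields T N y -> L2_fields T N (fun t s => x t s - y t s).
Proof.
move=> xL yL s; have [xN xs] := xL s; have [yN ys] := yL s; split=> [t tT i j ij|i j].
  by rewrite !coefB xN// yN// subrr.
have := L2_timeD (xs i j) (L2_timeZ (-1) (ys i j)).
by congr (L2_time T); apply/funext => t; rewrite !coefB mulN1r.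
Qed.

Lemma L2_fields_scale (h : R -> R) (M : R) x : measurable_fun `[0, T] h ->
  (forall t, t \in `[0, T] -> `|h t| <= M) -> L2_fields T N x ->
  L2_fields T N (fun t s => (h t)%:P *: x t s).
Proof.
move=> mh hM xL s; have [xN xs] := xL s; split=> [t tT i j ij|i j].
  by rewrite coef_scale xN// mulr0.
have := L2_time_bndM mh hM (xs i j).
by congr (L2_time T); apply/funext => t; rewrite coef_scale.
Qed.

Lemma H1_fieldsB x x' y y' : H1_fields T N x x' -> H1_fields T N y y' ->
  H1_fields T N (fun t s => x t s - y t s) (fun t s => x' t s - y' t s).
Proof.
move=> [xN xL xH] [yN yL yH]; split.
- by move=> s t tT i j ij; rewrite !coefB xN// yN// subrr.
- exact: L2_fieldsB.
- move=> s i j; apply: (primitive_eq T0 _ _ (primitiveD (xH s i j) (primitiveZ (-1) (yH s i j)))) => t _;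
    by rewrite !coefB mulN1r.
Qed.

End field_operations.

Section energy_identity.
Context {R : realType}.
Notation mu := (@lebesgue_measure R).
Notation poly2 := {poly {poly R}}.
Variables (a b c d T alpha beta : R).
Hypothesis T0 : 0 < T.
Hypotheses (halpha : 1 < alpha <= 2) (hbeta : 1 < beta <= 2).
Variables (K N : nat) (D : 'I_K -> triangle R).
Hypothesis hD : triangulation a b c d D.

Let D0 k : area2 (D k) != 0. Proof. by case: hD. Qed.
Let mI : measurable (`[0, T]%classic : set (measurableTypeR R)). Proof. exact: measurable_itv. Qed.

Definition mass_form (v w : 'I_K -> poly2) := \sum_(k < K) triangle_int (D k) (v k * w k).

Lemma bilinear_mass_form : bilinear_form mass_form.
Proof.
apply: bilinear_form_sum => k; apply: bilinear_form_functional; first exact: triangle_int_linear.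
by split=> *; rewrite -?mul_polyC; ring.
Qed.

Lemma mass_formC v w : mass_form v w = mass_form w v.
Proof. by apply: eq_bigr => k _; rewrite mulrC. Qed.

Lemma L2_norm_sqr v : L2_norm D v ^+ 2 = mass_form v v.
Proof.
rewrite /L2_norm sqr_sqrtr ?ip_ev//.
by apply: sumr_ge0 => k _; apply: Rintegral_ge0 => z _; rewrite evM -expr2 sqr_ge0.
Qed.

(** Trades the pointwise derivative of the scheme, uncontrolled on a null set, for the measurable
    weak derivative. *)
Lemma Rintegral_dt (u v : t_field R K) ut : H1_fields T N u ut -> L2_fields T N v ->
  \int[mu]_(t in `[0, T]) ip D (dt u t) (evb (v t)) = \int[mu]_(t in `[0, T]) mass_form (ut t) (v t).
Proof.
move=> uH vL; have [Z [mZ Z0 hZ]] := H1_fields_ae_derive uH.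
have [_ utL _] := uH; have iM := integrable_bilinear_form bilinear_mass_form utL vL.
apply: (congr1 fine).
(* The end points are excluded because the two-sided derivative there depends on values of [u]
   outside [[0, T]]. *)
apply: (@ae_integral_nonmeasurable _ _ R mu `[0, T]%classic (Z `|` [set 0; T])) => //.
- apply: measurableU => //; apply: measurableU; exact: measurable_set1.
- apply/negligibleP; first by apply: measurableU => //; apply: measurableU; exact: measurable_set1.
  apply: negligibleU; first exact/negligibleP.
  by apply: negligibleU; apply/negligibleP; [exact: measurable_set1|exact: lebesgue_measure_set1|
    exact: measurable_set1|exact: lebesgue_measure_set1].
- exact: (measurable_int mu iM).
- move=> t; rewrite /= in_itv/= => /andP[t0 tT] tZ; congr EFin.
  have tI : 0 < t < T.
    rewrite !lt_neqAle t0 tT !andbT eq_sym; apply/andP; split; apply/eqP => e; apply: tZ; right;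
      by [left|right].
  rewrite /mass_form -ip_ev; apply: eq_bigr => k _; apply: eq_Rintegral => z _; congr (_ * _).
  by apply: hZ => // h; apply: tZ; left.
Qed.

Variables (f : R -> R * R -> R) (u u' : t_field R K) (p p' q q' : vt_field R K) (ut ut' : t_field R K).
Hypotheses (uH : H1_fields T N u ut) (uH' : H1_fields T N u' ut').
Hypotheses (hp : L2_Vh2 T N p) (hq : L2_Vh2 T N q) (hp' : L2_Vh2 T N p') (hq' : L2_Vh2 T N q').
Hypothesis hsol : solves_scheme a b c d T alpha beta N D f u p q.
Hypothesis hsol' : solves_scheme a b c d T alpha beta N D f u' p' q'.

Definition diff_state (t : R) : fields K :=
  fun s => field_state u p q t s - field_state u' p' q' t s.

Let eu : t_field R K := fun t k => u t k - u' t k.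
Let et : t_field R K := fun t k => ut t k - ut' t k.

Lemma H1_L2_Vh w wt : H1_fields T N w wt -> L2_Vh T N (w : t_field R K).
Proof.
move=> wH; have wL := H1_fields_L2 T0 wH; split=> [t tT k|k i j].
  by have [+ _] := wL k; apply.
by have [_ +] := wL k; apply.
Qed.

Lemma L2_diff_state : L2_fields T N diff_state.
Proof.
by apply: L2_fieldsB => //; apply: L2_fields_state => //; [exact: H1_L2_Vh uH|exact: H1_L2_Vh uH'].
Qed.

Lemma weak_identity (h h' : R -> R) : H1_primitive T h h' ->
  \int[mu]_(t in `[0, T]) (h t * (mass_form (et t) (eu t) +
    form_frac a b c d alpha beta D (diff_state t) (diff_state t))) = 0.
Proof.
move=> hH.
pose E t := diff_state t.
pose v : t_field R K := fun t k => (h t)%:P *: eu t k.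
pose phi : vt_field R K := (fun t k => (- h t)%:P *: cp1 (E t) k, fun t k => (- h t)%:P *: cp2 (E t) k).
pose pi_ : vt_field R K := (fun t k => (h t)%:P *: cq1 (E t) k, fun t k => (h t)%:P *: cq2 (E t) k).
have eH : H1_fields T N eu et by exact: H1_fieldsB.
have vH := H1_fields_scale T0 hH eH.
have hv : H1_Vh T N v.
  have [vN _ vP] := vH; split=> [t tT k|k i j]; first exact: vN.
  by have [gL gE] := vP k i j; exists (fun t => ((h' t)%:P *: eu t k + (h t)%:P *: et t k)`_j`_i).
have [M hM] := primitive_bounded hH; have mh := primitive_measurable T0 hH.
have scaled (g : R -> R) s : measurable_fun `[0, T] g -> (forall t, t \in `[0, T] -> `|g t| <= M) ->
    L2_Vh T N (fun t k => (g t)%:P *: E t (s, k)).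
  move=> mg gM; have gL := L2_fields_scale mg gM L2_diff_state; split=> [t tT k|k i j].
    by have [+ _] := gL (s, k); apply.
  by have [_ +] := gL (s, k); apply.
have mhN : measurable_fun `[0, T] (fun t => - h t) by exact: measurable_funN.
have hMN t : t \in `[0, T] -> `|- h t| <= M by rewrite normrN; exact: hM.
have hphi : L2_Vh2 T N phi by split; exact: scaled.
have hpi : L2_Vh2 T N pi_ by split; exact: scaled.
have XL : L2_fields T N (field_state u p q) by apply: L2_fields_state => //; exact: H1_L2_Vh uH.
have XL' : L2_fields T N (field_state u' p' q') by apply: L2_fields_state => //; exact: H1_L2_Vh uH'.
have YL : L2_fields T N (field_state v phi pi_) by apply: L2_fields_state => //; exact: H1_L2_Vh vH.
have vL : L2_fields T N v by exact: (H1_fields_L2 T0 vH).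
have e1 := etrans (BformE halpha hbeta hD XL YL) (congr1 (+%R^~ _) (Rintegral_dt uH vL)).
have e2 := etrans (BformE halpha hbeta hD XL' YL) (congr1 (+%R^~ _) (Rintegral_dt uH' vL)).
(* Both schemes have the same right-hand side for this test triple, so [f] disappears before any
   integral is manipulated. *)
have e := etrans (esym e1) (etrans (etrans (hsol hv hphi hpi) (esym (hsol' hv hphi hpi))) e2).
move: {e1 e2} e => /= e.
have [_ utL _] := uH; have [_ utL' _] := uH'.
have i1 := integrable_bilinear_form bilinear_mass_form utL vL.
have i1' := integrable_bilinear_form bilinear_mass_form utL' vL.
have bS := bilinear_scheme_form halpha hbeta hD.
have i2 := integrable_bilinear_form bS XL YL; have i2' := integrable_bilinear_form bS XL' YL.
have YE t : field_state v phi pi_ t = fun s => (h t)%:P *: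
    state (cu (E t)) (fun k => - cp1 (E t) k) (fun k => - cp2 (E t) k) (cq1 (E t)) (cq2 (E t)) s.
  apply/funext => -[[[[] []]|] k]; rewrite /field_state /state.
  - by [].
  - by [].
  - by rewrite /phi /= polyCN scaleNr scalerN.
  - by rewrite /phi /= polyCN scaleNr scalerN.
  - by [].
have sE t : scheme_form a b c d alpha beta D (field_state u p q t) (field_state v phi pi_ t) -
    scheme_form a b c d alpha beta D (field_state u' p' q' t) (field_state v phi pi_ t) =
    h t * form_frac a b c d alpha beta D (E t) (E t).
  have [bl br] := bS; rewrite -(additive_homogeneousB _ _ (bl _)).
  rewrite -(scheme_form_diag halpha hbeta hD); have [_ <-] := br (E t).
  by rewrite -YE.
have mE t : mass_form (ut t) (v t) - mass_form (ut' t) (v t) = h t * mass_form (et t) (eu t).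
  have [bl br] := bilinear_mass_form; rewrite -(additive_homogeneousB _ _ (bl _)).
  by have [_ <-] := br (et t).
transitivity (\int[mu]_(t in `[0, T]) ((mass_form (ut t) (v t) - mass_form (ut' t) (v t)) +
  (scheme_form a b c d alpha beta D (field_state u p q t) (field_state v phi pi_ t) -
    scheme_form a b c d alpha beta D (field_state u' p' q' t) (field_state v phi pi_ t)))).
  by apply: eq_Rintegral => t _; rewrite sE mE mulrDr.
rewrite (RintegralD mI (integrableB mI i1 i1') (integrableB mI i2 i2')).
rewrite (RintegralB mI i1 i1') (RintegralB mI i2 i2') addrACA -opprD e subrr.
by [].
Qed.

End energy_identity.

Section energy_balance.
Context {R : realType}.
Notation mu := (@lebesgue_measure R).
Notation poly2 := {poly {poly R}}.
Variables (a b c d T alpha beta : R).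
Hypotheses (halpha : 1 < alpha <= 2) (hbeta : 1 < beta <= 2).
Variables (K N : nat) (D : 'I_K -> triangle R).
Hypothesis hD : triangulation a b c d D.
Variables (f : R -> R * R -> R) (u u' : t_field R K) (p p' q q' : vt_field R K).
Hypotheses (hu : H1_Vh T N u) (hu' : H1_Vh T N u').
Hypotheses (hp : L2_Vh2 T N p) (hq : L2_Vh2 T N q) (hp' : L2_Vh2 T N p') (hq' : L2_Vh2 T N q').
Hypothesis hsol : solves_scheme a b c d T alpha beta N D f u p q.
Hypothesis hsol' : solves_scheme a b c d T alpha beta N D f u' p' q'.

Let eu : t_field R K := fun t k => u t k - u' t k.
Let epx : t_field R K := fun t k => p.1 t k - p'.1 t k.
Let epy : t_field R K := fun t k => p.2 t k - p'.2 t k.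

Definition x_energy t := energy a b (2 - alpha) (plane_fun D (epx t)) (plane_fun D (epx t)).
Definition y_energy t := yenergy c d D (2 - beta) (epy t) (epy t).

Let m01 : 0 <= 2 - alpha < 1. Proof. by apply/andP; case/andP: halpha => ? ?; split; lra. Qed.
Let n01 : 0 <= 2 - beta < 1. Proof. by apply/andP; case/andP: hbeta => ? ?; split; lra. Qed.

Lemma L2_fields_Vh (w : t_field R K) : L2_Vh T N w -> L2_fields T N w.
Proof. by move=> [wN wL] k; split=> [t tT|i j]; [exact: wN|exact: wL]. Qed.

Lemma L2_epx : L2_fields T N epx.
Proof. by case: hp hp' => + _ [+ _] => /L2_fields_Vh hx /L2_fields_Vh hx'; exact: L2_fieldsB. Qed.

Lemma L2_epy : L2_fields T N epy.
Proof. by case: hp hp' => _ + [_ +] => /L2_fields_Vh hx /L2_fields_Vh hx'; exact: L2_fieldsB. Qed.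

Lemma integrable_x_energy : mu.-integrable `[0, T] (EFin \o x_energy).
Proof.
have B : bilinear_form (fun v w : 'I_K -> poly2 => energy a b (2 - alpha) (plane_fun D v) (plane_fun D w)).
  by split=> v; [exact: (energy_linearl hD v m01)|exact: (energy_linearr hD v m01)].
exact: (integrable_bilinear_form B L2_epx L2_epx).
Qed.

Lemma integrable_y_energy : mu.-integrable `[0, T] (EFin \o y_energy).
Proof.
have B : bilinear_form (yenergy c d D (2 - beta)).
  by split=> v; [exact: (yenergy_linearl hD v n01)|exact: (yenergy_linearr hD v n01)].
exact: (integrable_bilinear_form B L2_epy L2_epy).
Qed.

Lemma energy_balance t : 0 < t < T ->
  L2_norm D (eu t) ^+ 2 = L2_norm D (eu 0) ^+ 2
    - 2 * \int[mu]_(s in `[0, t]) x_energy s - 2 * \int[mu]_(s in `[0, t]) y_energy s.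
Proof.
move=> /andP[t0 tT]; have T0 := lt_trans t0 tT.
have [ut uH] := H1_Vh_fields T0 hu; have [ut' uH'] := H1_Vh_fields T0 hu'.
pose et : t_field R K := fun s k => ut s k - ut' s k.
have eH : H1_fields T N eu et by exact: H1_fieldsB.
have [_ etL _] := eH; have euL := H1_fields_L2 T0 eH.
have sub h : mu.-integrable `[0, T] h -> mu.-integrable `[0, t] h.
  by apply: integrableS => //; apply: subset_itv; rewrite bnd_simp// ltW.
have bM := bilinear_mass_form hD.
have iM := integrable_bilinear_form bM etL euL.
have ix := integrable_x_energy; have iy := integrable_y_energy.
have mI (r : R) : measurable (`[0, r]%classic : set (measurableTypeR R)) by exact: measurable_itv.
have iF := integrableD (mI T) ix iy.
have iH := integrableD (mI T) iM iF.
have h0 : \int[mu]_(s in `[0, t]) (mass_form D (et s) (eu s) + (x_energy s + y_energy s)) = 0.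
  apply: (cutoff_vanishing t0 tT iH) => n.
  rewrite -[RHS](weak_identity T0 halpha hbeta hD uH uH' hp hq hp' hq' hsol hsol' (cutoff_primitive T t n)).
  by apply: eq_Rintegral => s _.
have [_ /(_ t)] := bilinear_form_primitive T0 bM eH.
rewrite in_itv/= ltW// ltW// => /(_ isT) e.
have {}e : L2_norm D (eu t) ^+ 2 = L2_norm D (eu 0) ^+ 2 + 2 * \int[mu]_(s in `[0, t]) mass_form D (et s) (eu s).
  rewrite !L2_norm_sqr e; congr (_ + _).
  rewrite -(RintegralZl 2 (mI t) (sub _ iM)); apply: eq_Rintegral => s _.
  by rewrite (mass_formC _ (eu s)) mulr_natl mulr2n.
move: h0; rewrite (RintegralD (mI t) (sub _ iM) (sub _ iF)) (RintegralD (mI t) (sub _ ix) (sub _ iy)) => /eqP.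
by rewrite e addr_eq0 => /eqP ->; rewrite mulrN mulrDr opprD addrA.
Qed.

(** The general identity at [m = 2 - alpha]; the sign of the angle is absorbed by the parity of the
    cosine. *)
Lemma x_energy_Hneg t : (\int[mu]_(y in `[c, d]) (Hneg_norm (1 - alpha / 2) (fun x => to_fun D (epx t) x y) ^+ 2))%E =
  ((cos ((alpha / 2 - 1) * pi))^-1 * x_energy t)%:E.
Proof.
have -> : 1 - alpha / 2 = (2 - alpha) / 2 by field.
have -> : (alpha / 2 - 1) * pi = - ((2 - alpha) * (pi / 2)) by field.
by rewrite cosN; exact: Hneg_slices1.
Qed.

Lemma y_energy_Hneg t : (\int[mu]_(x in `[a, b]) (Hneg_norm (1 - beta / 2) (fun y => to_fun D (epy t) x y) ^+ 2))%E =
  ((cos ((beta / 2 - 1) * pi))^-1 * y_energy t)%:E.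
Proof.
have -> : 1 - beta / 2 = (2 - beta) / 2 by field.
have -> : (beta / 2 - 1) * pi = - ((2 - beta) * (pi / 2)) by field.
by rewrite cosN; exact: Hneg_slices2.
Qed.

Lemma cos_order_gt0 (r : R) : 1 < r <= 2 -> 0 < cos ((r / 2 - 1) * pi).
Proof.
move=> /andP[r1 r2]; have p0 := pi_gt0 R; apply: cos_gt0_pihalf; apply/andP; split; nra.
Qed.

Lemma integral_energy (g : R -> R) (k t : R) : 0 < t < T -> k != 0 -> mu.-integrable `[0, T] (EFin \o g) ->
  ((2 * k)%:E * \int[mu]_(s in `[0%R, t]) (k^-1 * g s)%:E)%E = (2 * \int[mu]_(s in `[0, t]) g s)%:E.
Proof.
move=> /andP[t0 tT] k0 ig.
have mI : measurable (`[0, t]%classic : set (measurableTypeR R)) by exact: measurable_itv.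
have {}ig : mu.-integrable `[0, t] (EFin \o g).
  by apply: integrableS ig => //; apply: subset_itv; rewrite bnd_simp// ltW.
have ik := integrableZl mI k^-1 ig.
rewrite -[X in (_ * X)%E]fineK; last exact: (integrable_fin_num mI ik).
rewrite -EFinM -[fine _]/(\int[mu]_(s in `[0, t]) (k^-1 * g s)) RintegralZl//.
by congr EFin; field.
Qed.

Lemma x_dissipation t : 0 < t < T ->
  ((2 * cos ((alpha / 2 - 1) * pi))%:E * \int[mu]_(tau in `[0%R, t])
    \int[mu]_(y in `[c, d]) Hneg_norm (1 - alpha / 2) (fun x => to_fun D (epx tau) x y) ^+ 2)%E =
  (2 * \int[mu]_(s in `[0, t]) x_energy s)%:E.
Proof.
move=> tT; rewrite -(integral_energy tT (lt0r_neq0 (cos_order_gt0 halpha)) integrable_x_energy).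
by congr (_ * _)%E; apply: eq_integral => s _; exact: x_energy_Hneg.
Qed.

Lemma y_dissipation t : 0 < t < T ->
  ((2 * cos ((beta / 2 - 1) * pi))%:E * \int[mu]_(tau in `[0%R, t])
    \int[mu]_(x in `[a, b]) Hneg_norm (1 - beta / 2) (fun y => to_fun D (epy tau) x y) ^+ 2)%E =
  (2 * \int[mu]_(s in `[0, t]) y_energy s)%:E.
Proof.
move=> tT; rewrite -(integral_energy tT (lt0r_neq0 (cos_order_gt0 hbeta)) integrable_y_energy).
by congr (_ * _)%E; apply: eq_integral => s _; exact: y_energy_Hneg.
Qed.

End energy_balance.

Theorem theorem4p2 (R : realType) (a b c d T alpha beta : R)
  (hab : a < b) (hcd : c < d) (hT : 0 < T)
  (halpha : 1 < alpha <= 2) (hbeta : 1 < beta <= 2)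
  (K N : nat) (D : 'I_K -> triangle R) (hD : triangulation a b c d D)
  (f : R -> R * R -> R)
  (u u' : t_field R K) (p p' q q' : vt_field R K)
  (hu : H1_Vh T N u) (hp : L2_Vh2 T N p) (hq : L2_Vh2 T N q)
  (hu' : H1_Vh T N u') (hp' : L2_Vh2 T N p') (hq' : L2_Vh2 T N q')
  (hsol : solves_scheme a b c d T alpha beta N D f u p q)
  (hsol' : solves_scheme a b c d T alpha beta N D f u' p' q') :
  let eu : t_field R K := fun t k => u t k - u' t k in
  let epx : t_field R K := fun t k => p.1 t k - p'.1 t k in
  let epy : t_field R K := fun t k => p.2 t k - p'.2 t k in
  (forall t, 0 < t < T -> L2_norm D (eu t) <= L2_norm D (eu 0)) /\
  (forall t, 0 < t < T ->
    (((L2_norm D (eu t)) ^+ 2)%:E =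
     ((L2_norm D (eu 0)) ^+ 2)%:E
     - (2 * cos ((alpha / 2 - 1) * pi))%:E *
       \int[lebesgue_measure]_(tau in `[0%R, t])
         \int[lebesgue_measure]_(y in `[c, d])
           Hneg_norm (1 - alpha / 2) (fun x => to_fun D (epx tau) x y) ^+ 2
     - (2 * cos ((beta / 2 - 1) * pi))%:E *
       \int[lebesgue_measure]_(tau in `[0%R, t])
         \int[lebesgue_measure]_(x in `[a, b])
           Hneg_norm (1 - beta / 2) (fun y => to_fun D (epy tau) x y) ^+ 2)%E).
Proof.
move=> eu epx epy.
have cx := cos_order_gt0 halpha; have cy := cos_order_gt0 hbeta.
have bal := energy_balance halpha hbeta hD hu hu' hp hq hp' hq' hsol hsol'.
split=> t tT; last first.
  rewrite (x_dissipation halpha hD hp hp' tT) (y_dissipation hbeta hD hp hp' tT).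
  by rewrite -!EFinB -(bal t tT).
(* The energies are seen to be nonnegative through their expression as an integral of squared norms
   times a positive cosine. *)
have e0 (g k : R) : 0 < k -> (0 <= (k^-1 * g)%:E)%E -> 0 <= g.
  by move=> k0; rewrite lee_fin pmulr_rge0 ?invr_gt0.
have x0 s : 0 <= x_energy a b alpha D p p' s.
  apply: (e0 _ _ cx); rewrite -(x_energy_Hneg halpha hD p p').
  by apply: integral_ge0 => y _; rewrite sqre_ge0 ?Lnorm_ge0.
have y0 s : 0 <= y_energy c d beta D p p' s.
  apply: (e0 _ _ cy); rewrite -(y_energy_Hneg hbeta hD p p').
  by apply: integral_ge0 => x _; rewrite sqre_ge0 ?Lnorm_ge0.
rewrite -ler_sqr ?nnegrE ?sqrtr_ge0// (bal t tT) -addrA gerDl -opprD oppr_le0.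
by rewrite addr_ge0// mulr_ge0// Rintegral_ge0.
Qed.
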